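(* The Min Tree Length problem is NP-hard for the class of simple graphs: given a finite simple graph $G$, finding a tree layout $(T,\varphi)$ of $G$ minimizing $L(T,\varphi,G)$ is NP-hard.
   Context: A tree layout of a graph $G$ is a pair $(T,\varphi)$ where $T$ is a tree all of whose nodes have degree $1$ or $3$ and $\varphi:V(G)\to V_L(T)$ is a bijection onto the set of leaves of $T$. Its length is $L(T,\varphi,G)=\sum_{\{u,v\}\in E(G)} d_T(\varphi(u),\varphi(v))$, where $d_T$ is the path distance in $T$. The Min Tree Length problem asks, given $G$, for a tree layout of minimum length. *)

(* Defs.v *)
From HB Require Import structures.
From mathcomp Require Import all_boot all_algebra.

Set Implicit Arguments.
Unset Strict Implicit.
Unset Printing Implicit Defensive.

(** * Graphs and tree layouts *)

Record sgraph (V : finType) := SGraph {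
  adj :> rel V;
  adj_sym : symmetric adj;
  adj_irrefl : irreflexive adj
}.

Definition degree (V : finType) (G : sgraph V) (x : V) : nat :=
  #|[set y | G x y]|.

(* A two-vertex [ucycle] is an edge traversed back and forth, so only cycles
   on at least three vertices are excluded. *)
Definition is_tree (V : finType) (G : sgraph V) : Prop :=
  [/\ 0 < #|V|,
      forall x y : V, connect G x y
    & forall c : seq V, 2 < size c -> ~ ucycle G c].

(* The number of edges of a shortest path from [x] to [y]; by convention it is
   [#|V|] when [x] and [y] are not connected. *)
Definition dist (V : finType) (G : sgraph V) (x y : V) : nat :=
  find (fun k => [exists p : k.-tuple V, path G x p && (last x p == y)])
       (iota 0 #|V|).

Definition tree_layout (V N : finType) (G : sgraph V) (T : sgraph N)
    (phi : V -> N) : Prop :=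
  [/\ is_tree T,
      forall a : N, degree T a = 1 \/ degree T a = 3,
      injective phi
    & forall a : N, a \in codom phi <-> degree T a = 1].

(* The condition [u < v] selects each edge {u, v} exactly once. *)
Definition layout_length (n : nat) (N : finType) (G : sgraph 'I_n)
    (T : sgraph N) (phi : 'I_n -> N) : nat :=
  \sum_(u < n) \sum_(v < n | (u < v) && G u v) dist T (phi u) (phi v).

Definition min_tree_layout (n : nat) (N : finType) (G : sgraph 'I_n)
    (T : sgraph N) (phi : 'I_n -> N) : Prop :=
  tree_layout G T phi /\
  forall (N' : finType) (T' : sgraph N') (phi' : 'I_n -> N'),
    tree_layout G T' phi' ->
    layout_length G T phi <= layout_length G T' phi'.

(** * Deterministic multitape Turing machines with an oracle *)

(* [None] is the blank, [Some (inl b)] a bit of an input, a query or an answer,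
   [Some (inr a)] a further working symbol. *)
Definition symbol (A : finType) : finType := option (bool + A).

Inductive move := MoveLeft | Stay | MoveRight.

(* There are at least two tapes.  Tape 0 holds the input; tape 1 holds the
   second input, if any, and serves as the oracle tape.
   [verdict q = Some b] means that [q] is halting, accepting if [b] holds and
   rejecting otherwise; [ask q = Some q'] means that the machine queries the
   oracle in state [q] and goes on in state [q']. *)
Record machine := Machine {
  aux : finType;
  state : finType;
  extra_tapes : nat;
  start : state;
  verdict : state -> option bool;
  ask : state -> option state;
  delta : state -> {ffun 'I_extra_tapes.+2 -> symbol aux} ->
          state * ('I_extra_tapes.+2 -> symbol aux * move)
}.

Definition oracle_free (M : machine) : Prop := forall q : state M, ask q = None.

(* A two-way infinite tape: the cells to the left of the head, nearest first,
   and the cells from the head rightwards; all cells not listed are blank. *)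
Definition tape (A : finType) : Type := (seq (symbol A) * seq (symbol A))%type.

Definition tape_read (A : finType) (t : tape A) : symbol A := head None t.2.

Definition tape_update (A : finType) (t : tape A) (w : symbol A * move) :
    tape A :=
  let r := w.1 :: behead t.2 in
  match w.2 with
  | MoveLeft => (behead t.1, head None t.1 :: r)
  | Stay => (t.1, r)
  | MoveRight => (w.1 :: t.1, behead r)
  end.

Definition tape_of_word (A : finType) (w : seq bool) : tape A :=
  ([::], [seq Some (inl b) | b <- w]).

(* The bits from the head rightwards, up to the first cell without a bit. *)
Fixpoint leading_bits (A : finType) (s : seq (symbol A)) : seq bool :=
  if s is Some (inl b) :: s' then b :: leading_bits s' else [::].

Definition config (M : machine) : Type :=
  (state M * ('I_(extra_tapes M).+2 -> tape (aux M)))%type.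

Definition init (M : machine) (x y : seq bool) : config M :=
  (start M, fun i => match val i with
                     | 0 => tape_of_word _ x
                     | 1 => tape_of_word _ y
                     | _ => tape_of_word _ [::]
                     end).

(* A query replaces the word on the oracle tape by the oracle's answer, in a
   single step. *)
Definition step (O : seq bool -> seq bool) (M : machine) (c : config M) :
    config M :=
  if verdict c.1 is Some _ then c
  else if ask c.1 is Some q' then
    (q', fun i => if val i == 1
                  then tape_of_word _ (O (leading_bits (c.2 i).2))
                  else c.2 i)
  else
    let act := delta c.1 [ffun i => tape_read (c.2 i)] in
    (act.1, fun i => tape_update (c.2 i) (act.2 i)).

Definition halts_within (O : seq bool -> seq bool) (M : machine)
    (x y : seq bool) (b : bool) (t : nat) : Prop :=
  verdict (iter t (@step O M) (init M x y)).1 = Some b.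

(** * NP-hardness of search problems *)

Definition language : Type := seq bool -> Prop.

Definition no_oracle : seq bool -> seq bool := fun=> [::].

Definition in_NP (L : language) : Prop :=
  exists (M : machine) (p q : {poly nat}),
    [/\ oracle_free M,
        forall x y : seq bool, exists b : bool,
          halts_within no_oracle M x y b p.[(size x + size y)%N]%R
      & forall x : seq bool,
          L x <-> exists y : seq bool,
            size y <= q.[size x]%R /\
            exists t : nat, halts_within no_oracle M x y true t].

(* [R x y] means that [y] is a solution of the instance [x]. *)
Definition search_problem : Type := seq bool -> seq bool -> Prop.

(* Nothing is required on words that encode no instance or an instance without
   a solution; otherwise no oracle might exist at all. *)
Definition solves (O : seq bool -> seq bool) (R : search_problem) : Prop :=
  forall x : seq bool, (exists y, R x y) -> R x (O x).

(* Polynomial-time Turing reducibility: a single machine and a single time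
   bound must work for all oracles that solve [R]. *)
Definition turing_reducible (L : language) (R : search_problem) : Prop :=
  exists (M : machine) (p : {poly nat}),
    forall O : seq bool -> seq bool, solves O R ->
    forall x : seq bool, exists b : bool,
      halts_within O M x [::] b p.[size x]%R /\ (b <-> L x).

Definition NP_hard (R : search_problem) : Prop :=
  forall L : language, in_NP L -> turing_reducible L R.

(** * The search problem Min Tree Length *)

Definition code_nat (k : nat) : seq bool := rcons (nseq k true) false.

Definition code_graph (n : nat) (G : sgraph 'I_n) : seq bool :=
  code_nat n ++ [seq G u v | u <- enum 'I_n, v <- enum 'I_n].

Definition code_layout (n m : nat) (T : sgraph 'I_m) (phi : 'I_n -> 'I_m) :
    seq bool :=
  code_graph T ++ flatten [seq code_nat (phi u) | u <- enum 'I_n].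

(* Graphs with fewer than two vertices have no tree layout, since every tree
   whose nodes have degree 1 or 3 has at least two leaves. *)
Definition MinTreeLength : search_problem := fun x y =>
  exists (n : nat) (G : sgraph 'I_n) (m : nat) (T : sgraph 'I_m)
         (phi : 'I_n -> 'I_m),
    [/\ x = code_graph G, y = code_layout T phi & min_tree_layout G T phi].

(* Main.v *)
(* Let L be in NP.  The accepting tableaux of a verifier for L on x are encoded
   as the proper 3-colourings of a graph H on n = 3 * 2^(k+1) vertices, all but a
   small fraction of which are isolated, and the oracle is asked for an optimal
   layout of the complement G of H.  The length of G is the sum of the distances
   between all pairs of leaves, minus the sum over the edges of H.  The former
   sum is smallest when the tree consists of three complete binary trees of equal
   size joined at a centre; and an edge of H contributes at most the depths of
   its two ends, with equality iff they lie in different branches at the centre.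
   Rooting an arbitrary layout at a median of its leaves, one bounds the length
   from below by means of a convex piecewise linear potential, for the pairs, and
   of Kraft's equality, for the depths.  If H is 3-colourable, the bound is
   attained by placing the colour classes of H in different branches, so that
   every optimal layout has a node whose three branches split all edges of H.
   A machine therefore decides whether x is in L by testing whether the layout it
   is given has such a node.  The query and the test are written in a language of
   bounded loops, which is compiled to multitape machines. *)

Require Import Defs.
From mathcomp Require Import all_boot all_order all_algebra zify ring lra.
From Stdlib Require Import FunctionalExtensionality.

Set Implicit Arguments.
Unset Strict Implicit.
Unset Printing Implicit Defensive.

Import Order.TTheory GRing.Theory Num.Theory.

(** * Rooted trees *)

(** Deep leaves are costly as ends of pairs, but every edge of H makes the depths of its two ends
    count negatively, so the pairs and the edges cannot be bounded independently: both bounds draw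
    on the same depths. Write s(x) for the number of leaves below the edge above x. The sum over all
    pairs is that of s(x) (n - s(x)), and the sum of the depths is that of s(x). If D bounds the
    degrees d(u) in H, the former splits into the sum of (n - 2 D) s(x) - s(x)^2, which the
    potential bounds, and 2 D times the sum of the depths. Once the edges of H are subtracted, the
    depth of u keeps the weight 2 D - d(u), between D and 2 D; weights within a factor of 2 are what
    Kraft's equality tolerates in favour of equal depths. The potential survives the loss of 2 D as
    long as 4 D <= 2^(k+1), which is what the isolated vertices are for. They also fill up the
    colour classes, whose sizes are unknown, to three equal branches. The median keeps each branch
    within half of the leaves, the range in which the potential works. *)

Section Dist.
Variables (V : finType) (T : sgraph V).

(** [find] never exceeds [#|V|], which settles the paths too long for the range that is searched. *)
Lemma dist_path x p : path T x p -> dist T x (last x p) <= size p.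
Proof.
move=> xp; rewrite /dist; set a := (fun k => _).
have [sp|sp] := ltnP (size p) #|V|; last first.
  by apply: leq_trans sp; rewrite -[X in _ <= X](size_iota 0) find_size.
rewrite leqNgt; apply/negP => /(before_find 0%N).
rewrite nth_iota // add0n /a => /existsP[]; exists (in_tuple p).
by rewrite xp eqxx.
Qed.

Hypothesis conn : forall x y, connect T x y.

Lemma dist_pathP x y : exists p, [/\ path T x p, last x p = y & size p = dist T x y].
Proof.
have [p xp yp]: exists2 p, path T x p & y = last x p by apply/connectP.
move: xp yp; case/shortenP => q xq uq _ ->.
have sq : size q < #|V|.
  by move/card_uniqP: uq (max_card (mem (x :: q))) => ->.
set a := (fun k => [exists p : k.-tuple V, path T x p && (last x p == last x q)]).
have hq : has a (iota 0 #|V|).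
  apply/hasP; exists (size q); first by rewrite mem_iota add0n sq.
  by apply/existsP; exists (in_tuple q); rewrite xq eqxx.
have := nth_find 0%N hq; rewrite has_find size_iota in hq.
rewrite nth_iota // add0n => /existsP[t /andP[xt /eqP lt]].
by exists t; rewrite size_tuple lt.
Qed.

Lemma dist_tri1 x y z : T x y -> dist T x z <= (dist T y z).+1.
Proof.
move=> xy; have [p [yp <- <-]] := dist_pathP y z.
by have /= := @dist_path x (y :: p); rewrite xy yp => ->.
Qed.

Lemma dist0 x : dist T x x = 0.
Proof. by apply/eqP; rewrite -leqn0; apply: (@dist_path x [::]). Qed.

End Dist.

(** A rooting in local terms, which covers both the distances to a node of a given tree and the
    explicit formulas for the balanced tree. The value of [par] at the root is arbitrary. *)
Record rooted (V : finType) (T : sgraph V) (r : V) (par : V -> V)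
    (dep : V -> nat) : Prop := Rooted {
  rt_root : dep r = 0;
  rt_adj : forall x, x != r -> T x (par x);
  rt_dep : forall x, x != r -> dep x = (dep (par x)).+1;
  rt_edge : forall x y, T x y -> (x != r) && (y == par x) || (y != r) && (x == par y)
}.

(** [par x] is a neighbour nearer to [r]. An edge not of the form {x, par x} would close a cycle
    with the simple path that joins its ends through such edges; this path has at least three
    vertices, since a single step would be the edge itself. *)
Lemma tree_rooted (V : finType) (T : sgraph V) (r : V) : is_tree T ->
  exists par, rooted T r par (fun x => dist T x r).
Proof.
case=> _ conn acyc.
pose par x := odflt x [pick y | T x y && (dist T y r < dist T x r)].
have parP x : x != r -> T x (par x) && (dist T (par x) r < dist T x r).
  move=> xr; rewrite /par; case: pickP => //= none.
  have [[|y p] [/= xp lx sx]] := dist_pathP conn x r.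
    by rewrite lx eqxx in xr.
  case/andP: xp => xy yp; move: (none y); rewrite xy /= -sx ltnS -lx.
  by rewrite dist_path.
have par_adj x : x != r -> T x (par x) by case/parP/andP.
have par_dep x : x != r -> dist T x r = (dist T (par x) r).+1.
  move=> xr; apply/eqP; rewrite eqn_leq; case/andP: (parP x xr) => a ->.
  by rewrite dist_tri1.
exists par; split=> //; first exact: dist0.
move=> x y xy; apply/negPn/negP; rewrite negb_or => /andP[nx ny].
pose R u v := ((u != r) && (v == par u)) || ((v != r) && (u == par v)).
have symR : connect_sym R by apply: sym_connect_sym => u v; rewrite /R orbC.
have toR u : connect R u r.
  have [k] := ubnP (dist T u r); elim: k u => // k IH u.
  have [->|ur] := eqVneq u r; first by rewrite connect0.
  rewrite par_dep // ltnS => /IH; apply: connect_trans.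
  by apply: connect1; rewrite /R ur eqxx.
have : connect R x y by apply: connect_trans (toR x) _; rewrite symR.
case/connectP => p xp yp; move: xp yp; case/shortenP => q xq uq _ yq.
apply: (acyc (x :: q)).
  case: q xq uq yq => [|z [|w q]] //= xq uq yq.
    by rewrite yq adj_irrefl in xy.
  by rewrite andbT -yq /R (negPf nx) (negPf ny) in xq.
rewrite /ucycle uq andbT /= rcons_path -yq adj_sym xy andbT.
apply: sub_path xq => u v /orP[] /andP[n /eqP->]; first exact: par_adj.
by rewrite adj_sym par_adj.
Qed.

Section Rooted.
Variables (V : finType) (T : sgraph V) (r : V) (par : V -> V) (dep : V -> nat).
Hypothesis RT : rooted T r par dep.

(** The root is left out because a node stands for the edge to its parent: [ancs x] is the set of
    edges between [x] and the root, and distances become sizes of symmetric differences. *)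
Definition ancs (x : V) : {set V} := [set z in traject par x (dep x)].

Lemma ancs_root : ancs r = set0.
Proof. by rewrite /ancs (rt_root RT); apply/setP => z; rewrite !inE. Qed.

Lemma ancsU x : x != r -> ancs x = x |: ancs (par x).
Proof. by move=> xr; rewrite /ancs (rt_dep RT xr) trajectS; apply/setP => z; rewrite !inE. Qed.

Lemma rt_ind (P : V -> Prop) : P r -> (forall x, x != r -> P (par x) -> P x) ->
  forall x, P x.
Proof.
move=> Pr IH x; have [k] := ubnP (dep x); elim: k x => // k IHk x.
have [->//|xr] := eqVneq x r; rewrite (rt_dep RT) // ltnS => /IHk.
exact: IH.
Qed.

Lemma ancs_dep x y : y \in ancs x -> dep y <= dep x.
Proof.
elim/rt_ind: x => [|x xr IH]; first by rewrite ancs_root inE.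
by rewrite ancsU // => /setU1P[->//|/IH]; rewrite (rt_dep RT xr); apply: leqW.
Qed.

Lemma notin_ancs_par x : x != r -> x \notin ancs (par x).
Proof. by move=> xr; apply/negP => /ancs_dep; rewrite (rt_dep RT xr) ltnn. Qed.

Lemma card_ancs x : #|ancs x| = dep x.
Proof.
elim/rt_ind: x => [|x xr IH]; first by rewrite ancs_root cards0 (rt_root RT).
by rewrite ancsU // cardsU1 notin_ancs_par // IH (rt_dep RT xr).
Qed.

Lemma root_notin_ancs x : r \notin ancs x.
Proof.
elim/rt_ind: x => [|x xr IH]; first by rewrite ancs_root inE.
by rewrite ancsU // in_setU1 negb_or eq_sym xr.
Qed.

Lemma ancs_self x : x != r -> x \in ancs x.
Proof. by move=> xr; rewrite ancsU // setU11. Qed.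

Lemma ancs_sub x y : y \in ancs x -> ancs y \subset ancs x.
Proof.
elim/rt_ind: x => [|x xr IH]; first by rewrite ancs_root inE.
rewrite [ancs x]ancsU // => /setU1P[->|/IH s]; first by rewrite ancsU.
exact: subset_trans s (subsetUr _ _).
Qed.

Definition kids (x : V) : {set V} := [set y | (y != r) && (par y == x)].

Lemma card_kids x : x != r -> #|kids x| = (degree T x).-1.
Proof.
move=> xr; have -> : degree T x = #|par x |: kids x|.
  apply: eq_card => y; rewrite !inE; apply/idP/idP.
    by case/(rt_edge RT)/orP => /andP[h /eqP->]; rewrite ?h eqxx ?orbT.
  by case/orP => [/eqP->|/andP[yr /eqP<-]]; [|rewrite adj_sym]; apply: (rt_adj RT).
rewrite cardsU1; suff -> : par x \notin kids x by [].
apply/negP; rewrite inE => /andP[p /eqP e].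
by have := rt_dep RT p; rewrite e (rt_dep RT xr); lia.
Qed.

Lemma card_kids_root : #|kids r| = degree T r.
Proof.
apply: eq_card => y; rewrite !inE; apply/idP/idP.
  by case/andP => yr /eqP<-; rewrite adj_sym (rt_adj RT).
case/(rt_edge RT)/orP => /andP[h /eqP e]; first by rewrite eqxx in h.
by rewrite h -e eqxx.
Qed.

Lemma ancs_kids x u : x != r ->
  (x \in ancs u) = (x == u) || [exists y in kids x, y \in ancs u].
Proof.
move=> xr; elim/rt_ind: u => [|u ur IH].
  rewrite (negPf xr) ancs_root in_set0; apply/esym/existsP => -[y].
  by rewrite in_set0 andbF.
rewrite ancsU // in_setU1; have [//|xu] := eqVneq x u; rewrite IH /=.
apply/idP/existsP => [/orP[/eqP->|/existsP[y /andP[yx yu]]]|[y /andP[yx]]].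
- by exists u; rewrite !inE ur !eqxx.
- by exists y; rewrite in_setU1 yx yu orbT.
rewrite in_setU1 => /predU1P[e|yu]; first by move: yx; rewrite e inE => /andP[_ /eqP->]; rewrite eqxx.
by apply/orP; right; apply/existsP; exists y; rewrite yx.
Qed.

Lemma ancs_root_kid u : u != r -> exists2 y, y \in kids r & y \in ancs u.
Proof.
elim/rt_ind: u => [|u ur IH _]; first by rewrite eqxx.
have [e|p] := eqVneq (par u) r.
  by exists u; [rewrite inE ur e eqxx | rewrite ancs_self].
by have [y ry yu] := IH p; exists y => //; rewrite ancsU // in_setU1 yu orbT.
Qed.

Lemma kids_ancs_uniq x y z u : y \in kids x -> z \in kids x ->
  y \in ancs u -> z \in ancs u -> y = z.
Proof.
rewrite ![_ \in kids x]inE => /andP[yr /eqP py] /andP[zr /eqP pz].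
elim/rt_ind: u => [|u ur IH]; first by rewrite ancs_root in_set0.
rewrite ancsU // !in_setU1 => /predU1P[eu|yu] /predU1P[zu|zu] //.
- by rewrite eu.
- by have := ancs_dep zu; rewrite (rt_dep RT zr) pz -py eu ltnn.
- by have := ancs_dep yu; rewrite (rt_dep RT yr) py -pz zu ltnn.
- exact: IH.
Qed.

Definition sdist u v := #|ancs u :\: ancs v| + #|ancs v :\: ancs u|.

Lemma sdist_edge x y : T x y -> sdist x y = 1.
Proof.
wlog /andP[xr /eqP->] : x y / (x != r) && (y == par x) => [H|_].
  move=> xy; case/orP: (rt_edge RT xy) => h; first exact: H.
  by rewrite /sdist addnC; apply: H; rewrite // adj_sym.
rewrite /sdist ancsU // setDUl setDv setU0 [X in _ + #|pred_of_set X|](_ : _ = set0).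
  rewrite cards0 addn0 -(cards1 x); congr #|pred_of_set _|.
  by apply/setDidPl; rewrite disjoints1 notin_ancs_par.
by apply/eqP; rewrite setD_eq0 subsetUr.
Qed.

Lemma sdist_tri x y z : sdist x z <= sdist x y + sdist y z.
Proof.
have D (A B C : {set V}) : #|A :\: C| <= #|A :\: B| + #|B :\: C|.
  apply: leq_trans (leq_card_setU _ _).1; apply: subset_leq_card.
  by apply/subsetP => w; rewrite !inE => /andP[-> ->]; case: (w \in B).
by rewrite /sdist; have := D (ancs x) (ancs y) (ancs z); have := D (ancs z) (ancs y) (ancs x); lia.
Qed.

Lemma rooted_connect x y : connect T x y.
Proof.
have toR u : connect T u r.
  elim/rt_ind: u => // u ur; apply: connect_trans.
  by apply: connect1; apply: (rt_adj RT).
apply: connect_trans (toR x) _; rewrite (sym_connect_sym (adj_sym T)).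
exact: toR.
Qed.

(** For the upper bound, an end that is not an ancestor of the other is moved to its parent, which
    lowers [sdist] by one; once it is the root, the depth of the other end bounds the distance. For
    the lower bound, [sdist] satisfies the triangle inequality and is 1 on edges. *)
Lemma dist_sdist x y : dist T x y = sdist x y.
Proof.
apply/eqP; rewrite eqn_leq; apply/andP; split.
  have [k] := ubnP (sdist x y); elim: k x y => // k IH x y lk.
  have [->|xy] := eqVneq x y; first by rewrite dist0 //; apply: rooted_connect.
  wlog xny : x y lk xy / x \notin ancs y => [H|].
    have [xy'|/H] := boolP (x \in ancs y); last exact.
    have sym u v : sdist u v = sdist v u by rewrite /sdist addnC.
    have dsym u v : dist T u v <= dist T v u.
      have [p [vp lp <-]] := dist_pathP rooted_connect v u.
      have := @dist_path _ T (last v p) (rev (belast v p)).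
      rewrite rev_path size_rev size_belast (eq_path (e':=T)) => [/(_ vp)|]; last first.
        by move=> a b; rewrite adj_sym.
      by rewrite -lp; case: p {vp lp} => //= a p; rewrite rev_cons last_rcons.
    rewrite sym; apply: leq_trans (dsym _ _) _; apply: H; rewrite 1?sym 1?eq_sym //.
    apply/negP => yx; have s1 := ancs_sub xy'; have s2 := ancs_sub yx.
    have e : dep x = dep y.
      by apply/eqP; rewrite eqn_leq (ancs_dep xy') (ancs_dep yx).
    have E : ancs x = ancs y by apply/eqP; rewrite eqEsubset s1.
    have xr : x != r by apply: contraTneq xy' => ->; rewrite root_notin_ancs.
    have yr : y != r by apply: contraTneq yx => ->; rewrite root_notin_ancs.
    move: xy'; rewrite ancsU // in_setU1 (negPf xy) /= => /ancs_dep.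
    by rewrite e (rt_dep RT yr) ltnn.
  have [xr|xr] := eqVneq x r; last first.
    have S : sdist x y = (sdist (par x) y).+1.
      rewrite /sdist ancsU // setDUl setDUr -addSn; congr (_ + _).
        rewrite (_ : [set x] :\: ancs y = [set x]); last first.
          by apply/setDidPl; rewrite disjoints1.
        by rewrite cardsU1 in_setD (negPf (notin_ancs_par xr)) andbF.
      congr #|pred_of_set _|; apply/setIidPr; apply/subsetP => w.
      rewrite !in_setD => /andP[_ wy]; rewrite wy andbT in_set1.
      by apply: contraNneq xny => <-.
    rewrite S; apply: leq_trans (dist_tri1 rooted_connect _ (rt_adj RT xr)) _.
    by rewrite ltnS; apply: IH; rewrite S ltnS in lk.
  have sym u v : sdist u v = sdist v u by rewrite /sdist addnC.
  have yr : y != r by rewrite -xr eq_sym.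
  suff : dist T x y <= dep y.
    by rewrite /sdist xr ancs_root set0D setD0 cards0 card_ancs.
  rewrite xr; clear -RT; elim/rt_ind: y => [|y yr IH].
    by rewrite dist0 //; apply: rooted_connect.
  rewrite (rt_dep RT yr).
  have [p [vp lp sp]] := dist_pathP rooted_connect r (par y).
  have := @dist_path _ T r (rcons p y); rewrite last_rcons size_rcons rcons_path vp lp /=.
  by rewrite adj_sym (rt_adj RT) // => /(_ isT)/leq_trans; apply; rewrite ltnS sp.
have [p [xp <- <-]] := dist_pathP rooted_connect x y.
elim: p x xp => [|y' p IH] x /=; first by rewrite /sdist !setDv cards0.
case/andP=> xy yp; apply: leq_trans (sdist_tri _ y' _) _.
by rewrite sdist_edge // add1n ltnS IH.
Qed.

End Rooted.

Lemma card_sum (I : finType) (A : {pred I}) : #|A| = \sum_i (i \in A : nat).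
Proof. by rewrite -sum1_card big_mkcond; apply: eq_bigr => i _; case: ifP. Qed.

(** * A lower bound for the length of layouts of dense graphs *)

Section Layout.
Variables (n : nat) (V : finType) (T : sgraph V) (r : V) (par : V -> V) (dep : V -> nat).
Hypothesis RT : rooted T r par dep.
Variable phi : 'I_n -> V.

Notation A u := (ancs par dep (phi u)).

Definition leaves_below (x : V) : nat := \sum_(u < n) (x \in A u).
Notation s := leaves_below.

Lemma leaves_below_root : s r = 0.
Proof. by apply: big1 => u _; rewrite (negPf (root_notin_ancs RT _)). Qed.

Lemma leaves_below_le x : s x <= n.
Proof.
rewrite -[X in _ <= X]card_ord -sum1_card; apply: leq_sum => u _.
by case: (_ \in _).
Qed.

Lemma sum_dep : \sum_u dep (phi u) = \sum_x s x.
Proof.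
rewrite exchange_big /=; apply: eq_bigr => u _.
by rewrite -(card_ancs RT) card_sum.
Qed.

(** Double counting: the edge above [x] is counted for the ordered pairs with the first leaf below
    it and the second one not. *)
Lemma sum_setD : \sum_u \sum_v #|A u :\: A v| = \sum_x s x * (n - s x).
Proof.
under eq_bigr => u _ do under eq_bigr => v _ do rewrite card_sum.
under eq_bigr => u _ do rewrite exchange_big /=.
rewrite exchange_big /=; apply: eq_bigr => x _.
rewrite big_distrl /=; apply: eq_bigr => u _.
have -> : n - s x = \sum_(v < n) (x \notin A v : nat).
  apply/eqP; rewrite -(eqn_add2l (s x)) subnKC ?leaves_below_le // -big_split /=.
  rewrite -[X in X == _]card_ord -sum1_card; apply/eqP/eq_bigr => v _.
  by case: (_ \in _).
rewrite big_distrr /=; apply: eq_bigr => v _.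
by rewrite in_setD; do 2!case: (_ \in _).
Qed.

(** The path between two leaves is cut at its highest node, and each half is charged to one of the
    two orders of the pair. *)
Lemma layout_length_setD (G : sgraph 'I_n) :
  layout_length G T phi = \sum_u \sum_v G u v * #|A u :\: A v|.
Proof.
pose F (u v : 'I_n) := if (u < v) && G u v then #|A u :\: A v| else 0.
pose F' (u v : 'I_n) := if (u < v) && G u v then #|A v :\: A u| else 0.
transitivity (\sum_u \sum_v (F u v + F' u v)).
  rewrite /layout_length; apply: eq_bigr => u _; rewrite big_mkcond /=.
  apply: eq_bigr => v _; rewrite /F /F' (dist_sdist RT) /sdist.
  by case: ifP.
transitivity (\sum_u \sum_v F u v + \sum_u \sum_v F' u v).
  by rewrite -big_split; apply: eq_bigr => u _; rewrite -big_split.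
rewrite [X in _ + X]exchange_big -big_split; apply: eq_bigr => u _ /=.
rewrite -big_split; apply: eq_bigr => v _ /=; rewrite /F /F' (adj_sym G v u).
have [->|uv] := eqVneq u v; first by rewrite ltnn adj_irrefl.
by case: ltngtP uv => [||/val_inj->] //=; case: (G u v); rewrite ?eqxx ?mul1n ?mul0n ?addn0.
Qed.

(** Every node but the root is a child of exactly one node. With suitable weights this makes the
    potential telescope, gives Kraft's equality and counts the nodes. *)
Lemma sum_kids (R : nmodType) (w : V -> R) :
  (\sum_(x | x != r) w x
   = \sum_(y in kids r par r) w y + \sum_(x | x != r) \sum_(y in kids r par x) w y)%R.
Proof.
rewrite (partition_big par predT) //= (bigD1 r) //=; congr (_ + _)%R.
  by apply: eq_bigl => y; rewrite inE.
by apply: eq_bigr => x _; apply: eq_bigl => y; rewrite inE.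
Qed.

Lemma leaves_below_kids x : x != r ->
  s x = \sum_u (x == phi u) + \sum_(y in kids r par x) s y.
Proof.
move=> xr; rewrite exchange_big /= -big_split /=; apply: eq_bigr => u _.
rewrite (ancs_kids RT) //; have [e|xu] := eqVneq x (phi u).
  rewrite -e big1 // => y yx; case: (boolP (_ \in _)) => // /(ancs_dep RT).
  by move: yx; rewrite inE => /andP[yr /eqP <-]; rewrite (rt_dep RT yr) ltnn.
rewrite orFb add0n; case: existsP => [[y /andP[yx yu]]|no].
  rewrite (bigD1 y) //= yu big1 // => z /andP[zx zy].
  case: (boolP (z \in _)) => // zu.
  by case/eqP: zy; apply: (kids_ancs_uniq RT zx yx zu yu).
rewrite big1 // => y yx; case: (boolP (_ \in _)) => // yu.
by case: no; exists y; rewrite yx.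
Qed.

Lemma leaves_below_root_kids : \sum_(y in kids r par r) s y = \sum_u (phi u != r).
Proof.
rewrite exchange_big /=; apply: eq_bigr => u _.
have [->|ur] := eqVneq (phi u) r.
  by rewrite big1 // => y _; rewrite (ancs_root RT) in_set0.
have [y yx yu] := ancs_root_kid RT ur.
rewrite (bigD1 y) //= yu big1 // => z /andP[zx zy].
case: (boolP (z \in _)) => // zu.
by case/eqP: zy; apply: (kids_ancs_uniq RT zx yx zu yu).
Qed.

End Layout.

(** * The potential: a convex lower bound for the cost of a subtree *)

Section Potential.
Local Open Scope ring_scope.
Variables (N : int) (k : nat).
Local Notation M := ((2 : int) ^+ k.+1).
Hypothesis N_ge : 5 * M <= 2 * N.

(** The chord between 2^j and 2^(j+1) of the function N q (log2 q + 1) + q - 2 q^2. For a power of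
    two q this is the sum of N s - s^2 over the edges of a complete binary tree with q leaves and
    the edge above it, where s counts the leaves below an edge. *)
Definition line (j : nat) (s : int) : int :=
  let p := 2 ^+ j in N * (j.+3%:R * s - 2 * p) + s - 6 * p * s + 4 * p ^+ 2.

Lemma line_step j s : line j.+1 s - line j s = (s - 2 * 2 ^+ j) * (N - 6 * 2 ^+ j).
Proof. by rewrite /line exprS -[j.+4%:R]natr1; ring. Qed.

Lemma line_slope j : (j < k)%N -> 0 <= N - 6 * 2 ^+ j.
Proof.
move=> jk; have : (2 : int) ^+ j.+2 <= M by rewrite ler_eXn2l.
by move: N_ge; rewrite !exprS; lia.
Qed.

Lemma line_incr i j s : (i <= j <= k)%N -> 2 ^+ j <= s -> line i s <= line j s.
Proof.
elim: j => [|j IH] /andP[ij jk] js; first by move: ij; rewrite leqn0 => /eqP->.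
move: ij; rewrite leq_eqVlt => /predU1P[->//|]; rewrite ltnS => ij.
apply: le_trans (IH _ _) _; first by rewrite ij ltnW.
  by apply: le_trans js; rewrite ler_eXn2l.
by rewrite -subr_ge0 line_step mulr_ge0 ?line_slope // subr_ge0 -exprS.
Qed.

Lemma line_decr i j s : (i <= j <= k)%N -> s <= 2 ^+ i.+1 -> line j s <= line i s.
Proof.
elim: j => [|j IH] /andP[ij jk] si; first by move: ij; rewrite leqn0 => /eqP->.
move: ij; rewrite leq_eqVlt => /predU1P[->//|]; rewrite ltnS => ij.
apply: le_trans (IH _ _) => //; last by rewrite ij ltnW.
rewrite -subr_le0 line_step.
rewrite mulr_le0_ge0 ?line_slope // subr_le0 -exprS.
by apply: le_trans si _; rewrite ler_eXn2l.
Qed.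

(* The convex piecewise linear function which at each power of two up to [M]
   takes the cost of the complete binary tree with that many leaves. *)
Definition potential (s : nat) : int := line (minn (trunc_log 2 s) k) s%:R.

(** Consecutive lines meet at a power of two and their slopes increase, so the potential is their
    upper envelope; convexity is used in this form only. *)
Lemma potential_line j s : (0 < s)%N -> (j <= k)%N -> line j s%:R <= potential s.
Proof.
move=> s0 jk; rewrite /potential; set i := minn _ _.
have /andP[ls us] := trunc_log_bounds (isT : 1 < 2)%N s0.
have [ji|ij] := leqP j i.
  apply: line_incr; first by rewrite ji geq_minr.
  by rewrite -natrX ler_nat (leq_trans _ ls) // leq_exp2l // geq_minl.
apply: line_decr; first by rewrite (ltnW ij) jk.
rewrite -natrX ler_nat; suff -> : i = trunc_log 2 s by apply: ltnW.
by rewrite /i in ij *; lia.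
Qed.

Lemma potential1 : potential 1 = N - 1.
Proof. by rewrite /potential trunc_log1 min0n /line expr0; ring. Qed.

(** This is the inequality at an inner node whose children have [a] and [b] leaves below them. Both
    potentials on the right are bounded by the line just before the one active at [a + b], or by
    line [k] itself if [a + b] is at least [2 ^ k.+1]; the slack is then a product of two
    nonnegative factors. *)
Lemma potentialD a b : (0 < a)%N -> (0 < b)%N -> (2 * (a + b) <= 3 * 2 ^ k.+1)%N ->
  potential (a + b) <=
  N * (a + b)%:R - (a + b)%:R ^+ 2 + potential a + potential b.
Proof.
move=> a0 b0 hs.
have sM : 2 * (a%:R + b%:R) <= 3 * M by rewrite -natrD -natrX -!natrM ler_nat.
have s0 : (0 < a + b)%N by rewrite addn_gt0 a0.
have /andP[ls us] := trunc_log_bounds (isT : 1 < 2)%N s0.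
rewrite {1}/potential; set t := trunc_log 2 _ in ls us *.
have [tk|kt] := leqP t k.
  have t0 : (0 < t)%N by rewrite trunc_log_gt0 //=; lia.
  rewrite -(prednK t0) in ls us tk *; set j := t.-1 in ls us tk *.
  have := potential_line a0 (ltnW tk); have := potential_line b0 (ltnW tk).
  have {}us : a%:R + b%:R < (2 : int) ^+ j.+2 by rewrite -natrD -natrX ltr_nat.
  have {}ls : (2 : int) ^+ j.+1 <= a%:R + b%:R by rewrite -natrD -natrX ler_nat.
  move: ls us; rewrite natrD.
  rewrite /line exprS (exprS _ j.+1) exprS -[j.+4%:R]natr1; set p := 2 ^+ j.
  move=> ls us lb la; have : 0 <= (a%:R + b%:R - 2 * p) * (4 * p - (a%:R + b%:R)).
    by rewrite mulr_ge0 // subr_ge0 //; lia.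
  by move: la lb; nra.
have := potential_line a0 (leqnn k); have := potential_line b0 (leqnn k).
have : M <= a%:R + b%:R.
  by rewrite -natrX -natrD ler_nat (leq_trans _ ls) // leq_exp2l.
move: sM N_ge; rewrite /line natrD exprS; set p := 2 ^+ k.
move=> sM Nge Ms lb la.
(* As [a + b] may reach [3 / 2 * M] and [2 * p = M], the second factor needs [N >= 5 / 2 * M]: this
   is the origin of [N_ge]. *)
have : 0 <= (a%:R + b%:R - 2 * p) * (N - (a%:R + b%:R) - 2 * p).
  by rewrite mulr_ge0 // subr_ge0 //; lia.
by move: la lb; nra.
Qed.

End Potential.

(** * Cubic trees rooted at a median of their leaves *)

Section CubicLayout.
Variables (n : nat) (V : finType) (G : sgraph 'I_n) (T : sgraph V) (phi : 'I_n -> V).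
Hypothesis lay : tree_layout G T phi.
Variables (r : V) (par : V -> V) (dep : V -> nat).
Hypothesis RT : rooted T r par dep.
Notation s := (leaves_below par dep phi).
Notation kids := (kids r par).
Hypothesis n2 : 2 < n.
Hypothesis half : forall y, y \in kids r -> 2 * s y <= n.

Let phi_inj : injective phi. Proof. by case: lay. Qed.

Lemma degree13 x : degree T x = 1 \/ degree T x = 3.
Proof. by case: lay. Qed.

Lemma degree_phi u : degree T (phi u) = 1.
Proof. by case: lay => _ _ _ h; apply/h/codom_f. Qed.

Lemma degree1_phi x : degree T x = 1 -> exists u, x = phi u.
Proof. by case: lay => _ _ _ h /h/codomP. Qed.

(** If the root were a leaf, its only branch would contain the other [n - 1] leaves, which is more
    than half of them. *)
Lemma degree_root : degree T r = 3.
Proof.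
have [d|//] := degree13 r.
have [u0 ru] := degree1_phi d.
have /eqP/cards1P[y ky] : #|kids r| = 1 by rewrite (card_kids_root RT).
have := leaves_below_root_kids RT phi; rewrite ky big_set1 => sy.
have := half (y := y); rewrite ky set11 sy => /(_ isT).
rewrite (bigD1 u0) //= ru eqxx add0n.
rewrite (eq_bigr (fun=> 1)) => [|u uu0]; last first.
  by rewrite (inj_eq phi_inj) uu0.
rewrite sum1_card cardC1 card_ord; lia.
Qed.

Lemma phi_root u : phi u != r.
Proof. by apply/eqP => e; have := degree_phi u; rewrite e degree_root. Qed.

Lemma sum_kids_root : \sum_(y in kids r) s y = n.
Proof.
rewrite (leaves_below_root_kids RT) (eq_bigr (fun=> 1)) => [|u _]; last first.
  by rewrite phi_root.
by rewrite sum1_card card_ord.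
Qed.

Lemma kids_phi u : kids (phi u) = set0.
Proof. by apply/eqP; rewrite -cards_eq0 (card_kids RT) ?phi_root // degree_phi. Qed.

Lemma sum_phi_eq x : \sum_u (x == phi u) = (degree T x == 1) :> nat.
Proof.
have [d|d] := degree13 x; rewrite d /=; last first.
  by apply: big1 => u _; case: eqP => // e; have := degree_phi u; rewrite -e d.
have [v ->] := degree1_phi d; rewrite (bigD1 v) //= eqxx big1 // => u uv.
by rewrite (inj_eq phi_inj) eq_sym (negPf uv).
Qed.

Lemma leaves_below_phi u : s (phi u) = 1.
Proof.
by rewrite (leaves_below_kids RT) ?phi_root // kids_phi big_set0 sum_phi_eq degree_phi.
Qed.

Lemma nonleaf_kids x : x != r -> degree T x != 1 ->
  exists y z, [/\ y != z, kids x = [set y; z] & s x = s y + s z].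
Proof.
move=> xr dx; have : #|kids x| == 2.
  by rewrite (card_kids RT) //; case: (degree13 x) dx => ->.
case/cards2P=> y [z [yz e]]; exists y, z; split=> //.
by rewrite (leaves_below_kids RT) // sum_phi_eq (negPf dx) e big_setU1 ?inE //= big_set1.
Qed.

Lemma leaves_below_gt0 x : x != r -> 0 < s x.
Proof.
move=> xr; pose m := \max_y dep y.
have [j] := ubnP (m - dep x); elim: j x xr => // j IH x xr le.
have [|dx] := eqVneq (degree T x) 1; first by case/degree1_phi => u ->; rewrite leaves_below_phi.
have [y [z [yz e ->]]] := nonleaf_kids xr dx.
have : y \in kids x by rewrite e set21.
rewrite inE => /andP[yr /eqP py]; rewrite addn_gt0 IH //.
have := leq_bigmax (F := dep) y; rewrite -/m (rt_dep RT yr) py; lia.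
Qed.

Lemma leaves_below_half x : x != r -> 2 * s x <= n.
Proof.
move=> xr; have [y yr yx] := ancs_root_kid RT xr.
apply: leq_trans (half yr); rewrite leq_mul2l /=; apply: leq_sum => u _.
case: (boolP (x \in _)) => // /(ancs_sub RT)/subsetP/(_ _ yx) ->.
by [].
Qed.

(** Counting children, three at the root and two at each other inner node. It tells the machine how
    many nodes to expect in the answer. *)
Lemma card_layout : #|V| + 2 = 2 * n.
Proof.
have I1 : \sum_(x | x != r) (degree T x == 1) = n.
  under eq_bigr => x _ do rewrite -sum_phi_eq.
  rewrite exchange_big /= (eq_bigr (fun=> 1)) ?sum1_card ?card_ord // => u _.
  rewrite (bigD1 (phi u)) ?phi_root //= eqxx big1 // => x /andP[_].
  by move/negPf->.
have := sum_kids r par (fun=> 1); rewrite sum1_card.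
rewrite [X in _ = (X + _)%R]sum1_card (card_kids_root RT) degree_root cardC1.
rewrite (eq_bigr (fun x => 2 - 2 * (degree T x == 1))) => [E|x xr]; last first.
  by rewrite sum1_card (card_kids RT) //; case: (degree13 x) => ->.
have E2 : \sum_(x | x != r) (2 - 2 * (degree T x == 1)) + 2 * n = 2 * (#|V|.-1).
  rewrite -{1}I1 big_distrr /= -big_split /= (eq_bigr (fun=> 2)) => [|x _].
    by rewrite sum_nat_const cardC1 mulnC.
  by case: (_ == _).
have : 0 < #|V| by rewrite (cardD1 r).
move: E E2; set S := \sum_(_ | _) _; rewrite -[(3 + S)%R]/(3 + S); lia.
Qed.

Section Bound.
Variables (k D : nat).
Hypothesis nM : n = 3 * 2 ^ k.+1.

(** By [local] the potential of a node exceeds that of its children by at most the term of the node,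
    so the sum telescopes to the branches at the root. There line [k] alone is used: being linear,
    it depends only on the total number of leaves, and it gives the value for three branches of
    [2 ^ k.+1] leaves. *)
Lemma potential_bound (N : int) (M := ((2 : int) ^+ k.+1)%R) : (5 * M <= 2 * N)%R ->
  (3 * M * (N * k.+2%:R + 1 - 2 * M) <= \sum_(x | x != r) (N * (s x)%:R - (s x)%:R ^+ 2))%R.
Proof.
rewrite {}/M => N_ge; pose w x := potential N k (s x).
have local x : (x != r -> w x - \sum_(y in kids x) w y <= N * (s x)%:R - (s x)%:R ^+ 2)%R.
  move=> xr; have [dx|dx] := eqVneq (degree T x) 1.
    case: (degree1_phi dx) => u ->.
    by rewrite kids_phi big_set0 /w leaves_below_phi potential1 subr0 expr1n mulr1.
  have [y [z [yz e sx]]] := nonleaf_kids xr dx.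
  have [yr zr] : y != r /\ z != r.
    have : y \in kids x by rewrite e set21.
    have : z \in kids x by rewrite e set22.
    by rewrite !inE => /andP[-> _] /andP[-> _].
  rewrite e big_setU1 ?inE //= big_set1 /w sx lerBlDr addrA.
  apply: potentialD; rewrite ?leaves_below_gt0 // -sx.
  by rewrite -nM leaves_below_half.
apply: le_trans (ler_sum _ local); rewrite sumrB (sum_kids r par w) addrK.
have lb y : (y \in kids r -> line N k (s y)%:R <= w y)%R.
  by rewrite inE => /andP[yr _]; apply: potential_line; rewrite ?leaves_below_gt0.
apply: le_trans (ler_sum _ lb); pose p := (2 ^+ k : int)%R.
rewrite (eq_bigr (fun y => (N * k.+3%:R + 1 - 6 * p) * (s y)%:R + (4 * p ^+ 2 - 2 * N * p)))%R.
  rewrite big_split /= sumr_const (card_kids_root RT) degree_root -mulr_sumr -natr_sum.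
  rewrite sum_kids_root nM natrM natrX -[k.+3%:R%R]natr1 exprS -/p mulr_natl le_eqVlt.
  by apply/orP; left; apply/eqP; ring.
by move=> y _; rewrite /line -/p; ring.
Qed.

(** The weight [2 ^- dep] of an inner node other than the root is the sum of the weights of its two
    children. The total is 3/2 since the root has three children of weight 1/2. *)
Lemma kraft : (\sum_u (2 : rat) ^- (dep (phi u)) = 3 / 2)%R.
Proof.
pose w x : rat := (2 ^- (dep x))%R.
have wk x y : (y \in kids x -> w y = w x / 2)%R.
  by rewrite inE /w => /andP[yr /eqP<-]; rewrite (rt_dep RT yr) exprS invfM mulrC.
have := sum_kids r par w.
rewrite [X in (_ = X + _)%R -> _](eq_bigr (fun=> (w r / 2)%R)) => [|y]; last exact: wk.
rewrite sumr_const (card_kids_root RT) degree_root.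
have -> : (\sum_(x | x != r) \sum_(y in kids x) w y =
           \sum_(x | x != r) (w x - w x * (degree T x == 1)%:R))%R.
  apply: eq_bigr => x xr; rewrite (eq_bigr (fun=> (w x / 2)%R)) => [|y]; last exact: wk.
  rewrite sumr_const (card_kids RT) //.
  by case: (degree13 x) => ->; rewrite ?mulr0n ?mulr1 ?subrr // mulr0 subr0 mulr2n; field.
have -> : (\sum_u 2 ^- dep (phi u) = \sum_(x | x != r) w x * (degree T x == 1)%:R)%R.
  under [RHS]eq_bigr => x _ do rewrite -sum_phi_eq natr_sum mulr_sumr.
  rewrite exchange_big /=; apply: eq_bigr => u _.
  rewrite (bigD1 (phi u)) ?phi_root //= eqxx mulr1 big1 ?addr0 // => x /andP[_].
  by move/negPf->; rewrite mulr0.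
rewrite sumrB /w (rt_root RT) expr0 invr1.
set X := (\sum_(_ | _) 2 ^- _)%R; set Y := (\sum_(_ | _) _ * _)%R => e.
by lra.
Qed.

(* A weight [w] between [D] and [2 D] satisfies
   [2 D * (1 - 2 ^ (k.+2 - e)) <= w * (e - k.+2)] for every depth [e], and by
   Kraft's equality the left-hand sides sum to 0. *)
Lemma weighted_depth (d : 'I_n -> nat) : (forall u, d u <= D) ->
  ((\sum_u (2 * D - d u)) * k.+2 <= \sum_u (2 * D - d u) * dep (phi u)).
Proof.
move=> dD; rewrite -(ler_nat rat) natrM !natr_sum mulr_suml -subr_ge0 -sumrB.
pose K : rat := (2 ^+ k.+2)%R.
have : (\sum_u ((2 * D)%:R * (1 - K * 2 ^- dep (phi u))) = 0 :> rat)%R.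
  rewrite -mulr_sumr sumrB -mulr_sumr kraft sumr_const card_ord nM.
  by rewrite !natrM natrX /K (exprS _ k.+1); field.
move=> E0; rewrite -[X in (X <= _)%R]E0; apply: ler_sum => u _; rewrite [X in (_ <= X - _)%R]natrM.
set e := dep _; have := dD u; set f := d u => fD.
rewrite -mulrBr.
(* Up to depth [k.+2] the weight is bounded by [2 D] and [1 + x <= 2 ^ x] is used; deeper down it is
   bounded below by [D], and a leaf just one level too deep is the tight case. *)
have [ek|ke] := leqP e k.+2.
  pose x := k.+2 - e; have xe : k.+2 = e + x by lia.
  have -> : (K * 2 ^- e = 2 ^+ x)%R.
    by rewrite /K xe exprD mulrAC mulfV ?mul1r // expf_neq0.
  have h1 : (1 + x%:R <= (2 : rat) ^+ x)%R.
    by rewrite addrC natr1 -natrX ler_nat ltn_expl.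
  rewrite xe natrD opprD addrA subrr sub0r.
  have h2 : ((2 * D - f)%:R <= 2 * (D%:R : rat))%R by rewrite -natrM ler_nat leq_subr.
  have h3 : (0 <= (x%:R : rat))%R by [].
  have h4 : (0 <= (D%:R : rat))%R by [].
  apply: le_trans (_ : 2 * D%:R * - x%:R <= _)%R; last by rewrite !mulrN lerN2 ler_wpM2r.
  by rewrite natrM ler_wpM2l ?mulr_ge0 //; lra.
pose x := (e - k.+2).-1; have xe : e = k.+2 + x.+1 by rewrite /x; lia.
have -> : (K * 2 ^- e = 2 ^- x.+1)%R.
  by rewrite /K xe exprD invfM mulrA mulfV ?mul1r // expf_neq0.
rewrite xe natrD [(_ + x.+1%:R)%R]addrC addrK.
have h2 : (D%:R <= (2 * D - f)%:R :> rat)%R by rewrite ler_nat; lia.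
have h4 : (0 <= (D%:R : rat))%R by [].
apply: le_trans (_ : D%:R * x.+1%:R <= _)%R; last by rewrite ler_wpM2r.
rewrite natrM mulrAC mulrC ler_wpM2l //.
case: x {xe} => [|x]; first by rewrite expr1; lra.
have : (0 <= (2 : rat) ^- x.+2)%R by rewrite invr_ge0 exprn_ge0.
have : (0 <= (x%:R : rat))%R by [].
rewrite -[(x.+2%:R)%R]natr1 -[(x.+1%:R)%R]natr1; lra.
Qed.

End Bound.
End CubicLayout.

(** [r] minimizes the sum of the distances to the leaves. Moving from [r] to a child [y] changes
    this sum by [n] minus twice the number of leaves below [y], which is therefore nonnegative. *)
Lemma median_root n (V : finType) (T : sgraph V) (phi : 'I_n -> V) : is_tree T ->
  exists r par dep, rooted T r par dep /\
    forall y, y \in kids r par r -> 2 * leaves_below par dep phi y <= n.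
Proof.
move=> tree; have [/card_gt0P[v0 _] _ _] := tree.
pose f r := \sum_u dist T (phi u) r.
have [r _ rmin] := @arg_minnP _ v0 predT f isT.
have [par RT] := tree_rooted r tree.
exists r, par, (fun x => dist T x r); split=> // y; rewrite inE => /andP[yr /eqP py].
have Ay : ancs par (fun x => dist T x r) y = [set y].
  by rewrite (ancsU RT) // py (ancs_root RT) setU0.
set s := leaves_below _ _ _ _.
suff : f y + 2 * s = f r + n by have := rmin y isT; lia.
rewrite -[X in _ = _ + X]card_ord -sum1_card big_distrr -!big_split /=.
apply: eq_bigr => u _; rewrite [dist T _ y](dist_sdist RT) /sdist Ay.
have := cardsD1 y (ancs par (fun x => dist T x r) (phi u)).
rewrite (card_ancs RT); case: (boolP (y \in _)) => yu ->.
  by rewrite (_ : [set y] :\: _ = set0) ?cards0; [lia | apply/eqP; rewrite setD_eq0 sub1set].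
rewrite (_ : [set y] :\: _ = [set y]) ?cards1; first lia.
by apply/setDidPl; rewrite disjoints1.
Qed.

Section LowerBound.
Variables (k D : nat).
Let n := 3 * 2 ^ k.+1.
Variables (H : rel 'I_n) (G : sgraph 'I_n).
Hypothesis GH : forall u v, G u v = (u != v) && ~~ H u v.
Hypothesis degH : forall u, \sum_v H u v <= D.
Hypothesis D_small : 4 * D <= 2 ^ k.+1.

(* The length is that of the complete graph minus the distances of the pairs in
   [H]; these are at most the sums of the depths of both ends, and smaller for a
   pair in one branch at [r]. *)
Lemma layout_lower_bound (V : finType) (T : sgraph V) (phi : 'I_n -> V) :
  tree_layout G T phi ->
  exists r par dep, rooted T r par dep /\
   [/\ degree T r = 3, forall u, phi u != r &
    n * (n * k.+2) +
     \sum_u \sum_v (H u v && [exists c in kids r par r,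
        (c \in ancs par dep (phi u)) && (c \in ancs par dep (phi v))])
    <= layout_length G T phi + n * (2 ^ k.+2 - 1) + \sum_u \sum_v H u v * k.+2].
Proof.
move=> lay; have [tree _ _ _] := lay.
have [r [par [dep [RT half]]]] := median_root phi tree.
exists r, par, dep; split=> //.
have n2 : 2 < n by rewrite /n; have := expn_gt0 2 k.+1; lia.
split; [exact: (degree_root lay RT n2 half) | exact: (phi_root lay RT n2 half) |].
pose same u v := [exists c in kids r par r,
  (c \in ancs par dep (phi u)) && (c \in ancs par dep (phi v))].
rewrite -[X in _ + X <= _]/(\sum_u \sum_v (H u v && same u v)).
rewrite (layout_length_setD RT).
pose A u := ancs par dep (phi u); pose s := leaves_below par dep phi.
pose d u := \sum_v H u v.
have e1 : \sum_u \sum_v G u v * #|A u :\: A v| + \sum_u \sum_v H u v * #|A u :\: A v|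
          = \sum_x s x * (n - s x).
  rewrite -(sum_setD par dep phi) -big_split /=; apply: eq_bigr => u _; rewrite -big_split /=.
  apply: eq_bigr => v _; rewrite -mulnDl GH.
  have [->|uv] := eqVneq u v; first by rewrite setDv cards0 muln0.
  by case: (H u v); rewrite mul1n.
(* The set [A u] has as many elements as the depth of [u]; if [u] and [v] share a branch, the top
   node [c] of that branch is missing from the difference. *)
have e2 : \sum_u \sum_v H u v * #|A u :\: A v| + \sum_u \sum_v (H u v && same u v)
          <= \sum_u d u * dep (phi u).
  rewrite -big_split /=; apply: leq_sum => u _; rewrite /d big_distrl -big_split /=.
  apply: leq_sum => v _ /=; case: (H u v) => //=; rewrite !mul1n -(card_ancs RT).
  case: (boolP (same u v)) => [/existsP[c /and3P[_ cu cv]]|_]; last first.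
    by rewrite addn0 subset_leq_card // subsetDl.
  rewrite addn1; apply: proper_card; apply/properP; split; first exact: subsetDl.
  by exists c => //; rewrite in_setD cv.
have e3 : \sum_u \sum_v H u v * k.+2 = \sum_u d u * k.+2.
  by apply: eq_bigr => u _; rewrite big_distrl.
(* The part [2 * D] of the coefficient [n] of [s x] is set aside: summed over [x], it is [2 * D]
   times the sum of the depths, and leaves the depth of [u] the weight [2 * D - d u] in e6. *)
pose N : int := (n%:R - 2 * D%:R)%R.
have N_ge : (5 * 2 ^+ k.+1 <= 2 * N)%R.
  have : ((4 * D)%:R <= (2 ^ k.+1)%:R :> int)%R by rewrite ler_nat.
  rewrite natrM natrX /N /n natrM natrX; lia.
have b1 := potential_bound lay RT n2 half (erefl n) N_ge.
have b2 := weighted_depth lay RT n2 half (erefl n) degH.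
have e4 : (\sum_(x | x != r) (N * (s x)%:R - (s x)%:R ^+ 2)
           = (\sum_x s x * (n - s x))%:R - 2 * D%:R * (\sum_u dep (phi u))%:R)%R.
  rewrite (sum_dep RT) !natr_sum [RHS](_ : _ = \sum_x (N * (s x)%:R - (s x)%:R ^+ 2))%R.
    by rewrite [RHS](bigD1 r) //= /s (leaves_below_root RT phi) mulr0 expr0n subrr add0r.
  rewrite mulr_sumr -sumrB; apply: eq_bigr => x _.
  by rewrite natrM natrB ?leaves_below_le // /N; ring.
have e5 : \sum_u (2 * D - d u) + \sum_u d u = n * (2 * D).
  rewrite -big_split /= (eq_bigr (fun=> 2 * D)) => [|u _]; first by rewrite sum_nat_const card_ord.
  by have := degH u; rewrite -/(d u); lia.
have e6 : \sum_u (2 * D - d u) * dep (phi u) + \sum_u d u * dep (phi u)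
          = 2 * D * \sum_u dep (phi u).
  rewrite -big_split big_distrr /=; apply: eq_bigr => u _; rewrite -mulnDl.
  by have := degH u; rewrite -/(d u) => h; congr (_ * _); lia.
move: b1; rewrite e4 -e1.
rewrite e3 -big_distrl /=; move: b2 e2 e5 e6.
set S1 := \sum_u (2 * D - d u); set S2 := \sum_u (2 * D - d u) * _.
set S3 := \sum_u d u * _; set S4 := \sum_u dep _; set S5 := \sum_u d u.
set L := \sum_u \sum_v G u v * _; set S6 := \sum_u \sum_v H u v * _.
set S7 := \sum_u \sum_v _.
have n1 : n * (2 ^ k.+2 - 1) + n = n * (2 * 2 ^ k.+1).
  by rewrite -expnS mulnBr muln1 subnK // leq_pmulr // expn_gt0.
move=> b2 e2 e5 e6.
have nE : (n%:R = 3 * 2 ^+ k.+1 :> int)%R by rewrite /n natrM natrX.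
rewrite -nE natrD => b1.
have M1 : (2 ^+ k.+1 = (2 ^ k.+1)%:R :> int)%R by rewrite natrX.
rewrite M1 /N in b1.
have {}b1 : (((n * (n * k.+2)) + n)%:R <= (L + S6 + n * (2 * 2 ^ k.+1))%:R
     + ((n * (2 * D)) * k.+2)%:R - (2 * D * S4)%:R :> int)%R.
  by rewrite !natrD !natrM; move: b1; lia.
rewrite -e5 -e6 in b1.
have : n * (n * k.+2) + n + (S2 + S3) <= L + S6 + n * (2 * 2 ^ k.+1) + (S1 + S5) * k.+2.
  by rewrite -(ler_nat int) !natrD; move: b1; rewrite !natrD; lia.
rewrite mulnDl; move: (n * (2 ^ k.+2 - 1)) n1 b2 e2; lia.
Qed.

End LowerBound.

(** * Optimal layouts of dense graphs *)

Section RootedTree.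
Variables (V : finType) (T : sgraph V) (r : V) (par : V -> V) (dep : V -> nat).
Hypothesis RT : rooted T r par dep.

(** The two neighbours of a deepest vertex on a cycle would both be its parent. *)
Lemma rooted_tree : is_tree T.
Proof.
split; [by rewrite (cardD1 r) | exact: rooted_connect RT | move=> c c2 uc].
have [x0 x0c] : exists x, x \in c by case: c c2 {uc} => // x c _; exists x; rewrite mem_head.
have [x xc xmax] := @arg_maxnP _ x0 (mem c) dep x0c.
have [i c' ec] := rot_to xc.
have ce z : (z \in x :: c') = (z \in c) by rewrite -ec mem_rot.
have up y : y \in c -> T x y -> y = par x.
  move=> yc /(rt_edge RT)/orP[/andP[_ /eqP->]//|/andP[yr /eqP xy]].
  by have := xmax y yc; rewrite (rt_dep RT yr) -xy; lia.
move: uc; rewrite -(rot_ucycle i) ec => /andP[].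
have : 2 < size (x :: c') by rewrite -ec size_rot.
case: c' ec ce => [|y c'] // ec ce; case/lastP: c' ec ce => [|c' z] // ec ce _ /=.
rewrite rcons_path last_rcons => /and3P[xy _ zx] /and3P[_ + _].
have yc : y \in c by rewrite -ce !inE eqxx orbT.
have zc : z \in c by rewrite -ce !inE mem_rcons mem_head !orbT.
by rewrite (up y yc xy) [z](up z zc) ?mem_rcons ?mem_head // adj_sym.
Qed.

Lemma ancs_level x d : \sum_(y in ancs par dep x) (dep y == d) = (0 < d <= dep x) :> nat.
Proof.
elim/(rt_ind RT): x => [|x xr IH].
  by rewrite (ancs_root RT) big_set0 (rt_root RT); case: d.
rewrite (ancsU RT) // big_setU1 ?(notin_ancs_par RT) //= IH (rt_dep RT xr).
move: (dep (par x)) => e; clear IH.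
by case: ltngtP; case: d => //; lia.
Qed.

End RootedTree.

(* The nodes of the balanced tree are numbered breadth first: the root 0 has the
   children 1, 2 and 3, and an inner node [x > 0] has [2 x + 2] and [2 x + 3]. *)
Definition heap_par (y : nat) : nat := if y < 4 then 0 else y./2.-1.
Definition heap_dep (y : nat) : nat :=
  if y == 0 then 0 else (trunc_log 2 ((y + 2) %/ 3)).+1.

Lemma heap_par_lt y : 0 < y -> heap_par y < y.
Proof. by rewrite /heap_par; case: ifP => // _ y0; lia. Qed.

Lemma heap_dep_par y : 0 < y -> heap_dep y = (heap_dep (heap_par y)).+1.
Proof.
move=> y0; rewrite /heap_par; case: ltnP => [y4|y4].
  by case: y y0 y4 => [|[|[|[|]]]].
have -> : heap_dep y = (trunc_log 2 ((y + 2) %/ 3)).+1 by rewrite /heap_dep eqn0Ngt y0.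
have -> : heap_dep y./2.-1 = (trunc_log 2 ((y./2.-1 + 2) %/ 3)).+1.
  by rewrite /heap_dep ifN //; lia.
rewrite trunc_log2S; last by lia.
by congr (trunc_log 2 _).+2; lia.
Qed.

Lemma heap_depP y d : 0 < y ->
  (heap_dep y == d.+1) = (3 * 2 ^ d <= y + 2 < 3 * 2 ^ d.+1).
Proof.
move=> y0; rewrite /heap_dep eqn0Ngt y0 /= eqSS.
have h : 0 < (y + 2) %/ 3 by lia.
apply/eqP/idP => [<-|hd].
  have /andP[] := trunc_log_bounds (isT : 1 < 2) h; lia.
by apply: trunc_log_eq => //; lia.
Qed.

Section Heap.
Variable n : nat.
Hypothesis n2 : 2 < n.
Let m := 2 * n - 3.

Definition heap_adj (x y : 'I_m.+1) : bool :=
  (0 < y) && (x == heap_par y :> nat) || (0 < x) && (y == heap_par x :> nat).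

Lemma heap_adj_sym : symmetric heap_adj.
Proof. by move=> x y; rewrite /heap_adj orbC. Qed.

Lemma heap_adj_irrefl : irreflexive heap_adj.
Proof.
move=> x; rewrite /heap_adj orbb; apply/andP => -[x0 /eqP].
by have := heap_par_lt x0; lia.
Qed.

Definition heap : sgraph 'I_m.+1 := SGraph heap_adj_sym heap_adj_irrefl.

Lemma heap_rooted : rooted heap ord0 (fun x => inord (heap_par x)) heap_dep.
Proof.
have hp (x : 'I_m.+1) : 0 < x -> heap_par x < m.+1.
  by move=> x0; apply: leq_trans (heap_par_lt x0) _; apply: ltnW; apply: ltn_ord.
split=> //.
- move=> x; rewrite -val_eqE /= -lt0n => x0.
  by rewrite /heap_adj inordK ?hp // x0 eqxx orbT.
- by move=> x; rewrite -val_eqE /= -lt0n => x0; rewrite inordK ?hp // heap_dep_par.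
- move=> x y /=; rewrite {1}/heap_adj => /orP[]/andP[z0 /eqP e]; apply/orP; [right|left].
    by rewrite -!val_eqE /= -lt0n z0 inordK ?hp // e eqxx.
  by rewrite -!val_eqE /= -lt0n z0 inordK ?hp // e eqxx.
Qed.

Lemma heap_degree (x : 'I_m.+1) : degree heap x = if x < n - 2 then 3 else 1.
Proof.
have mE : m = 2 * n - 3 by [].
have im i : i < 2 * n - 2 -> i < m.+1 by rewrite /m; lia.
have xm : x < 2 * n - 2 by have := ltn_ord x; rewrite /m; lia.
have Tin (y : 'I_m.+1) : y < 2 * n - 2 by have := ltn_ord y; rewrite /m; lia.
rewrite /degree; case: ltnP => xn.
  have [x0|x0] := posnP x.
    have -> : [set y | heap x y] = [set inord 1; inord 2; inord 3].
      apply/setP => y; rewrite !inE -!val_eqE /= !inordK; try by (apply: im; lia).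
      rewrite /heap_adj x0 /= orbF /heap_par; have := Tin y.
      by case: (nat_of_ord y) => [|[|[|[|i]]]] //= _; lia.
    rewrite -setUA cardsU1 cards2 !inE -!val_eqE /= !inordK //; try by (apply: im; lia).
  have -> : [set y | heap x y] = [set inord (heap_par x); inord (2 * x + 2); inord (2 * x + 3)].
    have hx := heap_par_lt x0.
    apply/setP => y; rewrite !inE -!val_eqE /= !inordK; try by (apply: im; lia).
    by rewrite /heap_adj x0 /= /heap_par; do 2!case: ifP; lia.
  have hx := heap_par_lt x0.
  rewrite -setUA cardsU1 cards2 !inE -!val_eqE /= !inordK; try by (apply: im; lia).
  by move: (heap_par x) hx => h hx; lia.
have x0 : 0 < x by lia.
have hx := heap_par_lt x0.
rewrite -(cards1 (inord (heap_par x) : 'I_m.+1)); congr #|pred_of_set _|.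
apply/setP => y; rewrite !inE -!val_eqE /= inordK; last by (apply: im; lia).
rewrite /heap_adj x0 /=; have := Tin y.
by rewrite /heap_par; do 2!case: ifP; lia.
Qed.

End Heap.

Lemma sum_pow2 k : (\sum_(d < k) 2 ^ d).+1 = 2 ^ k.
Proof. by elim: k => [|k IH]; rewrite ?big_ord0 // big_ord_recr /= -addSn IH expnS; lia. Qed.

(** * The balanced layout attains the lower bound *)

Section Balanced.
Variables (k : nat).
Let n := 3 * 2 ^ k.+1.
Variables (H : rel 'I_n) (G : sgraph 'I_n).
Hypothesis irrH : irreflexive H.
Hypothesis GH : forall u v, G u v = (u != v) && ~~ H u v.

Let n2 : 2 < n.
Proof. by rewrite /n; have := expn_gt0 2 k.+1; lia. Qed.

Let m := 2 * n - 3.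
Variable pos : 'I_n -> 'I_n.
Hypothesis pos_inj : injective pos.
Hypothesis posH : forall u v, H u v -> pos u %/ 2 ^ k.+1 != pos v %/ 2 ^ k.+1.

Definition heap_leaf (u : 'I_n) : 'I_m.+1 := inord (n - 2 + pos u).

Lemma heap_leafE u : heap_leaf u = n - 2 + pos u :> nat.
Proof. by rewrite inordK // /m; have := ltn_ord (pos u); lia. Qed.

Lemma heap_layout : tree_layout G (heap n2) heap_leaf.
Proof.
split; first exact: rooted_tree (heap_rooted n2).
- by move=> x; rewrite heap_degree; case: ifP; [right|left].
- move=> u v /(congr1 (@nat_of_ord _)); rewrite !heap_leafE => /addnI /val_inj.
  exact: pos_inj.
move=> x; rewrite heap_degree; split.
  by case/codomP => u ->; rewrite heap_leafE ltnNge leq_addr.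
case: ltnP => // xn _; have xm : x - (n - 2) < n by have := ltn_ord x; rewrite /m; lia.
have [g _ gK] := injF_bij pos_inj.
apply/codomP; exists (g (Ordinal xm)); apply: val_inj.
by rewrite /= heap_leafE gK /= subnKC.
Qed.

Notation par := (fun x : 'I_m.+1 => inord (heap_par x) : 'I_m.+1).
Notation dep := (fun x : 'I_m.+1 => heap_dep x).
Notation A u := (ancs par dep (heap_leaf u)).

Lemma heap_leaf_dep u : heap_dep (heap_leaf u) = k.+2.
Proof.
have pu := ltn_ord (pos u); apply/eqP.
rewrite heap_leafE heap_depP; last by rewrite addn_gt0 subn_gt0 n2.
by rewrite (expnS 2 k.+1); move: n2 pu; rewrite /n; lia.
Qed.

(** After adding 2 the children of [x] are [2 * (x + 2)] and [2 * (x + 2) + 1], so going up drops a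
    binary digit. Dropping all but the leading part leaves 3, 4 or 5, the number of the branch at
    the root. *)
Lemma heap_branch (x z : 'I_m.+1) : z \in ancs par dep x ->
  (z + 2) %/ 2 ^ (heap_dep z).-1 = (x + 2) %/ 2 ^ (heap_dep x).-1.
Proof.
elim/(rt_ind (heap_rooted n2)): x => [|x xr IH].
  by rewrite (ancs_root (heap_rooted n2)) in_set0.
rewrite (ancsU (heap_rooted n2)) // in_setU1 => /predU1P[->//|/[dup] zx /IH ->].
have x0 : 0 < x by rewrite lt0n.
have hx := heap_par_lt x0.
have px : (inord (heap_par x) : 'I_m.+1) = heap_par x :> nat.
  by rewrite inordK //; have := ltn_ord x; lia.
rewrite px; have : 0 < heap_par x.
  case: posnP => // p0; move: zx.
  rewrite (_ : inord _ = ord0) ?(ancs_root (heap_rooted n2)) ?in_set0 //.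
  by apply: val_inj; rewrite /= px p0.
move=> p0; rewrite [heap_dep x]heap_dep_par //= (heap_dep_par p0) /= expnS divnMA.
congr (_ %/ _); move: p0; rewrite /heap_par; case: (ltnP x 4) => [//|x4 _]; move: (nat_of_ord x) x4; clear => y; lia.
Qed.

Lemma heap_leaf_branch u v c : c \in kids ord0 par ord0 ->
  c \in A u -> c \in A v -> pos u %/ 2 ^ k.+1 = pos v %/ 2 ^ k.+1.
Proof.
rewrite inE => /andP[c0 /eqP pc] /heap_branch hu /heap_branch hv.
have E w : (heap_leaf w + 2) %/ 2 ^ k.+1 = 3 + pos w %/ 2 ^ k.+1.
  rewrite heap_leafE addnAC subnK; last by lia.
  by rewrite -[X in X + _]/(3 * 2 ^ k.+1) divnMDl ?expn_gt0.
by move: hu; rewrite hv !heap_leaf_dep /= !E => /addnI.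
Qed.

(** Adjacent vertices of [H] lie in different branches, so their ancestor sets are disjoint and each
    ordered pair contributes the full depth [k.+2]. As the depths are constant, what remains is a
    lower bound for the sum of the [s x ^ 2], taken level by level. *)
Lemma heap_layout_length :
  layout_length G (heap n2) heap_leaf + \sum_u \sum_v H u v * k.+2 + n * (2 ^ k.+2 - 1)
  <= n * (n * k.+2).
Proof.
have RT := heap_rooted n2.
pose s := leaves_below par dep heap_leaf.
rewrite (layout_length_setD RT).
have -> : \sum_u \sum_v G u v * #|A u :\: A v| + \sum_u \sum_v H u v * k.+2
          = \sum_x s x * (n - s x).
  rewrite -(sum_setD par dep heap_leaf) -big_split; apply: eq_bigr => u _ /=.
  rewrite -big_split; apply: eq_bigr => v _ /=; rewrite GH.
  have [->|uv] := eqVneq u v; first by rewrite irrH setDv cards0 muln0.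
  case: (boolP (H u v)) => Huv; rewrite /= ?mul1n ?addn0 //.
  have -> : A u :\: A v = A u.
    apply/setDidPl/pred0P => x /=; apply/negP => /andP[xu xv].
    have x0 : x != ord0 by apply: contraTneq xu => ->; apply: root_notin_ancs RT _.
    have [c ck cx] := ancs_root_kid RT x0.
    have := posH Huv; rewrite (heap_leaf_branch ck (u := u) (v := v)) ?eqxx //.
      by apply: (subsetP (ancs_sub RT xu)).
    by apply: (subsetP (ancs_sub RT xv)).
  by rewrite (card_ancs RT) heap_leaf_dep add0n.
have e1 : \sum_x s x * (n - s x) + \sum_x s x ^ 2 = n * (n * k.+2).
  have <- : \sum_x s x * n = n * (n * k.+2).
    rewrite -big_distrl /= -(sum_dep RT) (eq_bigr (fun=> k.+2)) => [|u _].
      by rewrite sum_nat_const card_ord mulnC.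
    exact: heap_leaf_dep.
  rewrite -big_split; apply: eq_bigr => x _ /=.
  by rewrite -mulnn -mulnDr subnK // leaves_below_le.
rewrite -e1 leq_add2l.
have lev (d : 'I_k.+2) : \sum_(x : 'I_m.+1 | heap_dep x == d.+1) s x = n.
  rewrite exchange_big /= -[RHS]card_ord -sum1_card; apply: eq_bigr => u _.
  have := ancs_level RT (heap_leaf u) d.+1; rewrite heap_leaf_dep ltnS ltn_ord /= => <-.
  by rewrite big_mkcond [RHS]big_mkcond /=; apply: eq_bigr => x _; do 2!case: ifP.
have cnt (d : 'I_k.+2) : \sum_(x : 'I_m.+1 | heap_dep x == d.+1) 1 <= 3 * 2 ^ d.
  rewrite sum1_card; pose P := [pred x : 'I_m.+1 | heap_dep x == d.+1].
  have sub : {subset [seq val x | x <- enum P] <= iota (3 * 2 ^ d - 2) (3 * 2 ^ d)}.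
    move=> i /mapP[x]; rewrite mem_enum inE => dx ->; rewrite mem_iota.
    have x0 : 0 < x by rewrite lt0n; apply: contraTneq dx => /= ->.
    by move: dx; rewrite heap_depP // expnS /=; have := expn_gt0 2 d; lia.
  have := uniq_leq_size _ sub; rewrite size_map -cardE size_iota; apply.
  by rewrite map_inj_uniq ?enum_uniq //; apply: val_inj.
have ineq (d : 'I_k.+2) : n * 2 ^ (k.+1 - d) <= \sum_(x : 'I_m.+1 | heap_dep x == d.+1) s x ^ 2.
  set q := 2 ^ _; have q1 : 3 * 2 ^ d * q = n.
    by rewrite -mulnA -expnD subnKC // -ltnS.
  (* The tangent inequality [2 q s <= s^2 + q^2] at the mean value [q] of [s] on the level; it
     spares the exact computation of [s]. *)
  have h : 2 * q * n <= \sum_(x : 'I_m.+1 | heap_dep x == d.+1) s x ^ 2 + q * q * (3 * 2 ^ d).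
    rewrite -{1}(lev d) big_distrr /=.
    apply: leq_trans (_ : \sum_(x : 'I_m.+1 | heap_dep x == d.+1) (s x ^ 2 + q * q * 1) <= _).
      apply: leq_sum => x _; rewrite muln1 mulnn -mulnA.
      by rewrite (mulnC q) (nat_Cauchy (s x) q).
    by rewrite big_split /= -big_distrr /= leq_add2l leq_mul2l cnt orbT.
  move: h; rewrite -mulnA -(mulnA q q) (mulnC q (3 * 2 ^ d)) q1 (mulnC n q); lia.
apply: leq_trans (_ : \sum_(d < k.+2) n * 2 ^ (k.+1 - d) <= _).
  rewrite -big_distrr leq_mul2l /= -(sum_pow2 k.+2) subSS subn0 orbC.
  by rewrite [X in X <= _](reindex_inj rev_ord_inj) /= (eq_leq (erefl _)).
apply: leq_trans (leq_sum _ (fun d _ => ineq d)) _.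
rewrite (exchange_big_dep predT) //=; apply: leq_sum => x _.
rewrite sum_nat_const; suff : #|[pred d : 'I_k.+2 | heap_dep x == d.+1]| <= 1.
  by move=> h; rewrite -[X in _ <= X]mul1n leq_mul2r h orbT.
apply/card_le1P => d; rewrite inE => /eqP-> d'; rewrite !inE eqSS eq_sym.
by [].
Qed.

End Balanced.

(** Each colour class inside [S] fits into a block of [M] places, and the vertices outside [S] fill
    the blocks up. [pos] is the index in the concatenation of the three blocks. *)
Lemma balanced_extension (M : nat) (S : {pred 'I_(3 * M)}) (f : 'I_(3 * M) -> nat) :
  #|S| <= M -> (forall u, f u < 3) ->
  exists2 pos : 'I_(3 * M) -> 'I_(3 * M), injective pos &
    forall u, u \in S -> pos u %/ M = f u.
Proof.
move=> SM f3; have [M0|M0] := posnP M; first by exists id => // -[i hi]; exfalso; rewrite M0 in hi.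
pose e := enum 'I_(3 * M).
pose C i := [seq u <- e | (u \in S) && (f u == i)].
pose R := [seq u <- e | u \notin S].
have cnt a : count a (C 0) + count a (C 1) + count a (C 2) + count a R = count a e.
  rewrite /C /R; elim: (e) => //= u s <-.
  case: (u \in S) => /=; last by lia.
  by have := f3 u; case: (f u) => [|[|[|]]] //= _; lia.
have sC i : size (C i) <= M.
  apply: leq_trans SM; rewrite cardE; apply: uniq_leq_size.
    by rewrite filter_uniq ?enum_uniq.
  by move=> u; rewrite mem_filter => /andP[/andP[uS _] _]; rewrite mem_enum.
have sR : size (C 0) + size (C 1) + size (C 2) + size R = 3 * M.
  by have := cnt predT; rewrite !count_predT => ->; rewrite /e size_enum_ord.
pose B0 := C 0 ++ take (M - size (C 0)) R.
pose R1 := drop (M - size (C 0)) R.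
pose B1 := C 1 ++ take (M - size (C 1)) R1.
pose B2 := C 2 ++ drop (M - size (C 1)) R1.
have := sC 0; have := sC 1; have := sC 2 => c2 c1 c0.
have sB0 : size B0 = M by rewrite size_cat size_take_min; lia.
have sB1 : size B1 = M by rewrite size_cat size_take_min size_drop; lia.
have sB2 : size B2 = M by rewrite size_cat !size_drop; lia.
pose Z := B0 ++ B1 ++ B2.
have pZ : perm_eq Z e.
  apply/permP => a; rewrite -cnt /Z /B0 /B1 /B2 !count_cat.
  have hR : count a R = count a (take (M - size (C 0)) R) + count a R1.
    by rewrite -count_cat cat_take_drop.
  have hR1 : count a R1 = count a (take (M - size (C 1)) R1) + count a (drop (M - size (C 1)) R1).
    by rewrite -count_cat cat_take_drop.
  by rewrite hR hR1; ring.
have uZ : uniq Z by rewrite (perm_uniq pZ) enum_uniq.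
have inZ u : u \in Z by rewrite (perm_mem pZ) mem_enum.
have sZ : size Z = 3 * M by rewrite /Z (size_cat B0) (size_cat B1) sB0 sB1 sB2; lia.
have ltZ u : index u Z < 3 * M by have := inZ u; rewrite -index_mem sZ.
exists (fun u => Ordinal (ltZ u)).
  by move=> u v [] /(congr1 (nth u Z)); rewrite !nth_index.
move=> u uS /=; have uC : u \in C (f u) by rewrite mem_filter uS eqxx mem_enum.
have := uZ; rewrite !cat_uniq => /and3P[_ /hasPn d0 /and3P[_ /hasPn d1 _]].
have : f u < 3 by [].
rewrite /Z (index_cat u B0) (index_cat u B1) sB0 sB1; move: uC.
have iB B : size B = M -> u \in B -> index u B < M by move=> sB; rewrite -index_mem sB.
case: (f u) => [|[|[|]]] // uC _.
- have uB : u \in B0 by rewrite mem_cat uC.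
  by rewrite uB divn_small // iB.
- have uB : u \in B1 by rewrite mem_cat uC.
  have /d0/negPf/= -> : u \in B1 ++ B2 by rewrite mem_cat uB.
  by rewrite uB -{1}[M]mul1n divnMDl // divn_small // iB.
- have uB : u \in B2 by rewrite mem_cat uC.
  have /d0/negPf/= -> : u \in B1 ++ B2 by rewrite mem_cat uB orbT.
  have /d1/negPf/= -> := uB.
  by rewrite addnA addnn -mul2n divnMDl // divn_small // iB.
Qed.

(** Forbidding only the steps into [r] confines a walk that starts elsewhere to one branch, and it
    is the test that the closure loops of the machine perform. *)
Definition avoid (V : finType) (T : sgraph V) (r : V) : rel V := fun x y => T x y && (y != r).

Lemma connect_avoid (V : finType) (T : sgraph V) r par dep (c x : V) :
  rooted T r par dep -> c \in kids r par r ->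
  connect (avoid T r) c x = (c \in ancs par dep x).
Proof.
move=> RT ck; have cr : c != r by move: ck; rewrite inE => /andP[].
have pc : par c = r by move: ck; rewrite inE => /andP[_ /eqP].
apply/idP/idP.
  case/connectP => p cp ->; suff gen y : path (avoid T r) y p ->
      c \in ancs par dep y -> c \in ancs par dep (last y p).
    by apply: gen cp _; apply: (ancs_self RT).
  elim: p y {cp} => [|z p IH] y //= /andP[/andP[yz zr] zp] cy.
  apply: IH zp _; case/orP: (rt_edge RT yz) => /andP[nr /eqP e].
    move: cy; rewrite e (ancsU RT nr) in_setU1 => /predU1P[ey|//].
    by move: zr; rewrite e -ey pc eqxx.
  by rewrite (ancsU RT) // -e in_setU1 cy orbT.
elim/(rt_ind RT): x => [|x xr IH]; first by rewrite (ancs_root RT) in_set0.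
rewrite (ancsU RT) // in_setU1 => /predU1P[->//|/IH h]; apply: connect_trans h _.
by apply: connect1; rewrite /avoid xr adj_sym (rt_adj RT).
Qed.

(* [r] is a node such that the three branches [c i] at [r] colour [H]. *)
Definition splits (n : nat) (V : finType) (T : sgraph V) (phi : 'I_n -> V)
    (H : rel 'I_n) (r : V) (c : nat -> V) : Prop :=
  [/\ forall i, c i != r,
      forall u, exists2 i, i < 3 & connect (avoid T r) (c i) (phi u) &
      forall u v i, H u v -> ~~ (connect (avoid T r) (c i) (phi u) &&
                                 connect (avoid T r) (c i) (phi v))].

(** * Optimal layouts split a 3-colourable graph *)

Section MinimumLayout.
Variables (k : nat).
Let n := 3 * 2 ^ k.+1.
Variables (H : rel 'I_n) (G : sgraph 'I_n) (S : {pred 'I_n}) (f : 'I_n -> nat).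
Hypothesis irrH : irreflexive H.
Hypothesis GH : forall u v, G u v = (u != v) && ~~ H u v.
Hypothesis HS : forall u v, H u v -> (u \in S) && (v \in S).
Hypothesis S_small : 4 * #|S| <= 2 ^ k.+1.
Hypothesis f3 : forall u, f u < 3.
Hypothesis fH : forall u v, H u v -> f u != f v.

Lemma deg_support u : \sum_v H u v <= #|S|.
Proof.
rewrite card_sum; apply: leq_sum => v _.
by case: (boolP (H u v)) => // /HS/andP[_ ->].
Qed.

Lemma exists_good_layout : exists (T : sgraph 'I_(2 * n - 3).+1) (phi : 'I_n -> 'I_(2 * n - 3).+1),
  tree_layout G T phi /\
  layout_length G T phi + \sum_u \sum_v H u v * k.+2 + n * (2 ^ k.+2 - 1)
  <= n * (n * k.+2).
Proof.
have SM : #|S| <= 2 ^ k.+1 by lia.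
have [pos pos_inj posS] := balanced_extension SM f3.
have posH u v : H u v -> pos u %/ 2 ^ k.+1 != pos v %/ 2 ^ k.+1.
  by move=> h; have /andP[uS vS] := HS h; rewrite !posS ?fH.
have n2 : 2 < n by rewrite /n; have := expn_gt0 2 k.+1; lia.
exists (heap n2), (heap_leaf pos); split; first exact: heap_layout.
exact: heap_layout_length.
Qed.

(** The good layout meets the lower bound. Existence matters because an oracle is bound only on
    instances that have a solution. *)
Lemma exists_min_layout : exists (T : sgraph 'I_(2 * n - 3).+1) (phi : 'I_n -> 'I_(2 * n - 3).+1),
  min_tree_layout G T phi.
Proof.
have [T [phi [lay len]]] := exists_good_layout; exists T, phi; split=> // N' T' phi' lay'.
have [r [par [dep [_ [_ _ h]]]]] := layout_lower_bound GH deg_support S_small lay'.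
move: (leq_trans len (leq_trans (leq_addr _ _) h)).
by rewrite addnAC leq_add2r leq_add2r.
Qed.

(** Next to the length of the good layout, the lower bound leaves no room for the term that counts
    the pairs of [H] within a branch at the median. *)
Lemma min_layout_splits (V : finType) (T : sgraph V) (phi : 'I_n -> V) :
  min_tree_layout G T phi ->
  #|V| + 2 = 2 * n /\ exists r c, splits T phi H r c.
Proof.
have [T0 [phi0 [lay0 len0]]] := exists_good_layout.
case=> lay /(_ _ _ _ lay0) le0; have [tree _ _ _] := lay.
have n2 : 2 < n by rewrite /n; have := expn_gt0 2 k.+1; lia.
split.
  have [r [par [dep [RT half]]]] := median_root phi tree.
  exact: (card_layout lay RT n2 half).
have [r [par [dep [RT [dr pr h]]]]] := layout_lower_bound GH deg_support S_small lay.
have /eqP : \sum_u \sum_v (H u v && [exists c in kids r par r,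
        (c \in ancs par dep (phi u)) && (c \in ancs par dep (phi v))]) = 0.
  move: le0; set L0 := layout_length _ _ phi0; set L := layout_length _ _ phi => le0.
  apply/eqP; rewrite -leqn0 -(leq_add2l (n * (n * k.+2))) addn0.
  apply: leq_trans h (leq_trans _ len0).
  by rewrite addnAC leq_add2r leq_add2r.
rewrite sum_nat_eq0 => /forallP h0.
have s3 : size (enum (kids r par r)) = 3 by rewrite -cardE (card_kids_root RT).
have [c0 c0k] : exists c0, c0 \in kids r par r by apply/card_gt0P; rewrite (card_kids_root RT) dr.
(* The default [c0] makes [c i] a child of [r] for every [i], since two clauses of [splits] range
   over all [i]. *)
pose c i := nth c0 (enum (kids r par r)) i.
have ck i : c i \in kids r par r.
  rewrite -mem_enum /c; have [hi|hi] := ltnP i (size (enum (kids r par r))).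
    by rewrite mem_nth.
  by rewrite nth_default // mem_enum.
exists r, c; split.
- by move=> i; have := ck i; rewrite inE => /andP[].
- move=> u; have [y yk yu] := ancs_root_kid RT (pr u).
  exists (index y (enum (kids r par r))); first by rewrite -s3 index_mem mem_enum.
  by rewrite (connect_avoid _ RT) // /c nth_index ?mem_enum.
move=> u v i Huv; rewrite !(connect_avoid _ RT) //.
have := h0 u; rewrite implyTb sum_nat_eq0 => /forallP/(_ v).
rewrite implyTb Huv eqb0 => /existsPn/(_ (c i)).
by rewrite ck.
Qed.

End MinimumLayout.

(** * Structured programs on multitape machines *)

Notation Sy := (symbol void).
Definition bit (b : bool) : Sy := Some (inl b).

Inductive instr := IAct of nat & (Sy -> Sy * move * nat) | IAsk of nat.

Definition halt : instr := IAsk 0.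

(* Tapes 0 to 5 hold arrays, the others hold registers in unary.  The labels
   just after the code accept and reject. *)
Definition code_machine (code : seq instr) (R : nat) : machine :=
  @Machine void 'I_(size code).+2 R.+4 ord0
    (fun q => if q == size code :> nat then Some true
              else if q == (size code).+1 :> nat then Some false else None)
    (fun q => if nth halt code q is IAsk l then Some (inord l) else None)
    (fun q v => if nth halt code q is IAct i f then
       ((inord (f (v (inord i))).2),
        fun j => if j == inord i then (f (v j)).1 else (v j, Stay))
     else (q, fun j => (v j, Stay))).

Inductive prog :=
  | Skip
  | Inc of nat
  | Dec of nat
  | MvR of 'I_6
  | MvL of 'I_6
  | Wr of 'I_6 & Sy
  | Seq of prog & prog
  | IfA of 'I_6 & Sy & prog & prog
  | Loop of nat & prog
  | Until of 'I_6 & prog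
  | Ask.

Fixpoint csize (p : prog) : nat :=
  match p with
  | Inc _ => 2
  | Seq p q => csize p + csize q
  | IfA _ _ p q => (csize p + csize q).+1
  | Loop _ p | Until _ p => (csize p).+1
  | _ => 1
  end.

(** [b] is the address of the first instruction and [l] the label reached on exit; loop bodies exit
    to [b]. A register changes at its head only, by moving left and marking or by erasing and moving
    right, so both operations take constant time. *)
Fixpoint comp (p : prog) (b l : nat) : seq instr :=
  match p with
  | Skip => [:: IAct 0 (fun x => (x, Stay, l))]
  | Inc r => [:: IAct (6 + r) (fun x => (x, MoveLeft, b.+1));
                 IAct (6 + r) (fun x => (bit true, Stay, l))]
  | Dec r => [:: IAct (6 + r) (fun x => if x == bit true then (None, MoveRight, l)
                                        else (x, Stay, l))]
  | MvR a => [:: IAct a (fun x => (x, MoveRight, l))]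
  | MvL a => [:: IAct a (fun x => (x, MoveLeft, l))]
  | Wr a s => [:: IAct a (fun x => (s, Stay, l))]
  | Seq p q => comp p b (b + csize p) ++ comp q (b + csize p) l
  | IfA a s p q => IAct a (fun x => (x, Stay, if x == s then b.+1 else b.+1 + csize p))
                   :: comp p b.+1 l ++ comp q (b.+1 + csize p) l
  | Loop r p => IAct (6 + r) (fun x => if x == bit true then (None, MoveRight, b.+1)
                                       else (x, Stay, l)) :: comp p b.+1 b
  | Until a p => IAct a (fun x => (x, Stay, if x == None then l else b.+1))
                 :: comp p b.+1 b
  | Ask => [:: IAsk l]
  end.

Fixpoint regs_lt (R : nat) (p : prog) : bool :=
  match p with
  | Inc r | Dec r => r < R
  | Seq p q | IfA _ _ p q => regs_lt R p && regs_lt R q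
  | Loop r p => (r < R) && regs_lt R p
  | Until _ p => regs_lt R p
  | _ => true
  end.

Record store := Store {
  reg : nat -> nat;
  con : 'I_6 -> nat -> Sy;
  hpos : 'I_6 -> nat
}.

Definition upd (T : eqType) (V : Type) (f : T -> V) (x : T) (v : V) : T -> V :=
  fun y => if y == x then v else f y.

Definition setr (s : store) r v := Store (upd (reg s) r v) (con s) (hpos s).
Definition seta (s : store) a c := Store (reg s) (upd (con s) a c) (hpos s).
Definition setp (s : store) a v := Store (reg s) (con s) (upd (hpos s) a v).

Definition word (w : seq bool) : nat -> Sy := nth None [seq bit b | b <- w].

Definition tapeQ : 'I_6 := @Ordinal 6 1 isT.

Section Exec.
Variable O : seq bool -> seq bool.

(** Big-step semantics with exact running times. There is no rule for leaving an array to the left.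
    A query needs the head at 0 and a word as the contents, because a machine reads its query from
    the head to the first cell without a bit. *)
Inductive texec : prog -> store -> store -> nat -> Prop :=
  | XSkip s : texec Skip s s 1
  | XInc r s : texec (Inc r) s (setr s r (reg s r).+1) 2
  | XDec r s : texec (Dec r) s (setr s r (reg s r).-1) 1
  | XMvR a s : texec (MvR a) s (setp s a (hpos s a).+1) 1
  | XMvL a s p : hpos s a = p.+1 -> texec (MvL a) s (setp s a p) 1
  | XWr a x s : texec (Wr a x) s (seta s a (upd (con s a) (hpos s a) x)) 1
  | XSeq p q s1 s2 s3 t1 t2 : texec p s1 s2 t1 -> texec q s2 s3 t2 ->
      texec (Seq p q) s1 s3 (t1 + t2)
  | XIfA a x p q s s' t :
      texec (if con s a (hpos s a) == x then p else q) s s' t ->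
      texec (IfA a x p q) s s' t.+1
  | XLoop0 r p s : reg s r = 0 -> texec (Loop r p) s s 1
  | XLoopS r p s s1 s2 v t1 t2 : reg s r = v.+1 ->
      texec p (setr s r v) s1 t1 -> texec (Loop r p) s1 s2 t2 ->
      texec (Loop r p) s s2 (t1 + t2).+1
  | XUntil0 a p s : con s a (hpos s a) = None -> texec (Until a p) s s 1
  | XUntilS a p s s1 s2 t1 t2 : con s a (hpos s a) != None ->
      texec p s s1 t1 -> texec (Until a p) s1 s2 t2 ->
      texec (Until a p) s s2 (t1 + t2).+1
  | XAsk w s : hpos s tapeQ = 0 -> con s tapeQ =1 word w ->
      texec Ask s (seta s tapeQ (word (O w))) 1.

End Exec.

Definition located (code : seq instr) (b : nat) (l : seq instr) : Prop :=
  b + size l <= size code /\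
  forall i, i < size l -> nth halt code (b + i) = nth halt l i.

Lemma located_cat code b l1 l2 : located code b (l1 ++ l2) ->
  located code b l1 /\ located code (b + size l1) l2.
Proof.
rewrite /located size_cat => -[h H]; split; split; try lia.
  by move=> i hi; rewrite H ?nth_cat ?hi //; lia.
by move=> i hi; rewrite -addnA H ?nth_cat ?ltnNge ?leq_addr /= ?addKn //; lia.
Qed.

Lemma located_cons code b i l : located code b (i :: l) ->
  [/\ b < size code, nth halt code b = i & located code b.+1 l].
Proof.
move=> [h H]; have := H 0 (ltn0Sn _); rewrite addn0 /= => h0.
split=> //; first by move: h => /=; lia.
split; first by move: h => /=; lia.
by move=> j hj; rewrite addSnnS H.
Qed.

Lemma size_comp p b l : size (comp p b l) = csize p.
Proof.
elim: p b l => //=.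
- by move=> p IHp q IHq b l; rewrite size_cat IHp IHq.
- by move=> a s p IHp q IHq b l; rewrite size_cat IHp IHq.
- by move=> r p IHp b l; rewrite IHp.
- by move=> r p IHp b l; rewrite IHp.
Qed.

Section Simulation.
Variables (O : seq bool -> seq bool) (code : seq instr) (R : nat).
Let M := code_machine code R.
Notation tapes := ('I_(R.+4).+2 -> tape void).

(** Cells are compared through [nth None] because rewriting a blank may lengthen the list without
    changing the contents of the tape. *)
Definition okR (v : nat) (t : tape void) : Prop :=
  forall k, nth None t.1 k = None /\ nth None t.2 k = if k < v then bit true else None.

Definition okA (c : nat -> Sy) (p : nat) (t : tape void) : Prop :=
  (forall k, k < p -> nth None t.1 k = c (p - k.+1)) /\
  (forall k, nth None t.2 k = c (p + k)).

Definition rep (s : store) (tp : tapes) : Prop :=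
  (forall r, r < R -> okR (reg s r) (tp (inord (6 + r)))) /\
  (forall a : 'I_6, okA (con s a) (hpos s a) (tp (inord a))).

Lemma tape_readE (t : tape void) : tape_read t = nth None t.2 0.
Proof. by case: t => l []. Qed.

Lemma tape_idle (t : tape void) k :
  nth None (tape_update t (tape_read t, Stay)).1 k = nth None t.1 k /\
  nth None (tape_update t (tape_read t, Stay)).2 k = nth None t.2 k.
Proof. by case: t => l [|x r]; case: k => [|k] //=; rewrite ?nth_nil. Qed.

Lemma okR_idle v t : okR v t -> okR v (tape_update t (tape_read t, Stay)).
Proof. by move=> h k; have [-> ->] := tape_idle t k. Qed.

Lemma okA_idle c p t : okA c p t -> okA c p (tape_update t (tape_read t, Stay)).
Proof.
by case=> h1 h2; split=> k; have [e1 e2] := tape_idle t k; rewrite ?e1 ?e2 //; apply: h1.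
Qed.

Lemma okR_read v t : okR v t -> tape_read t = if 0 < v then bit true else None.
Proof. by move=> h; rewrite tape_readE; case: (h 0). Qed.

Lemma okA_read c p t : okA c p t -> tape_read t = c p.
Proof. by case=> _ h; rewrite tape_readE h addn0. Qed.

Definition acts (tp tp' : tapes) (i : nat) (w : Sy * move) : Prop :=
  forall j, tp' j = tape_update (tp j) (if j == inord i then w else (tape_read (tp j), Stay)).

Lemma step_act b i f (tp : tapes) : b < size code -> nth halt code b = IAct i f ->
  exists2 tp' : tapes, @step O M (inord b, tp) =
    (inord (f (tape_read (tp (inord i)))).2, tp') &
    acts tp tp' i (f (tape_read (tp (inord i)))).1.
Proof.
move=> hb hc; have bS : b < (size code).+2 by lia.
rewrite /step /= inordK // (ltn_eqF hb) (ltn_eqF (leqW hb)) hc /= ffunE.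
eexists; first reflexivity.
by move=> j /=; case: ifP => [/eqP->|_]; rewrite ffunE.
Qed.

Lemma rep_acts s s' tp tp' i w : i < 6 + R -> rep s tp -> acts tp tp' i w ->
  (forall r, r < R -> if 6 + r == i then okR (reg s' r) (tape_update (tp (inord i)) w)
                      else reg s' r = reg s r) ->
  (forall a : 'I_6, if a == i :> nat then okA (con s' a) (hpos s' a) (tape_update (tp (inord i)) w)
                    else con s' a = con s a /\ hpos s' a = hpos s a) ->
  rep s' tp'.
Proof.
move=> hi [rR rA] hact hR hA; split=> [r rR'|a].
  have := hR r rR'; rewrite hact -val_eqE /= !inordK; try lia.
  by case: eqP => [->//|_ ->]; apply/okR_idle/rR.
have := hA a; have := ltn_ord a; rewrite hact -val_eqE /= => a6; rewrite !inordK; try lia.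
by case: eqP => [->//|_ [-> ->]]; apply/okA_idle/rA.
Qed.

Lemma rep_idle s tp tp' i : i < 6 + R -> rep s tp ->
  acts tp tp' i (tape_read (tp (inord i)), Stay) -> rep s tp'.
Proof.
move=> hi hr hact; have [rR rA] := hr; apply: (rep_acts hi hr hact).
  by move=> r rR'; case: eqP => // e; subst i; apply/okR_idle/rR.
by move=> a; case: eqP => // e; subst i; apply/okA_idle/rA.
Qed.

Lemma rep_setr s tp tp' r v w : r < R -> rep s tp -> acts tp tp' (6 + r) w ->
  okR v (tape_update (tp (inord (6 + r))) w) -> rep (setr s r v) tp'.
Proof.
move=> hr h hact ok; apply: (rep_acts _ h hact); first lia.
  by move=> r' _; rewrite eqn_add2l /= /upd; case: eqP.
by move=> a; case: eqP => // e; have := ltn_ord a; lia.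
Qed.

Lemma rep_setpa s s' tp tp' (a : 'I_6) w : rep s tp -> acts tp tp' a w ->
  okA (con s' a) (hpos s' a) (tape_update (tp (inord a)) w) ->
  reg s' = reg s -> (forall b, b != a -> con s' b = con s b /\ hpos s' b = hpos s b) ->
  rep s' tp'.
Proof.
move=> h hact ok er ec; apply: (rep_acts _ h hact).
- by have := ltn_ord a; lia.
- by move=> r rR; case: eqP => [e|_]; [have := ltn_ord a; lia|rewrite er].
- by move=> b; case: (eqVneq b a) => [->|ba]; [rewrite eqxx|rewrite val_eqE (negPf ba); apply: ec].
Qed.

Definition reaches b s l s' t := forall tp, rep s tp ->
  exists2 tp', rep s' tp' & iter t (@step O M) (inord b, tp) = (inord l, tp').

Lemma reaches_trans b1 b2 b3 s1 s2 s3 t1 t2 :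
  reaches b1 s1 b2 s2 t1 -> reaches b2 s2 b3 s3 t2 -> reaches b1 s1 b3 s3 (t1 + t2).
Proof.
move=> h1 h2 tp /h1[tp1 /h2[tp2 r2 e2] e1]; exists tp2 => //.
by rewrite addnC iterD e1.
Qed.

Lemma reaches_act b i f s l s' : b < size code -> nth halt code b = IAct i f ->
  (forall tp, rep s tp -> (f (tape_read (tp (inord i)))).2 = l /\
     forall tp', acts tp tp' i (f (tape_read (tp (inord i)))).1 -> rep s' tp') ->
  reaches b s l s' 1.
Proof.
move=> hb hc hf tp hr; have [e h] := hf tp hr.
by have [tp' st /h r'] := step_act tp hb hc; exists tp' => //; rewrite /= st e.
Qed.

Lemma reaches_test b i f s l : i < 6 + R -> b < size code -> nth halt code b = IAct i f ->
  (forall tp, rep s tp -> f (tape_read (tp (inord i))) = (tape_read (tp (inord i)), Stay, l)) ->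
  reaches b s l s 1.
Proof.
move=> hi hb hc hf; apply: (reaches_act hb hc) => tp hr.
rewrite (hf tp hr); split=> // tp'; exact: rep_idle.
Qed.

Lemma rep_read_reg s tp r : r < R -> rep s tp ->
  tape_read (tp (inord (6 + r))) = if 0 < reg s r then bit true else None.
Proof. by move=> hr [/(_ r hr)/okR_read]. Qed.

Lemma rep_read_arr s tp (a : 'I_6) : rep s tp -> tape_read (tp (inord a)) = con s a (hpos s a).
Proof. by move=> [_ /(_ a)/okA_read]. Qed.

Lemma reaches_dec b r l s v f : r < R -> b < size code ->
  nth halt code b = IAct (6 + r) f -> f (bit true) = (None, MoveRight, l) ->
  reg s r = v.+1 -> reaches b s l (setr s r v) 1.
Proof.
move=> hr hb hc hf hv; apply: (reaches_act hb hc) => tp rp.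
rewrite (rep_read_reg hr rp) hv /= hf; split=> // tp' /(rep_setr hr rp); apply.
move=> k; have [/(_ r hr)] := rp; rewrite hv; case: (tp _) => l1 r1 h _.
split; first by case: k => //= k; case: (h k).
by rewrite /= nth_behead; case: (h k.+1) => _ ->.
Qed.

Lemma reaches_inc b r l s : r < R -> located code b (comp (Inc r) b l) ->
  reaches b s l (setr s r (reg s r).+1) 2.
Proof.
move=> hr /located_cons[hb hc /located_cons[hb' hc' _]] tp rp.
have [tp1 st1 a1] := step_act tp hb hc.
have [tp2 st2 a2] := step_act tp1 hb' hc'.
exists tp2; last by rewrite /= st1 /= st2.
have [rR rA] := rp; split=> [r' rr'|a]; last first.
  have a6 := ltn_ord a; rewrite a2 a1 -!val_eqE /= !inordK; try lia.
  by case: eqP => [e|_]; [lia | apply/okA_idle/okA_idle/rA].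
rewrite a2 a1 -!val_eqE /= !inordK; try lia.
rewrite eqn_add2l /= /upd; case: eqP => [->|_]; last by apply/okR_idle/okR_idle/rR.
  move=> k; have := rR r hr; case: (tp _) => l1 r1 h; rewrite /tape_update /=.
  split; first by rewrite nth_behead; case: (h k.+1).
  case: k => [|k] //=; have := h k; rewrite ltnS /tape_read /=.
  by case: r1 {h} => [|x r1] /= [_ <-]; case: k => //= k; rewrite ?nth_nil.
Qed.

Lemma rep_read_mark s tp r : r < R -> rep s tp ->
  (tape_read (tp (inord (6 + r))) == bit true) = (0 < reg s r).
Proof. by move=> hr rp; rewrite (rep_read_reg hr rp); case: (0 < _). Qed.

Lemma simulate p s s' t : texec O p s s' t -> forall b l,
  located code b (comp p b l) -> l < (size code).+2 -> regs_lt R p -> reaches b s l s' t.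
Proof.
elim=> {p s s' t}.
- move=> s b l /located_cons[hb hc _] _ _.
  by apply: (reaches_test _ hb hc).
- by move=> r s b l hc _ hr; apply: reaches_inc.
- move=> r s b l /located_cons[hb hc _] _ /= hr.
  case hv : (reg s r) => [|v]; last exact: (reaches_dec hr hb hc).
  have ht : reaches b s l s 1.
    apply: (reaches_test _ hb hc); rewrite ?ltn_add2l // => tp rp.
    by rewrite (rep_read_mark hr rp) hv.
  move=> tp rp; have [tp2 rp2 e] := ht tp rp.
  exists tp2 => //; have [h1 h2] := rp2; split=> // r' hr'; have := h1 r' hr'.
  by rewrite /= /upd; case: eqP => // ->; rewrite hv.
- move=> a s b l /located_cons[hb hc _] _ _; apply: (reaches_act hb hc) => tp rp.
  split=> // tp' /(rep_setpa rp); apply=> //=; last first.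
    by move=> b' ne; rewrite /upd (negPf ne).
  rewrite /upd eqxx (rep_read_arr a rp); have [_ /(_ a)[h1 h2]] := rp.
  case: (tp _) h1 h2 => l1 r1 /= h1 h2; rewrite /tape_update /=; split=> k; last by rewrite nth_behead h2 addnS.
  by case: k => [|k] /=; rewrite ?subSS ?subn0 // ltnS; apply: h1.
- move=> a s q hq b l /located_cons[hb hc _] _ _; apply: (reaches_act hb hc) => tp rp.
  split=> // tp' /(rep_setpa rp); apply=> //=; last first.
    by move=> b' ne; rewrite /upd (negPf ne).
  rewrite /upd eqxx (rep_read_arr a rp) hq; have [_ /(_ a)[h1 h2]] := rp.
  rewrite hq in h1 h2; case: (tp _) h1 h2 => l1 r1 /= h1 h2; rewrite /tape_update /=; split=> k.
    by move=> kq; rewrite nth_behead h1 // subSS.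
  case: k => [|[|k]] /=; rewrite ?addn0 -?nth0 ?h1 ?subSS ?subn0 ?addn1 //.
  by rewrite nth_behead h2 addSnnS.
- move=> a x s b l /located_cons[hb hc _] _ _; apply: (reaches_act hb hc) => tp rp.
  split=> // tp' /(rep_setpa rp); apply=> //=; last first.
    by move=> b' ne; rewrite /upd (negPf ne).
  rewrite /upd eqxx; have [_ /(_ a)[h1 h2]] := rp.
  case: (tp _) h1 h2 => l1 r1 /= h1 h2; rewrite /tape_update /=; split=> k.
    by move=> kp; rewrite h1 // ifN //; lia.
  by case: k => [|k] /=; rewrite ?addn0 ?eqxx // nth_behead h2 ifN //; lia.
- move=> p q s1 s2 s3 t1 t2 _ IHp _ IHq b l /located_cat[].
  rewrite size_comp => hp hq hl /= /andP[rp rq].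
  apply: reaches_trans (IHq _ _ hq hl rq); apply: IHp => //.
  by case: hq => h _; lia.
- move=> a x p q s s' t _ IH b l /located_cons[hb hc].
  move=> /located_cat[]; rewrite size_comp => hp hq hl /= /andP[rp rq].
  rewrite -[t.+1]add1n; apply: (@reaches_trans _ (if con s a (hpos s a) == x then b.+1 else b.+1 + csize p) _ _ s).
    apply: (reaches_test _ hb hc); first by have := ltn_ord a; lia.
    by move=> tp hr; rewrite (rep_read_arr a hr).
  by case: eqP IH => _; apply.
- move=> r p s hr b l /located_cons[hb hc _] _ /= /andP[rR _].
  by apply: (reaches_test _ hb hc); rewrite ?ltn_add2l // => tp rp; rewrite (rep_read_mark rR rp) hr.
- move=> r p s s1 s2 v t1 t2 hv _ IH1 _ IH2 b l hloc hl hreg.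
  have /located_cons[hb hc hp] := hloc; have /= /andP[rR rp] := hreg.
  rewrite -[_.+1]add1n; apply: reaches_trans (reaches_trans (IH1 _ _ hp _ rp) (IH2 _ _ hloc hl hreg)).
    exact: (reaches_dec rR hb hc).
  lia.
- move=> a p s hn b l /located_cons[hb hc _] _ _.
  apply: (reaches_test _ hb hc); first by have := ltn_ord a; lia.
  by move=> tp rp; rewrite (rep_read_arr a rp) hn.
- move=> a p s s1 s2 t1 t2 hn _ IH1 _ IH2 b l hloc hl hreg.
  have /located_cons[hb hc hp] := hloc.
  rewrite -[_.+1]add1n; apply: reaches_trans (reaches_trans (IH1 _ _ hp _ hreg) (IH2 _ _ hloc hl hreg)).
    apply: (reaches_test _ hb hc); first by have := ltn_ord a; lia.
    by move=> tp rp; rewrite (rep_read_arr a rp) (negPf hn).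
  lia.
move=> w s hp hw b l /located_cons[hb hc _] hl _ tp rp.
pose tp' : tapes := fun i => if val i == 1 then tape_of_word _ (O (leading_bits (tp i).2)) else tp i.
exists tp'; last first.
  rewrite /= /step /= inordK ?(leqW (leqW hb)) // (ltn_eqF hb) (ltn_eqF (leqW hb)) hc.
  by [].
have [h1 h2] := rp; split=> [r hr|a].
  by rewrite /tp' /= inordK; [exact: h1 | lia].
have a6 := ltn_ord a; rewrite /tp' /= inordK; last lia.
rewrite /upd; case: (eqVneq a tapeQ) => [->|aQ]; last first.
  rewrite ifN; first exact: h2.
  by apply: contra aQ => /eqP e; apply/eqP/val_inj.
rewrite /= hp; split=> // k; rewrite add0n /word; congr (nth _ _ _).
congr ([seq _ | _ <- O _]); have [_] := h2 tapeQ; rewrite hp /=.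
set tq := (tp _).2 => htq; have {htq hw} : nth None tq =1 word w by move=> i; rewrite htq add0n hw.
rewrite /word; elim: w tq => [|x w IH] [|y tq] h //=.
- by have := h 0; rewrite /= => ->.
- by have := h 0.
- by have := h 0; rewrite /= => ->; congr (_ :: _); apply: IH => i; apply: (h i.+1).
Qed.

End Simulation.

(** As the base is at least 2, sums and constant factors are absorbed by the exponent, and a single
    power stands for a polynomial. *)
Definition polyb (f : nat -> nat) := exists c, forall b, f b <= (b + 2) ^ c.

Lemma polyb_le f g : (forall b, f b <= g b) -> polyb g -> polyb f.
Proof. by move=> h [c hc]; exists c => b; apply: leq_trans (hc b). Qed.

Lemma polyb_exp c : polyb (fun b => (b + 2) ^ c).
Proof. by exists c. Qed.

Lemma polyb_const c : polyb (fun=> c).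
Proof.
exists c => b; apply: leq_trans (ltnW (ltn_expl c (isT : 1 < 2))) _.
by case: c => // c; rewrite leq_exp2r // leq_addl.
Qed.

Lemma polyb_id : polyb id.
Proof. by exists 1 => b; rewrite expn1 leq_addr. Qed.

Lemma polyb_mul f g : polyb f -> polyb g -> polyb (fun b => f b * g b).
Proof. by move=> [c hc] [d hd]; exists (c + d) => b; rewrite expnD leq_mul. Qed.

Lemma polyb_add f g : polyb f -> polyb g -> polyb (fun b => f b + g b).
Proof.
move=> [c hc] [d hd]; exists (c + d).+1 => b.
have p : 0 < b + 2 by rewrite addn2.
apply: leq_trans (leq_add (hc b) (hd b)) _; rewrite expnS.
apply: leq_trans (_ : 2 * (b + 2) ^ (c + d) <= _); last by rewrite leq_mul2r leq_addl orbT.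
by rewrite mul2n -addnn leq_add // leq_exp2l ?addn2 // ?leq_addr ?leq_addl.
Qed.

Lemma polyb_pow f c : polyb f -> polyb (fun b => (f b + 2) ^ c).
Proof.
move=> pf; have [d hd] := polyb_add pf (polyb_const 2).
exists (d * c) => b; rewrite expnM; case: c => // c; by rewrite leq_exp2r.
Qed.

Ltac polyb_tac := repeat first
  [ exact: polyb_exp | exact: polyb_const | exact: polyb_id
  | apply: polyb_add | apply: polyb_mul | apply: polyb_pow ].

Lemma store_eq (s s' : store) : reg s =1 reg s' -> con s =2 con s' -> hpos s =1 hpos s' -> s = s'.
Proof.
case: s s' => [r c p] [r' c' p'] /= hr hc hp; congr Store.
- exact: functional_extensionality.
- by apply: functional_extensionality => a; apply: functional_extensionality.
- exact: functional_extensionality.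
Qed.

Ltac upd_cases := rewrite /= /upd; repeat case: eqP => ? /=; try subst; try lia.

Ltac store_tac := apply: store_eq => // ?; upd_cases.

Section Runs.
Variable O : seq bool -> seq bool.

Definition runs p s s' T := exists2 t, texec O p s s' t & t <= T.

Lemma runs_le p s s' T T' : runs p s s' T -> T <= T' -> runs p s s' T'.
Proof. by move=> [t h ht] hT; exists t => //; apply: leq_trans hT. Qed.

Lemma runs_seq p q s1 s2 s3 T1 T2 :
  runs p s1 s2 T1 -> runs q s2 s3 T2 -> runs (Seq p q) s1 s3 (T1 + T2).
Proof. by move=> [t h ht] [t' h' ht']; exists (t + t'); [apply: XSeq h h'|apply: leq_add]. Qed.

(** [F i] is the store before round [i]. The counted loops below are handled by giving [F] in closed
    form and checking one round. *)
Lemma runs_loop r p (F : nat -> store) v c :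
  (forall i, i <= v -> reg (F i) r = v - i) ->
  (forall i, i < v -> runs p (setr (F i) r (v - i.+1)) (F i.+1) c) ->
  runs (Loop r p) (F 0) (F v) (v * c.+1 + 1).
Proof.
elim: v F => [|v IH] F hr hb.
  by exists 1 => //; apply: XLoop0; rewrite hr.
have [t1 h1 le1] := hb 0 isT.
have [|i iv|t2 h2 le2] := IH (fun i => F i.+1); first by move=> i iv; rewrite hr ?subSS.
  by have := hb i.+1; rewrite !subSS; apply.
exists (t1 + t2).+1; last by rewrite mulSn; lia.
by apply: XLoopS h2; [rewrite hr // subn0 | move: h1; rewrite subSS subn0].
Qed.

Lemma runs_drain r p (F : nat -> store) s s' c : (forall i, reg (F i) r = reg s r - i) ->
  (forall i, i < reg s r -> runs p (setr (F i) r (reg s r - i.+1)) (F i.+1) c) ->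
  F 0 = s -> F (reg s r) = s' -> runs (Loop r p) s s' (c.+1 * reg s r + 1).
Proof.
move=> hr hb e0 e1; have := runs_loop (F := F) (v := reg s r) (fun i _ => hr i) hb.
by rewrite e0 e1 mulnC.
Qed.

Lemma runs_inc r s : runs (Inc r) s (setr s r (reg s r).+1) 2.
Proof. by exists 2 => //; constructor. Qed.

Lemma runs_skip s : runs Skip s s 1.
Proof. by exists 1 => //; constructor. Qed.

Lemma runs_dec r s : runs (Dec r) s (setr s r (reg s r).-1) 1.
Proof. by exists 1 => //; constructor. Qed.

Lemma runs_to p s s1 s2 T : s1 = s2 -> runs p s s1 T -> runs p s s2 T.
Proof. by move=> ->. Qed.

Lemma runs_move r k s : r != k ->
  runs (Loop r (Inc k)) s (setr (setr s k (reg s k + reg s r)) r 0) (3 * reg s r + 1).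
Proof.
move=> rk; pose F i := setr (setr s k (reg s k + i)) r (reg s r - i).
apply: (runs_drain (F := F)) => [i|i iv||].
- by rewrite /= /upd eqxx.
- apply: runs_to (runs_inc _ _); apply: store_eq => // x.
  by upd_cases; move/eqP: rk.
all: by rewrite /F ?subn0 ?subnn; store_tac.
Qed.

Lemma runs_copy r k k' s : r != k -> r != k' -> k != k' ->
  runs (Loop r (Seq (Inc k) (Inc k'))) s
    (setr (setr (setr s k (reg s k + reg s r)) k' (reg s k' + reg s r)) r 0) (5 * reg s r + 1).
Proof.
move=> /eqP rk /eqP rk' /eqP kk'.
pose F i := setr (setr (setr s k (reg s k + i)) k' (reg s k' + i)) r (reg s r - i).
apply: (runs_drain (F := F)) => [i|i iv||].
- by rewrite /= /upd eqxx.
- apply: runs_to (runs_seq (runs_inc _ _) (runs_inc _ _)).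
  by store_tac.
all: by rewrite /F ?subn0 ?subnn; store_tac.
Qed.

Lemma runs_clear r s : runs (Loop r Skip) s (setr s r 0) (2 * reg s r + 1).
Proof.
pose F i := setr s r (reg s r - i).
apply: (runs_drain (F := F)) => [i|i iv||].
- by rewrite /= /upd eqxx.
- by apply: runs_to (runs_skip _); store_tac.
all: by rewrite /F ?subn0 ?subnn; store_tac.
Qed.

Lemma runs_sub r k s : r != k ->
  runs (Loop r (Dec k)) s (setr (setr s k (reg s k - reg s r)) r 0) (2 * reg s r + 1).
Proof.
move=> /eqP rk; pose F i := setr (setr s k (reg s k - i)) r (reg s r - i).
apply: (runs_drain (F := F)) => [i|i iv||].
- by rewrite /= /upd eqxx.
- by apply: runs_to (runs_dec _ _); store_tac.
all: by rewrite /F ?subn0 ?subnn; store_tac.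
Qed.

Lemma runs_right r k a s : r != k ->
  runs (Loop r (Seq (MvR a) (Inc k))) s
    (setp (setr (setr s k (reg s k + reg s r)) r 0) a (hpos s a + reg s r)) (4 * reg s r + 1).
Proof.
move=> /eqP rk.
pose F i := setp (setr (setr s k (reg s k + i)) r (reg s r - i)) a (hpos s a + i).
apply: (runs_drain (F := F)) => [i|i iv||].
- by rewrite /= /upd eqxx.
- apply: runs_le (_ : runs _ _ _ (1 + 2)) _ => //.
  have h1 s1 : runs (MvR a) s1 (setp s1 a (hpos s1 a).+1) 1 by exists 1 => //; constructor.
  apply: runs_to (runs_seq (h1 _) (runs_inc _ _)).
  by store_tac.
all: by rewrite /F ?subn0 ?subnn; store_tac.
Qed.

Lemma runs_left r a s : reg s r <= hpos s a ->
  runs (Loop r (MvL a)) s (setp (setr s r 0) a (hpos s a - reg s r)) (2 * reg s r + 1).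
Proof.
move=> le; pose F i := setp (setr s r (reg s r - i)) a (hpos s a - i).
apply: (runs_drain (F := F)) => [i|i iv||].
- by rewrite /= /upd eqxx.
- exists 1 => //.
  have -> : F i.+1 = setp (setr (F i) r (reg s r - i.+1)) a (hpos s a - i.+1).
    by store_tac.
  by apply: XMvL; rewrite /= /upd eqxx; lia.
all: by rewrite /F ?subn0 ?subnn; store_tac.
Qed.

End Runs.

(** * A language of bounded loops over bit arrays *)

Definition arrays := 'I_6 -> nat -> Sy.

Inductive term := V of nat | K of nat | Add of term & term | Mul of term & term.

Inductive bexp :=
  | Le of term & term
  | Bit of 'I_6 & term & Sy
  | Not of bexp
  | And of bexp & bexp
  | Ex of term & bexp.

Inductive cmd :=
  | CSeq of cmd & cmd
  | CFor of term & cmd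
  | CIf of bexp & cmd
  | CSet of 'I_6 & term & Sy.

Fixpoint teval (rho : nat -> nat) (e : term) : nat :=
  match e with
  | V i => rho i
  | K c => c
  | Add e1 e2 => teval rho e1 + teval rho e2
  | Mul e1 e2 => teval rho e1 * teval rho e2
  end.

(* Binders are numbered by their level [l]; the right operand of [And] is one
   level deeper, since the value of the left one occupies the current level. *)
Fixpoint beval (al : arrays) (l : nat) (rho : nat -> nat) (b : bexp) : bool :=
  match b with
  | Le e1 e2 => teval rho e1 <= teval rho e2
  | Bit a e x => al a (teval rho e) == x
  | Not b => ~~ beval al l rho b
  | And b1 b2 => beval al l rho b1 && beval al l.+1 rho b2
  | Ex e b => has (fun v => beval al l.+1 (upd rho l v) b) (iota 0 (teval rho e))
  end.

Fixpoint ceval (l : nat) (rho : nat -> nat) (c : cmd) (al : arrays) : arrays :=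
  match c with
  | CSeq c1 c2 => ceval l rho c2 (ceval l rho c1 al)
  | CFor e c => foldl (fun al v => ceval l.+1 (upd rho l v) c al) al (iota 0 (teval rho e))
  | CIf b c => if beval al l rho b then ceval l rho c al else al
  | CSet a e x => upd al a (upd (al a) (teval rho e) x)
  end.

Fixpoint incs (c k : nat) : prog := if c is c'.+1 then Seq (Inc k) (incs c' k) else Skip.

(* Level [l] owns the registers [3 l] (variable or truth value), [3 l + 1]
   (loop counter) and [3 l + 2]; [cterm l k e] puts the value of [e] in [k]. *)
Fixpoint cterm (l k : nat) (e : term) : prog :=
  match e with
  | V i => if i < l then Seq (Loop (3 * i) (Seq (Inc k) (Inc k.+1))) (Loop k.+1 (Inc (3 * i)))
           else Skip
  | K c => incs c k
  | Add e1 e2 => Seq (cterm l k e1) (Seq (cterm l k.+1 e2) (Loop k.+1 (Inc k)))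
  | Mul e1 e2 =>
      Seq (cterm l k.+1 e1) (Seq (cterm l k.+2 e2)
        (Seq (Loop k.+1 (Seq (Loop k.+2 (Seq (Inc k) (Inc k.+3))) (Loop k.+3 (Inc k.+2))))
             (Loop k.+2 Skip)))
  end.

Fixpoint cbexp (l : nat) (b : bexp) : prog :=
  let k := 3 * l in
  match b with
  | Le e1 e2 =>
      Seq (cterm l k.+1 e1) (Seq (cterm l k.+2 e2) (Seq (Loop k.+2 (Dec k.+1))
        (Seq (Inc k) (Loop k.+1 (Dec k)))))
  | Bit a e x =>
      Seq (cterm l k e) (Seq (Loop k (Seq (MvR a) (Inc k.+1)))
        (Seq (IfA a x (Inc k) Skip) (Loop k.+1 (MvL a))))
  | Not b => Seq (cbexp l b) (Seq (Loop k (Inc k.+1)) (Seq (Inc k) (Loop k.+1 (Dec k))))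
  | And b1 b2 => Seq (cbexp l b1) (Seq (Loop k (cbexp l.+1 b2)) (Loop k.+3 (Inc k)))
  | Ex e b =>
      Seq (cterm l k.+1 e)
       (Seq (Loop k.+1 (Seq (cbexp l.+1 b) (Seq (Loop k.+3 (Inc k.+2)) (Inc k))))
        (Seq (Loop k Skip)
             (Loop k.+2 (Seq (Loop k Skip) (Inc k)))))
  end.

Fixpoint ccmd (l : nat) (c : cmd) : prog :=
  let k := 3 * l in
  match c with
  | CSeq c1 c2 => Seq (ccmd l c1) (ccmd l c2)
  | CFor e c => Seq (cterm l k.+1 e) (Seq (Loop k.+1 (Seq (ccmd l.+1 c) (Inc k))) (Loop k Skip))
  | CIf b c => Seq (cbexp l b) (Loop k (ccmd l c))
  | CSet a e x =>
      Seq (cterm l k e) (Seq (Loop k (Seq (MvR a) (Inc k.+1)))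
        (Seq (Wr a x) (Loop k.+1 (MvL a))))
  end.

Lemma teval_bound e : exists c, forall rho b, (forall i, rho i <= b) -> teval rho e <= (b + 2) ^ c.
Proof.
elim: e => [i|c|e1 [c1 h1] e2 [c2 h2]|e1 [c1 h1] e2 [c2 h2]] /=.
- by exists 1 => rho b h; rewrite expn1 (leq_trans (h i)) // leq_addr.
- by have [d hd] := polyb_const c; exists d => rho b _; apply: hd.
- have [d hd] : polyb (fun b => (b + 2) ^ c1 + (b + 2) ^ c2) by polyb_tac.
  by exists d => rho b h; apply: leq_trans (hd b); rewrite leq_add ?h1 ?h2.
- by exists (c1 + c2) => rho b h; rewrite expnD leq_mul ?h1 ?h2.
Qed.

(** The registers between [3 l] and [k] may hold intermediate results. Running times are measured in
    the bound [b] on the variables. *)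
Definition fits (l k b : nat) (rho : nat -> nat) (s : store) : Prop :=
  [/\ forall i, i < l -> reg s (3 * i) = rho i, forall i, l <= i -> rho i = 0,
      forall i, rho i <= b & forall i, k <= i -> reg s i = 0].

Lemma fits_setr l k k' b rho s v : 3 * l <= k -> k < k' ->
  fits l k b rho s -> fits l k' b rho (setr s k v).
Proof.
move=> lk kk' [h1 h2 h3 h4]; split=> //.
  by move=> i il; rewrite /= /upd ifN ?h1 //; lia.
by move=> i ki; rewrite /= /upd ifN ?h4 //; lia.
Qed.

Lemma runs_incs O c k s : runs O (incs c k) s (setr s k (reg s k + c)) (3 * c + 1).
Proof.
elim: c s => [|c IH] s /=.
  by apply: runs_to (runs_skip _ _); store_tac.
have h := runs_seq (runs_inc O k s) (IH _); apply: runs_le (runs_to _ h) _; last lia.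
by store_tac.
Qed.

Lemma cterm_runs e l k : 3 * l <= k -> exists c, forall O s rho b, fits l k b rho s ->
  runs O (cterm l k e) s (setr s k (teval rho e)) ((b + 2) ^ c).
Proof.
elim: e k => [i|n|e1 IH1 e2 IH2|e1 IH1 e2 IH2] k lk.
- have [c hc] : polyb (fun b => (5 * b + 1) + (3 * b + 1)) by polyb_tac.
  exists c => O s rho b [h1 h2 h3 h4] /=; case: ltnP => il.
    have r1 : 3 * i != k by lia.
    have r2 : 3 * i != k.+1 by lia.
    have r3 : k != k.+1 by lia.
    have r4 : k.+1 != 3 * i by lia.
    have := runs_seq (runs_copy O s r1 r2 r3) (runs_move O _ r4).
    move/runs_to => h; apply: runs_le (h _ _) _; last first.
      apply: leq_trans (hc b); have := h3 i; rewrite -h1 // => hb.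
      by move: r1 r2 r3 r4; rewrite /= /upd eqxx; do !case: eqP => //; rewrite (h4 k.+1) //; lia.
    apply: store_eq => // x; have := h4 k (leqnn _); have := h4 k.+1 (leqnSn _).
    have := h1 i il => e1 e2 e3.
    by move/eqP: r1; move/eqP: r2; move/eqP: r4; upd_cases.
  apply: runs_le (runs_to _ (runs_skip O s)) _; last by rewrite expn_gt0 addn2.
  by apply: store_eq => // x; rewrite /= h2 //; have := h4 k (leqnn _); upd_cases.
- have [c hc] : polyb (fun b => 3 * n + 1) by polyb_tac.
  exists c => O s rho b [h1 h2 h3 h4]; apply: runs_le (runs_to _ (runs_incs O n k s)) (hc b).
  by rewrite h4.
- have [c1 h1] := IH1 k lk; have [c2 h2] := IH2 k.+1 (leqW lk).
  have [d hd] := teval_bound e2.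
  have [c hc] : polyb (fun b => (b + 2) ^ c1 + ((b + 2) ^ c2 + (3 * (b + 2) ^ d + 1))) by polyb_tac.
  exists c => O s rho b hf /=; have rk : k.+1 != k by lia.
  have hf1 := fits_setr (teval rho e1) lk (ltnSn k) hf.
  have := runs_seq (h1 O _ _ _ hf) (runs_seq (h2 O _ _ _ hf1) (runs_move O _ rk)).
  have [hf1' hf2 hf3 hf4] := hf.
  move/runs_to => h; apply: runs_le (h _ _) _; last first.
    by apply: leq_trans (hc b); rewrite !leq_add2l /= /upd eqxx leq_add2r leq_mul2l /= hd.
  by apply: store_eq => // x; have := hf4 k.+1 (leqnSn _); upd_cases.
have [c1 h1] := IH1 k.+1 (leqW lk); have [c2 h2] := IH2 k.+2 (leqW (leqW lk)).
have [d1 hd1] := teval_bound e1; have [d2 hd2] := teval_bound e2.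
have [c hc] : polyb (fun b => (b + 2) ^ c1 + ((b + 2) ^ c2 +
   (((b + 2) ^ d1 * ((5 * (b + 2) ^ d2 + 1) + (3 * (b + 2) ^ d2 + 1) + 1) + 1)
     + (2 * (b + 2) ^ d2 + 1)))) by polyb_tac.
exists c => O s rho b hf /=; have [hf1' hf2 hf3 hf4] := hf.
set v1 := teval rho e1; set v2 := teval rho e2.
have le1 : v1 <= (b + 2) ^ d1 by apply: hd1.
have le2 : v2 <= (b + 2) ^ d2 by apply: hd2.
have fk1 : fits l k.+1 b rho s by split=> // i ki; apply: hf4; lia.
have fk2 := fits_setr v1 (leqW lk) (ltnSn k.+1) fk1.
set s2 := setr (setr s k.+1 v1) k.+2 v2.
(* Repeated addition; in each round register [k.+3] saves the factor in [k.+2], which the addition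
   to [k] uses up. *)
pose F i := setr (setr s2 k (i * v2)) k.+1 (v1 - i).
have hF : runs O (Loop k.+1 (Seq (Loop k.+2 (Seq (Inc k) (Inc k.+3))) (Loop k.+3 (Inc k.+2))))
    (F 0) (F v1) (v1 * ((5 * v2 + 1) + (3 * v2 + 1)).+1 + 1).
  apply: runs_loop => [i _|i iv]; first by rewrite /= /upd eqxx.
  have a1 : k.+2 != k by lia.
  have a2 : k.+2 != k.+3 by lia.
  have a3 : k != k.+3 by lia.
  have a4 : k.+3 != k.+2 by lia.
  have := runs_seq (runs_copy O (setr (F i) k.+1 (v1 - i.+1)) a1 a2 a3) (runs_move O _ a4).
  have z3 := hf4 k.+3 (leqW (leqW (leqnSn k))).
  move/runs_to => h; apply: runs_le (h _ _) _; last by move: z3; upd_cases.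
  by apply: store_eq => // x; move: z3; upd_cases.
have s2F : s2 = F 0 by apply: store_eq => // x; have := hf4 k (leqnn _); upd_cases.
have R2 := h2 O _ _ _ fk2; rewrite -/v2 -/s2 s2F in R2.
have := runs_seq (h1 O _ _ _ fk1) (runs_seq R2 (runs_seq hF (runs_clear O k.+2 _))).
have := hf4 k.+1 (leqnSn _); have := hf4 k.+2 (leqW (leqnSn _)) => z2 z1.
move/runs_to => h; apply: runs_le (h _ _) _.
  by store_tac.
apply: leq_trans (hc b); rewrite !leq_add2l leq_add //; last by upd_cases.
by rewrite leq_add2r leq_mul // -[_.+1]addn1 leq_add // leq_add // leq_add // leq_mul.
Qed.

Definition home (s : store) : Prop := forall a, hpos s a = 0.

Lemma runs_once O r p s s' (b : bool) T : reg s r = b -> reg s' r = 0 ->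
  (b -> runs O p (setr s r 0) s' T) -> (~~ b -> s' = s) -> runs O (Loop r p) s s' (T + 2).
Proof.
move=> hr hr' h1 h0; case: b hr h1 h0 => hr h1 h0.
  have [t ht le] := h1 isT; exists (t + 1).+1; last lia.
  by apply: XLoopS hr ht _; apply: XLoop0.
by rewrite h0 //; exists 1; [apply: XLoop0 | lia].
Qed.

Lemma iotaSr i : iota 0 i.+1 = rcons (iota 0 i) i.
Proof. by rewrite -addn1 iotaD cats1. Qed.

(* Both [Bit] and [CSet] compile to an excursion of this shape. *)
Lemma runs_visit l a e p : exists c, forall O s rho b s', fits l (3 * l) b rho s -> home s ->
  hpos s' a = teval rho e -> reg s' (3 * l).+1 = teval rho e ->
  runs O p (setp (setr s (3 * l).+1 (teval rho e)) a (teval rho e)) s' 3 ->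
  runs O (Seq (cterm l (3 * l) e) (Seq (Loop (3 * l) (Seq (MvR a) (Inc (3 * l).+1)))
        (Seq p (Loop (3 * l).+1 (MvL a))))) s (setp (setr s' (3 * l).+1 0) a 0) ((b + 2) ^ c).
Proof.
set k := 3 * l; have [c1 h1] := cterm_runs e (leqnn (3 * l)); have [d hd] := teval_bound e.
have [c hc] : polyb (fun b => (b + 2) ^ c1 + ((4 * (b + 2) ^ d + 1) + (3 + (2 * (b + 2) ^ d + 1))))
  by polyb_tac.
exists c => O s rho b s' hf ho hp' hr' hrun; set v := teval rho e in hp' hr' hrun.
have [hf1 hf2 hf3 hf4] := hf; have k1 : k != k.+1 by lia.
have vd : v <= (b + 2) ^ d by apply: hd.
have h2 := runs_right O a (setr s k v) k1.
have zk := hf4 k.+1 (leqnSn _).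
have e2 : setp (setr (setr (setr s k v) k.+1 (reg (setr s k v) k.+1 + reg (setr s k v) k)) k 0) a
   (hpos (setr s k v) a + reg (setr s k v) k) = setp (setr s k.+1 v) a v.
  apply: store_eq => // x; last by move: (ho a); upd_cases.
  by have := hf4 k (leqnn _); upd_cases.
rewrite e2 in h2.
have h4 := @runs_left O k.+1 a s'; rewrite hp' hr' subnn in h4.
apply: runs_le (runs_seq (h1 O _ _ _ hf) (runs_seq h2 (runs_seq hrun (h4 (leqnn _))))) _.
apply: leq_trans (hc b); rewrite leq_add2l leq_add //; last by rewrite leq_add2l leq_add2r leq_mul2l vd.
by rewrite leq_add2r leq_mul2l /= /upd eqxx vd.
Qed.

(** The exponent depends on the formula and the level alone. Under a quantifier the bound on the
    variables grows to [b + (b + 2) ^ d], which remains polynomial because the nesting is fixed. *)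
Lemma cbexp_runs e l : exists c, forall O s rho b, fits l (3 * l) b rho s -> home s ->
  runs O (cbexp l e) s (setr s (3 * l) (beval (con s) l rho e)) ((b + 2) ^ c).
Proof.
elim: e l => [e1 e2|a e x|e IH|e1 IH1 e2 IH2|e eb IH] l /=; set k := 3 * l.
- have [c1 h1] := cterm_runs e1 (leqW (leqnn (3 * l))).
  have [c2 h2] := cterm_runs e2 (leqW (leqW (leqnn (3 * l)))).
  have [d1 hd1] := teval_bound e1; have [d2 hd2] := teval_bound e2.
  have [c hc] : polyb (fun b => (b + 2) ^ c1 + ((b + 2) ^ c2 + ((2 * (b + 2) ^ d2 + 1) +
     (2 + (2 * (b + 2) ^ d1 + 1))))) by polyb_tac.
  exists c => O s rho b hf ho; have [hf1 hf2 hf3 hf4] := hf.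
  have le1 := hd1 _ _ hf3; have le2 := hd2 _ _ hf3.
  set v1 := teval rho e1 in le1 *; set v2 := teval rho e2 in le2 *.
  have fk1 : fits l k.+1 b rho s by split=> // i ki; apply: hf4; lia.
  have fk2 := fits_setr v1 (leqW (leqnn (3 * l))) (ltnSn k.+1) fk1.
  have a1 : k.+2 != k.+1 by lia.
  have a2 : k.+1 != k by lia.
  have z0 := hf4 k (leqnn _); have z1 := hf4 k.+1 (leqnSn _).
  have z2 := hf4 k.+2 (leqW (leqnSn _)).
  have := runs_seq (h1 O _ _ _ fk1) (runs_seq (h2 O _ _ _ fk2) (runs_seq (runs_sub O _ a1)
     (runs_seq (runs_inc O k _) (runs_sub O _ a2)))).
  move/runs_to => h; apply: runs_le (h _ _) _; rewrite -/k -/v1 -/v2.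
    apply: store_eq => // y; case: (leqP v1 v2); upd_cases.
  apply: leq_trans (hc b); rewrite !leq_add2l leq_add //.
    by upd_cases.
  by rewrite leq_add2l; upd_cases.
- have [c h] := runs_visit l a e (IfA a x (Inc k) Skip).
  exists c => O s rho b hf ho; have [hf1 hf2 hf3 hf4] := hf.
  set v := teval rho e; set r := con s a v == x.
  have z0 := hf4 k (leqnn _); have z1 := hf4 k.+1 (leqnSn _).
  have p1 : hpos (setp (setr (setr s k.+1 v) k r) a v) a = v by upd_cases.
  have p2 : reg (setp (setr (setr s k.+1 v) k r) a v) k.+1 = v by upd_cases.
  apply: runs_to (h O _ _ _ _ hf ho p1 p2 _).
    by apply: store_eq => // y; [|move: (ho a)]; upd_cases.
  have test t : texec O (if r then Inc k else Skip) (setp (setr s k.+1 v) a v)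
       (setp (setr (setr s k.+1 v) k r) a v) t ->
     texec O (IfA a x (Inc k) Skip) (setp (setr s k.+1 v) a v)
       (setp (setr (setr s k.+1 v) k r) a v) t.+1.
    by move=> ht; apply: XIfA; rewrite /= /upd eqxx -/r.
  case: (r) test => test.
    have [t ht le] := runs_inc O k (setp (setr s k.+1 v) a v).
    exists t.+1 => //; apply: test; move: ht; congr texec.
    by store_tac.
  have [t ht le] := runs_skip O (setp (setr s k.+1 v) a v).
  exists t.+1; last by lia.
  apply: test; move: ht; congr texec.
  by store_tac.
- have [c1 h1] := IH l.
  have [c hc] : polyb (fun b => (b + 2) ^ c1 + (4 + (2 + 3))) by polyb_tac.
  exists c => O s rho b hf ho; have [hf1 hf2 hf3 hf4] := hf.
  have a1 : k != k.+1 by lia.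
  have a2 : k.+1 != k by lia.
  have z0 := hf4 k (leqnn _); have z1 := hf4 k.+1 (leqnSn _).
  have := runs_seq (h1 O _ _ _ hf ho) (runs_seq (runs_move O _ a1)
     (runs_seq (runs_inc O k _) (runs_sub O _ a2))).
  rewrite -/k; move/runs_to => h; apply: runs_le (h _ _) _.
    by apply: store_eq => // y; case: (beval _ _ _ _); upd_cases.
  apply: leq_trans (hc b); rewrite !leq_add2l leq_add //.
    by case: (beval _ _ _ _); upd_cases.
  by rewrite leq_add2l; case: (beval _ _ _ _); upd_cases.
- have [c1 h1] := IH1 l; have [c2 h2] := IH2 l.+1.
  have [c hc] : polyb (fun b => (b + 2) ^ c1 + ((b + 2) ^ c2 + 2 + 4)) by polyb_tac.
  exists c => O s rho b hf ho; have [hf1 hf2 hf3 hf4] := hf.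
  have k3 : 3 * l.+1 = k.+3 by lia.
  set b1 := beval _ _ _ _; set b2 := beval _ _ _ _.
  have z0 := hf4 k (leqnn _); have z3 := hf4 k.+3 (leqW (leqW (leqnSn _))).
  have sk : setr s k 0 = s by store_tac.
  have f2 : fits l.+1 (3 * l.+1) b rho s.
    split=> // i; last by rewrite k3 => ki; apply: hf4; lia.
      rewrite ltnS leq_eqVlt => /predU1P[->|]; last exact: hf1.
      by rewrite hf2 // hf4.
    by move=> li; apply: hf2; lia.
  pose s2 := setr s k.+3 (b1 && b2).
  have R2 : runs O (Loop k (cbexp l.+1 e2)) (setr s k b1) s2 ((b + 2) ^ c2 + 2).
    apply: (@runs_once O _ _ _ _ b1); [by upd_cases | by rewrite /s2; upd_cases | |].
      move=> hb1; have := h2 O _ _ _ f2 ho; rewrite -/b2 k3 /s2 hb1 /=.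
      by rewrite (_ : setr (setr s k 1) k 0 = s) //; store_tac.
    by move=> /negPf hb1; rewrite /s2 hb1 sk; store_tac.
  have a3 : k.+3 != k by lia.
  have := runs_seq (h1 O _ _ _ hf ho) (runs_seq R2 (runs_move O _ a3)).
  rewrite -/k -/b1; move/runs_to => h; apply: runs_le (h _ _) _.
    by rewrite /s2; case: (b1 && b2); store_tac.
  apply: leq_trans (hc b); rewrite !leq_add2l /s2.
  by case: (b1 && b2); upd_cases.
have [c1 h1] := cterm_runs e (leqW (leqnn (3 * l))); have [c2 h2] := IH l.+1.
have [d hd] := teval_bound e.
have [c hc] : polyb (fun b => (b + 2) ^ c1 + (((b + 2) ^ d * (((b + (b + 2) ^ d) + 2) ^ c2 + (4 + 2) + 1) + 1)
  + ((2 * (b + 2) ^ d + 1) + ((b + 2) ^ d * (3 + 2 + 1) + 1)))) by polyb_tac.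
exists c => O s rho b hf ho; have [hf1 hf2 hf3 hf4] := hf.
have k3 : 3 * l.+1 = k.+3 by lia.
have le := hd _ _ hf3; set v := teval rho e in le *.
pose P w := beval (con s) l.+1 (upd rho l w) eb.
pose n i := count P (iota 0 i).
have nS i : n i.+1 = n i + P i by rewrite /n iotaSr -cats1 count_cat /= addn0.
have nle i : n i <= i by rewrite -{2}(size_iota 0 i) count_size.
have z0 := hf4 k (leqnn _); have z1 := hf4 k.+1 (leqnSn _).
have z2 := hf4 k.+2 (leqW (leqnSn _)); have z3 := hf4 k.+3 (leqW (leqW (leqnSn _))).
have fk1 : fits l k.+1 b rho s by split=> // i ki; apply: hf4; lia.
pose F i := setr (setr (setr s k.+1 (v - i)) k i) k.+2 (n i).
have a3 : k.+3 != k.+2 by lia.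
have R1 : runs O (Loop k.+1 (Seq (cbexp l.+1 eb) (Seq (Loop k.+3 (Inc k.+2)) (Inc k))))
    (F 0) (F v) (v * ((((b + (b + 2) ^ d) + 2) ^ c2 + (4 + 2)).+1) + 1).
  apply: runs_loop => [i _|i iv]; first by upd_cases.
  have fi : fits l.+1 (3 * l.+1) (b + (b + 2) ^ d) (upd rho l i) (setr (F i) k.+1 (v - i.+1)).
    split=> j.
    - rewrite ltnS leq_eqVlt => /predU1P[->|jl]; first by rewrite -/k; upd_cases.
      by move: (hf1 j jl); rewrite /k; upd_cases.
    - by move=> lj; move: (hf2 j (ltnW lj)); upd_cases.
    - by move: (hf3 j); upd_cases.
    - by rewrite k3 => kj; move: (hf4 j); upd_cases.
  have := runs_seq (h2 O _ _ _ fi ho) (runs_seq (runs_move O _ a3) (runs_inc O k _)).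
  rewrite k3 -/(P i); move/runs_to => h; apply: runs_le (h _ _) _.
    by apply: store_eq => // y; rewrite /F nS; case: (P i); upd_cases.
  by rewrite !leq_add2l leq_add2r; case: (P i); upd_cases.
(* While the number of successes is counted down, register [k] is set to 1 anew, and so ends up as
   the truth value. *)
pose F' i := setr (setr s k (0 < i)) k.+2 (n v - i).
have R2 : runs O (Loop k.+2 (Seq (Loop k Skip) (Inc k))) (F' 0) (F' (n v)) (n v * (3 + 2).+1 + 1).
  apply: runs_loop => [i _|i iv]; first by upd_cases.
  have := runs_seq (runs_clear O k (setr (F' i) k.+2 (n v - i.+1))) (runs_inc O k _).
  move/runs_to => h; apply: runs_le (h _ _) _.
    by store_tac.
  by rewrite leq_add2r; case: i {iv h} => [|i]; upd_cases.
have sF : setr s k.+1 v = F 0 by apply: store_eq => // y; rewrite /F /n; upd_cases.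
have sF' : setr (F v) k 0 = F' 0 by apply: store_eq => // y; rewrite /F /F'; upd_cases.
have C1 := h1 O _ _ _ fk1; rewrite -/v -/k sF in C1.
have C2 := runs_clear O k (F v); rewrite sF' in C2.
have := runs_seq C1 (runs_seq R1 (runs_seq C2 R2)).
move/runs_to => h; apply: runs_le (h _ _) _.
  by apply: store_eq => // y; rewrite /F' has_count -/(n v); upd_cases.
apply: leq_trans (hc b); rewrite leq_add2l leq_add //.
  by rewrite leq_add2r -[_.+1]addn1 leq_mul2r le orbT.
rewrite leq_add //; first by upd_cases.
by rewrite leq_add2r leq_mul // (leq_trans (nle v)).
Qed.

Lemma ccmd_runs p l : exists c, forall O s rho b, fits l (3 * l) b rho s -> home s ->
  runs O (ccmd l p) s (Store (reg s) (ceval l rho p (con s)) (hpos s)) ((b + 2) ^ c).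
Proof.
elim: p l => [p1 IH1 p2 IH2|e p IH|e p IH|a e x] l /=; set k := 3 * l.
- have [c1 h1] := IH1 l; have [c2 h2] := IH2 l.
  have [c hc] : polyb (fun b => (b + 2) ^ c1 + (b + 2) ^ c2) by polyb_tac.
  exists c => O s rho b hf ho; apply: runs_le (hc b).
  exact: runs_seq (h1 O _ _ _ hf ho) (h2 O (Store _ _ _) _ _ hf ho).
- have [c1 h1] := cterm_runs e (leqW (leqnn (3 * l))); have [c2 h2] := IH l.+1.
  have [d hd] := teval_bound e.
  have [c hc] : polyb (fun b => (b + 2) ^ c1 + (((b + 2) ^ d * (((b + (b + 2) ^ d) + 2) ^ c2 + 2 + 1) + 1)
     + (2 * (b + 2) ^ d + 1))) by polyb_tac.
  exists c => O s rho b hf ho; have [hf1 hf2 hf3 hf4] := hf.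
  have k3 : 3 * l.+1 = k.+3 by lia.
  have le := hd _ _ hf3; set v := teval rho e in le *.
  have z0 := hf4 k (leqnn _); have z1 := hf4 k.+1 (leqnSn _).
  have fk1 : fits l k.+1 b rho s by split=> // i ki; apply: hf4; lia.
  pose step al w := ceval l.+1 (upd rho l w) p al.
  pose A i := foldl step (con s) (iota 0 i).
  have AS i : A i.+1 = step (A i) i by rewrite /A iotaSr foldl_rcons.
  pose F i := setr (setr (Store (reg s) (A i) (hpos s)) k.+1 (v - i)) k i.
  have R1 : runs O (Loop k.+1 (Seq (ccmd l.+1 p) (Inc k))) (F 0) (F v)
      (v * (((b + (b + 2) ^ d) + 2) ^ c2 + 2).+1 + 1).
    apply: runs_loop => [i _|i iv]; first by upd_cases.
    have fi : fits l.+1 (3 * l.+1) (b + (b + 2) ^ d) (upd rho l i) (setr (F i) k.+1 (v - i.+1)).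
      split=> j.
      - rewrite ltnS leq_eqVlt => /predU1P[->|jl]; first by rewrite -/k; upd_cases.
        by move: (hf1 j jl); rewrite /k; upd_cases.
      - by move=> lj; move: (hf2 j (ltnW lj)); upd_cases.
      - by move: (hf3 j); upd_cases.
      - by rewrite k3 => kj; move: (hf4 j); upd_cases.
    have := runs_seq (h2 O _ _ _ fi ho) (runs_inc O k _).
    apply: runs_to; apply: store_eq => // y; first by upd_cases.
    by rewrite /F AS.
  have sF : setr s k.+1 v = F 0 by apply: store_eq => // y; rewrite /F; upd_cases.
  have C1 := h1 O _ _ _ fk1; rewrite -/v -/k sF in C1.
  have := runs_seq C1 (runs_seq R1 (runs_clear O k _)).
  move/runs_to => h; apply: runs_le (h _ _) _.
    by store_tac.
  apply: leq_trans (hc b); rewrite leq_add2l leq_add //; last by upd_cases.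
  by rewrite leq_add2r -[_.+1]addn1 leq_mul2r le orbT.
- have [c1 h1] := cbexp_runs e l; have [c2 h2] := IH l.
  have [c hc] : polyb (fun b => (b + 2) ^ c1 + ((b + 2) ^ c2 + 2)) by polyb_tac.
  exists c => O s rho b hf ho; have [hf1 hf2 hf3 hf4] := hf.
  have z0 := hf4 k (leqnn _); set r := beval _ _ _ _.
  apply: runs_le (hc b); apply: runs_seq (h1 O _ _ _ hf ho) _; rewrite -/k -/r.
  have sk (w : nat) : setr (setr s k w) k 0 = s by store_tac.
  apply: (@runs_once O _ _ _ _ r); [by upd_cases | exact: z0 | |].
    by move=> hr; rewrite sk hr; apply: h2.
  by move/negPf => hr; rewrite hr; rewrite -{1}(sk 0); store_tac.
have [c h] := runs_visit l a e (Wr a x).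
exists c => O s rho b hf ho; have [hf1 hf2 hf3 hf4] := hf; set v := teval rho e.
have z0 := hf4 k (leqnn _); have z1 := hf4 k.+1 (leqnSn _).
pose s' := seta (setp (setr s k.+1 v) a v) a (upd (con s a) v x).
have p1 : hpos s' a = v by rewrite /s'; upd_cases.
have p2 : reg s' k.+1 = v by rewrite /s'; upd_cases.
apply: runs_to (h O _ _ _ _ hf ho p1 p2 _).
  by apply: store_eq => // y; [|move: (ho a)]; rewrite /s'; upd_cases.
exists 1 => //; rewrite -/k -/v; have := XWr O a x (setp (setr s k.+1 v) a v).
by rewrite /= {2}/upd eqxx.
Qed.

Lemma regs_lt_mono R R' p : R <= R' -> regs_lt R p -> regs_lt R' p.
Proof.
move=> le; elim: p => //=.
- by move=> r h; apply: leq_trans le.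
- by move=> r h; apply: leq_trans le.
- by move=> p IHp q IHq /andP[/IHp-> /IHq->].
- by move=> _ _ p IHp q IHq /andP[/IHp-> /IHq->].
- by move=> r p IHp /andP[h /IHp->]; rewrite (leq_trans h).
Qed.

Lemma regs_bounded p : exists R, regs_lt R p.
Proof.
elim: p => //=; try (by move=> *; exists 0).
- by move=> r; exists r.+1.
- by move=> r; exists r.+1.
- move=> p [R hp] q [R' hq]; exists (maxn R R').
  by rewrite (regs_lt_mono _ hp) ?leq_maxl // (regs_lt_mono _ hq) ?leq_maxr.
- move=> _ _ p [R hp] q [R' hq]; exists (maxn R R').
  by rewrite (regs_lt_mono _ hp) ?leq_maxl // (regs_lt_mono _ hq) ?leq_maxr.
- move=> r p [R hp]; exists (maxn R r.+1).
  by rewrite (regs_lt_mono _ hp) ?leq_maxl // andbT leq_maxr.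
Qed.

Definition tapeX : 'I_6 := @Ordinal 6 0 isT.
Definition tapeR : 'I_6 := @Ordinal 6 5 isT.

Definition input_arrays (x : seq bool) : arrays := fun a => if a == tapeX then word x else fun=> None.
Definition input_env (n : nat) : nat -> nat := fun i => if i == 0 then n else 0.

(** Variable 0 becomes the length of the input; the copy in register 1 is spent on bringing the head
    back. *)
Definition scan : prog :=
  Seq (Until tapeX (Seq (MvR tapeX) (Seq (Inc 0) (Inc 1)))) (Loop 1 (MvL tapeX)).

Lemma scan_runs O x : runs O scan (Store (fun=> 0) (input_arrays x) (fun=> 0))
  (Store (input_env (size x)) (input_arrays x) (fun=> 0)) (9 * size x + 2).
Proof.
pose F i := Store (fun r => if r < 2 then i else 0) (input_arrays x) (fun a => if a == tapeX then i else 0).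
have R1 : forall d i, size x = i + d ->
    runs O (Until tapeX (Seq (MvR tapeX) (Seq (Inc 0) (Inc 1)))) (F i) (F (size x)) (6 * d + 1).
  elim=> [|d IH] i hi.
    rewrite hi addn0; exists 1 => //; apply: XUntil0.
    by rewrite /= /input_arrays eqxx /word nth_default // size_map hi addn0.
  have h1 : runs O (Seq (MvR tapeX) (Seq (Inc 0) (Inc 1))) (F i) (F i.+1) (1 + (2 + 2)).
    have h1 s1 : runs O (MvR tapeX) s1 (setp s1 tapeX (hpos s1 tapeX).+1) 1 by exists 1 => //; constructor.
    apply: runs_to (runs_seq (h1 _) (runs_seq (runs_inc _ _ _) (runs_inc _ _ _))).
    apply: store_eq => // y; rewrite /= /upd /=; last by case: eqP.
    by case: y => [|[|y]].
  have [t ht le] := h1; have [|t' ht' le'] := IH i.+1; first by rewrite hi; lia.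
  exists (t + t').+1; last lia.
  apply: XUntilS ht ht'; rewrite /= /input_arrays eqxx /word (nth_map false) //; lia.
have e0 : F 0 = Store (fun=> 0) (input_arrays x) (fun=> 0).
  by apply: store_eq => // y /=; case: ifP.
rewrite -e0; have le1 : reg (F (size x)) 1 <= hpos (F (size x)) tapeX by [].
have := runs_seq (R1 (size x) 0 (erefl _)) (runs_left O le1).
move/runs_to => h; apply: runs_le (h _ _) _; last by rewrite /=; lia.
apply: store_eq => // y; rewrite /= /upd /=; last by case: eqP; rewrite ?subnn.
by case: y => [|[|y]].
Qed.

Lemma halts_stable O M x y b t t' :
  halts_within O M x y b t -> t <= t' -> halts_within O M x y b t'.
Proof.
rewrite /halts_within => h /subnK <-; elim: (t' - t) => // d IH.
by rewrite addSn iterS; move: IH; move: (iter _ _ _) => cf hv; rewrite /step hv.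
Qed.

Lemma cmd_machine (P1 P2 : cmd) : exists (M : machine) (p : {poly nat}), forall O x w,
  let al1 := ceval 1 (input_env (size x)) P1 (input_arrays x) in
  al1 tapeQ =1 word w ->
  halts_within O M x [::]
    (ceval 1 (input_env (size x)) P2 (upd al1 tapeQ (word (O w))) tapeR 0 == bit true)
    (p.[size x])%R.
Proof.
pose main := Seq scan (Seq (ccmd 1 P1) (Seq Ask (ccmd 1 P2))).
pose L := csize main.
pose code := rcons (comp main 0 L)
  (IAct tapeR (fun x => (x, Stay, if x == bit true then L.+1 else L.+2))).
have [R hR] := regs_bounded main.
have [c1 h1] := ccmd_runs P1 1; have [c2 h2] := ccmd_runs P2 1.
have [c hc] : polyb (fun b => 9 * b + 2 + ((b + 2) ^ c1 + (1 + (b + 2) ^ c2)) + 1) by polyb_tac.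
exists (code_machine code R), (('X + 2%:P) ^+ c)%R => O x w al1 hw.
pose s0 := Store (fun=> 0) (input_arrays x) (fun=> 0).
pose s1 := Store (input_env (size x)) (input_arrays x) (fun=> 0).
pose s2 := Store (input_env (size x)) al1 (fun=> 0).
pose s3 := seta s2 tapeQ (word (O w)).
pose s4 := Store (input_env (size x)) (ceval 1 (input_env (size x)) P2 (upd al1 tapeQ (word (O w)))) (fun=> 0).
have f1 al : fits 1 (3 * 1) (size x) (input_env (size x)) (Store (input_env (size x)) al (fun=> 0)).
  by split=> //= -[|i].
have RA : runs O Ask s2 s3 1 by exists 1 => //; apply: XAsk.
have hm : runs O main s0 s4 (9 * size x + 2 + ((size x + 2) ^ c1 + (1 + (size x + 2) ^ c2))).
  apply: runs_seq (scan_runs O x) _; apply: runs_seq (h1 O s1 _ _ (f1 _) _) _ => //.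
  by apply: runs_seq RA _; apply: (h2 O s3 _ _ (f1 _)).
have [t ht le] := hm.
have sc : size code = L.+1 by rewrite size_rcons size_comp.
have loc : located code 0 (comp main 0 L).
  split; first by rewrite add0n size_comp sc.
  by move=> i hi; rewrite add0n nth_rcons hi.
have r0 : @rep R s0 (init (code_machine code R) x [::]).2.
  split=> [r hr k|a] /=.
    by rewrite inordK /=; [rewrite !nth_nil | lia].
  have a6 := ltn_ord a; rewrite inordK; last lia.
  split=> // k; rewrite add0n /input_arrays -val_eqE /=.
  by case: (nat_of_ord a) => [|[|i]] //=; rewrite ?nth_nil.
have Lt : L < (size code).+2 by rewrite sc leqW.
have [tp r4 e4] := @simulate O code R _ _ _ _ ht 0 L loc Lt hR _ r0.
have hL : nth halt code L = IAct tapeR (fun x => (x, Stay, if x == bit true then L.+1 else L.+2)).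
  by rewrite nth_rcons size_comp ltnn eqxx.
have Lc : L < size code by rewrite sc.
have [tp' st _] := @step_act O code R L _ _ tp Lc hL.
set b := (_ == bit true).
have fin : halts_within O (code_machine code R) x [::] b t.+1.
  rewrite /halts_within iterS.
  have -> : init (code_machine code R) x [::] = (inord 0, (init (code_machine code R) x [::]).2).
    by congr (_, _); apply: val_inj; rewrite /= inordK.
  rewrite e4 st (rep_read_arr tapeR r4).
  transitivity (verdict (inord (if b then L.+1 else L.+2) : state (code_machine code R))) => //.
  rewrite (_ : verdict _ = if (if b then L.+1 else L.+2) == size code then Some true
     else if (if b then L.+1 else L.+2) == (size code).+1 then Some false else None).
    by rewrite sc; case: (b); rewrite ?eqxx // gtn_eqF.
  rewrite {1}/verdict {1}/code_machine; have -> // :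
    (inord (if b then L.+1 else L.+2) : 'I_(size code).+2) = (if b then L.+1 else L.+2) :> nat.
  by rewrite inordK // sc; case: (b).
have -> : ((('X + 2%:P) ^+ c : {poly nat}).[size x] = ((size x + 2) ^ c)%N)%R.
  elim: (c) => [|c' IH]; first by rewrite expr0 hornerC.
  by rewrite exprS expnS -IH hornerM hornerD hornerX hornerC.
apply: halts_stable fin _.
by apply: leq_trans (hc (size x)); rewrite addn1 ltnS.
Qed.

(** * Tableaux *)

Section Tableau.
Variable M : machine.
Hypothesis noask : oracle_free M.
Let k := (extra_tapes M).+2.
Let S := symbol (aux M).

Definition column : finType := {ffun 'I_k -> S * S}.

(* The cell in row [t] and column [d] of the tableau describes the machine at
   time [t]: it holds the state, the tape cells at distance 0, [d - 1], [d] and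
   [d + 1] from the heads (leftwards and rightwards for each tape), the number
   [minn d 2], and a flag which is set in row 0. *)
Definition label : finType :=
  (bool * 'I_3 * state M * (column * column * column * column))%type.

Definition lrow (l : label) : bool := l.1.1.1.
Definition lpos (l : label) : nat := l.1.1.2.
Definition lst (l : label) : state M := l.1.2.
Definition lhead (l : label) : column := l.2.1.1.1.
Definition lprev (l : label) : column := l.2.1.1.2.
Definition lcur (l : label) : column := l.2.1.2.
Definition lnext (l : label) : column := l.2.2.

Definition tape1 : 'I_k := @Ordinal k 1 isT.

(** In row 0, where the flag is set, the last clause makes the blanks of tape 1 a final segment, so
    that the guessed second input is a word. *)
Definition label_right (l l' : label) : bool :=
  [&& lst l' == lst l, lhead l' == lhead l, lprev l' == lcur l, lcur l' == lnext l,
      lpos l' == minn (lpos l).+1 2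
    & lrow l ==> ((lcur l tape1).2 == None) ==> ((lcur l' tape1).2 == None)].

Definition view (z : column) : {ffun 'I_k -> S} := [ffun i => (z i).2].

Definition next_state (q : state M) (z : column) : state M :=
  if verdict q is Some _ then q else (delta q (view z)).1.

(** Positions are relative to the heads, so a move shifts the whole tape by a cell. The symbols at
    the head matter at distances 0 and 1 only, which is why [p] is the distance capped at 2. *)
Definition next_column (q : state M) (p : nat) (z a b c : column) : column :=
  if verdict q is Some _ then b else
  [ffun i => let w := (delta q (view z)).2 i in
     match w.2 with
     | Stay => ((b i).1, if p == 0 then w.1 else (b i).2)
     | MoveRight => (if p == 0 then w.1 else (a i).1, (c i).2)
     | MoveLeft => ((c i).1, if p == 0 then (z i).1 else if p == 1 then w.1 else (a i).2)
     end].

Definition label_down (l l' : label) : bool :=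
  (lst l' == next_state (lst l) (lhead l)) &&
  (lcur l' == next_column (lst l) (lpos l) (lhead l) (lprev l) (lcur l) (lnext l)).

Lemma next_column0 q z a a' b c : next_column q 0 z a b c = next_column q 0 z a' b c.
Proof. by []. Qed.

Definition is_cell_bit (s : S) : bool := if s is Some (inl _) then true else false.

Definition label_init (xd : option bool) (dQ : bool) (l : label) : bool :=
  [&& lrow l, lst l == start M
    & [forall i : 'I_k, ((lcur l i).1 == None) &&
        match val i with
        | 0 => (lcur l i).2 == omap inl xd
        | 1 => ((lcur l i).2 == None) || dQ && is_cell_bit (lcur l i).2
        | _ => (lcur l i).2 == None
        end]].

Definition label_ok (t0 tN d0 : bool) (xd : option bool) (dQ : bool) (l : label) : bool :=
  [&& t0 ==> label_init xd dQ l, tN ==> (verdict (lst l) == Some true)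
    & d0 ==> (lpos l == 0) && (lcur l == lhead l)].

Definition labelling (N Q : nat) (x : seq bool) (L : nat -> nat -> label) : Prop :=
  [/\ forall t d, t < N -> d.+1 < N -> label_right (L t d) (L t d.+1),
      forall t d, t.+1 < N -> d < N -> label_down (L t d) (L t.+1 d)
    & forall t d, t < N -> d < N ->
        label_ok (t == 0) (t.+1 == N) (d == 0) (onth x d) (d < Q) (L t d)].

Definition col (c : config M) (d : nat) : column :=
  [ffun i => (nth None (c.2 i).1 d, nth None (c.2 i).2 d)].

Let run x y t := iter t (@step no_oracle M) (init M x y).

Lemma view_col (c : config M) : view (col c 0) = [ffun i => tape_read (c.2 i)].
Proof. by apply/ffunP => i; rewrite !ffunE /=; case: (c.2 i) => l []. Qed.

Lemma step_state (c : config M) : (step no_oracle c).1 = next_state c.1 (col c 0).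
Proof. by rewrite /step /next_state noask view_col; case: (verdict _). Qed.

Lemma step_col (c : config M) d :
  col (step no_oracle c) d =
  next_column c.1 (minn d 2) (col c 0) (col c d.-1) (col c d) (col c d.+1).
Proof.
rewrite /step /next_column noask view_col; case: (verdict _) => // /=.
apply/ffunP => i; rewrite !ffunE /=; case: ((delta _ _).2 i) => w [] /=;
  rewrite /tape_update; case: (c.2 i) => l r /=.
- by case: d => [|[|d]] /=; rewrite ?nth_behead -?nth0.
- by case: d => [|[|d]] /=; rewrite ?nth_behead.
- by case: d => [|[|d]] /=; rewrite ?nth_behead.
Qed.

Lemma nth_bits (x : seq bool) d :
  nth None [seq Some (inl b) | b <- x] d = omap inl (onth x d) :> S.
Proof. by elim: x d => [|b x IH] [|d] //=. Qed.

Lemma tableau_complete x y N Q : 0 < N -> size y <= Q ->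
  halts_within no_oracle M x y true N.-1 -> exists L, labelling N Q x L.
Proof.
move=> N0 yQ acc.
pose L t d : label := ((t == 0, inord (minn d 2), (run x y t).1,
  (col (run x y t) 0, col (run x y t) d.-1, col (run x y t) d, col (run x y t) d.+1))).
have Lpos t d : lpos (L t d) = minn d 2 by rewrite /lpos /= inordK // ltnS geq_minr.
have init_col d i : col (init M x y) d i =
  (None, match val i with 0 => omap inl (onth x d) | 1 => omap inl (onth y d) | _ => None end).
  by rewrite ffunE /init /=; case: (val i) => [|[|j]] /=; rewrite ?nth_bits nth_nil.
exists L; split.
- move=> t d _ _; rewrite /label_right !Lpos !eqxx /=.
  apply/andP; split; first by lia.
  apply/implyP => /eqP->; rewrite /lcur /= !init_col /=.
  apply/implyP; elim: y d {yQ acc L Lpos init_col} => [|b y IH] [|d] //=.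
  exact: IH.
- move=> t d _ _; rewrite /label_down Lpos /lst /lcur /=.
  by rewrite -step_state -step_col !eqxx.
move=> t d tN dN; rewrite /label_ok Lpos; apply/and3P; split.
- apply/implyP => /eqP t0; rewrite /label_init /lrow /lst /lcur t0 /= eqxx /=.
  apply/forallP => i; rewrite init_col /= ?eqxx /=.
  case: (val i) => [|[|j]] //=; case: ltnP => dQ.
    by case: (onth y d) => //; rewrite orbT.
  have : onth y d = None by rewrite onth_default // (leq_trans yQ).
  by move->.
- apply/implyP => /eqP e; have -> : t = N.-1 by lia.
  by rewrite -acc.
by apply/implyP => /eqP->; rewrite /lcur /lhead /= eqxx.
Qed.

Lemma leading_bits_nth (s : seq S) :
  (forall d, d < size s -> nth None s d = None \/ is_cell_bit (nth None s d)) ->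
  (forall d, d.+1 < size s -> nth None s d = None -> nth None s d.+1 = None) ->
  forall d, nth None [seq Some (inl b) | b <- leading_bits s] d = nth None s d.
Proof.
elim: s => [|c s IH] hb hc d //=.
have IH' : forall d, nth None [seq Some (inl b) | b <- leading_bits s] d = nth None s d.
  by apply: IH => i hi; [apply: (hb i.+1) | apply: (hc i.+1)].
case: c hb hc => [[b|a]|] hb hc /=; first by case: d => [|d] //=.
  by case: (hb 0).
have none i : nth None s i = None.
  elim: i => [|i IHi]; first by case: s hc {IH IH' hb} => // c s /(_ 0); apply.
  have [hi|hi] := ltnP i.+2 (size (None :: s)); first exact: (hc i.+1).
  by rewrite nth_default.
by rewrite nth_nil; case: d => [|d] //=; rewrite none.
Qed.

Lemma size_leading_bits (s : seq S) i : i < size s -> nth None s i = None -> size (leading_bits s) <= i.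
Proof.
elim: s i => [|c s IH] [|i] //= hi; first by move->.
by case: c => [[b|]|] //= h; apply: IH.
Qed.

Lemma leading_bits_size (s : seq S) : size (leading_bits s) <= size s.
Proof. by elim: s => // -[[b|]|] s IH /=. Qed.

(** The [lnext] of the last column is not checked, so errors may enter at the right border and
    advance by a column per row. Row [t] is therefore shown correct for [d + t < N] only, which
    still covers column 0 of the last row, where acceptance is read. *)
Lemma tableau_sound x N Q L : 0 < N -> labelling N Q x L ->
  exists2 y, size y <= Q & halts_within no_oracle M x y true N.-1.
Proof.
move=> N0 [hr hv hu].
pose s := [seq (lcur (L 0 d) tape1).2 | d <- iota 0 N].
have sN : size s = N by rewrite size_map size_iota.
have sd d : d < N -> nth None s d = (lcur (L 0 d) tape1).2.
  by move=> dN; rewrite (nth_map 0) ?size_iota // nth_iota.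
have init0 d : d < N -> label_init (onth x d) (d < Q) (L 0 d).
  by move=> dN; have /and3P[] := hu 0 d N0 dN.
have bits d : d < N -> ((lcur (L 0 d) tape1).2 == None) || (d < Q) && is_cell_bit (lcur (L 0 d) tape1).2.
  by move=> dN; have /and3P[_ _ /forallP/(_ tape1)/andP[_]] := init0 d dN.
pose y := leading_bits s.
have ys : forall d, nth None [seq Some (inl b) | b <- y] d = nth None s d.
  apply: leading_bits_nth => d; rewrite sN => dN.
    by rewrite sd //; case/orP: (bits d dN) => [/eqP|/andP[_]]; [left|right].
  rewrite !sd //; last by apply: ltnW.
  move=> h; have /and5P[_ _ _ _ /andP[_]] := hr 0 d N0 dN.
  have /and3P[-> _ _] := init0 d (ltnW dN); rewrite h /= => /eqP; exact.
have pos t d : t < N -> d < N -> lpos (L t d) = minn d 2.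
  move=> tN; elim: d => [|d IH] dN.
    by have /and3P[_ _ /= /andP[/eqP]] := hu t 0 tN dN.
  have /and5P[_ _ _ _ /andP[/eqP-> _]] := hr t d tN dN.
  by rewrite IH 1?ltnW //; lia.
have row t d : t < N -> d < N -> lst (L t d) = lst (L t 0) /\ lhead (L t d) = lcur (L t 0).
  move=> tN; elim: d => [|d IH] dN.
    by have /and3P[_ _ /= /andP[_ /eqP]] := hu t 0 tN dN.
  have [e1 e2] := IH (ltnW dN).
  by have /and5P[/eqP-> /eqP-> _ _ _] := hr t d tN dN.
exists y.
  have [NQ|QN] := leqP N Q; first by apply: leq_trans NQ; rewrite -sN leading_bits_size.
  apply: size_leading_bits; first by rewrite sN.
  by rewrite sd //; have := bits Q QN; rewrite ltnn orbF => /eqP.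
have main t : t < N -> lst (L t 0) = (run x y t).1 /\
    forall d, d + t < N -> lcur (L t d) = col (run x y t) d.
  elim: t => [|t IH] tN.
    split; first by have /and3P[_ /eqP-> _] := init0 0 N0.
    move=> d; rewrite addn0 => dN; have /and3P[_ _ /forallP hi] := init0 d dN.
    apply/ffunP => i; rewrite ffunE /run /init /=.
    have := hi i; rewrite [lcur _ i]surjective_pairing /= => /andP[/eqP-> +].
    case ei : (val i) => [|[|j]] /=; rewrite ?nth_nil ?nth_bits.
    - by move/eqP->.
    - move=> _; have -> : i = tape1 by apply: val_inj.
      by rewrite -sd // -ys -nth_bits.
    - by move/eqP->.
  have [e1 e2] := IH (ltnW tN).
  have head : lcur (L t 0) = col (run x y t) 0 by rewrite e2 // add0n ltnW.
  have down d : d < N -> label_down (L t d) (L t.+1 d) by apply: hv.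
  split.
    have /andP[/eqP-> _] := down 0 N0.
    have [_ ->] := row t 0 (ltnW tN) N0.
    by rewrite /run iterS step_state -/(run x y t) e1 head.
  move=> d dt; have dN : d.+1 < N by lia.
  have /andP[_ /eqP->] := down d (ltnW dN).
  have [-> ->] := row t d (ltnW tN) (ltnW dN).
  rewrite /run iterS step_col -/(run x y t) e1 head pos ?(ltnW tN) ?(ltnW dN) //.
  have /and5P[_ _ _ /eqP <- _] := hr t d (ltnW tN) dN.
  rewrite !e2; try lia.
  case: d dt dN => [|d] dt dN.
    exact: next_column0.
  by have /and5P[_ _ /eqP-> _ _] := hr t d (ltnW tN) (ltnW dN); rewrite e2 //; lia.
have N1 : N.-1 < N by rewrite prednK.
have [e _] := main _ N1; rewrite /halts_within -/(run x y N.-1) -e.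
by have /and3P[_ +] := hu N.-1 0 N1 N0; rewrite prednK // eqxx => /= /eqP->.
Qed.

End Tableau.

(** * Tableaux as 3-colourings *)

Section Vertices.
Variables J N : nat.

Definition vert (t d j : nat) : nat := (t * N + d) * J + j.

Lemma vert_div t d j : d < N -> j < J ->
  [/\ vert t d j %/ J %/ N = t, (vert t d j %/ J) %% N = d & vert t d j %% J = j].
Proof.
move=> dN jJ; have J0 : 0 < J by lia.
have N0 : 0 < N by lia.
rewrite /vert divnMDl // (divn_small jJ) addn0 divnMDl // (divn_small dN) addn0.
by rewrite modnMDl modn_small // modnMDl modn_small.
Qed.

Lemma vert_lt t d j : t < N -> d < N -> j < J -> vert t d j < N * N * J.
Proof.
move=> tN dN jJ; apply: leq_trans (_ : (t * N + d).+1 * J <= _).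
  by rewrite /vert mulSn addnC ltn_add2r.
by rewrite leq_mul2r; apply/orP; right; nia.
Qed.

End Vertices.

(** The bounded quantifier in the form in which [Ex] is evaluated, so that a graph defined with it
    can be compiled clause by clause. *)
Definition has_lt (n : nat) (p : nat -> bool) : bool := has p (iota 0 n).

Lemma has_ltP n (p : pred nat) : reflect (exists2 i, i < n & p i) (has_lt n p).
Proof.
apply: (iffP hasP) => -[i]; rewrite ?mem_iota /= => hi pi; exists i => //.
by rewrite mem_iota.
Qed.

Section Gadget.
Variables (g J N : nat) (hr vr : rel nat) (ok : nat -> nat -> nat -> bool).
Hypothesis g_odd : odd g.
Hypothesis g_gt1 : 1 < g.
Hypothesis gJ : 2 * g + 3 <= J.
Local Notation vert := (vert J N).

(* Cell [(t, d)] has the vertices [a_i = (t, d, i)] and [b_i = (t, d, g + i)]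
   for [i < g]; the palette consists of [(0, 0, 2 g + c)] for [c < 3].  The cell
   has label [i] when [b_i] has the colour of palette vertex 1; otherwise the
   colour of [b_i] is that of palette vertex 0 or 2, according to the parity of
   [t + d].  Hence adjacent cells may both avoid colour 1 at will, and a single
   edge excludes a pair of labels.  The odd cycle of the [a_i] cannot be coloured
   if no [b_i] has colour 1. *)
Definition edge (t d j t' d' j' : nat) : bool :=
  [|| [&& t == t', d == d', j < g & [|| (j' == j.+1) && (j' < g), (j.+1 == g) && (j' == 0) | j' == g + j]],
      [&& t' == 0, d' == 0 & has_lt g (fun i => (j == g + i) &&
           ((j' == 2 * g + (if odd (t + d) then 0 else 2)) || (j' == 2 * g + 1) && ~~ ok t d i))],
      has_lt g (fun i => has_lt g (fun i' => [&& j == g + i, j' == g + i' &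
           [&& t == t', d' == d.+1 & ~~ hr i i'] || [&& t' == t.+1, d' == d & ~~ vr i i']]))
    | [&& t == 0, d == 0, t' == 0, d' == 0 & [&& 2 * g <= j, j < j' & j' < 2 * g + 3]]].

Definition arc (u v : nat) : bool :=
  has_lt N (fun t => has_lt N (fun d => has_lt J (fun j =>
  has_lt N (fun t' => has_lt N (fun d' => has_lt J (fun j' =>
    [&& u == vert t d j, v == vert t' d' j' & edge t d j t' d' j'])))))).

Definition gadget (u v : nat) : bool := (u != v) && (arc u v || arc v u).

Lemma arcP u v : reflect (exists t d j t' d' j',
  [/\ [/\ t < N, d < N & j < J], [/\ t' < N, d' < N & j' < J], u = vert t d j, v = vert t' d' j'
    & edge t d j t' d' j']) (arc u v).
Proof.
apply: (iffP idP).
  move=> /has_ltP[t ht /has_ltP[d hd /has_ltP[j hj /has_ltP[t' ht' /has_ltP[d' hd' /has_ltP[j' hj']]]]]].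
  by move=> /and3P[/eqP-> /eqP-> e]; exists t, d, j, t', d', j'.
case=> t [d [j [t' [d' [j' [[ht hd hj] [ht' hd' hj'] -> -> e]]]]]].
apply/has_ltP; exists t => //; apply/has_ltP; exists d => //; apply/has_ltP; exists j => //.
apply/has_ltP; exists t' => //; apply/has_ltP; exists d' => //; apply/has_ltP; exists j' => //.
by rewrite !eqxx.
Qed.

Definition is_labelling (lab : nat -> nat -> nat) : Prop :=
  [/\ forall t d, t < N -> d < N -> lab t d < g /\ ok t d (lab t d),
      forall t d, t < N -> d.+1 < N -> hr (lab t d) (lab t d.+1)
    & forall t d, t.+1 < N -> d < N -> vr (lab t d) (lab t.+1 d)].

Definition colouring (f : nat -> nat) : Prop :=
  (forall u, f u < 3) /\
  forall u v, u < N * N * J -> v < N * N * J -> gadget u v -> f u != f v.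

(** [e0] is the colour of the [b_i] that are not selected, and [a_i] for the selected index [i0]
    takes it too. The other [a_j], even in number, alternate between 1 and [2 - e0] around the
    cycle; the flip for [j < i0] comes from the passage from [g - 1] to 0, since [g] is odd. *)
Definition cell_colour (lab : nat -> nat -> nat) (t d j : nat) : nat :=
  let e0 := if odd (t + d) then 2 else 0 in
  let i0 := lab t d in
  if j < g then if j == i0 then e0 else if odd (i0 + j) (+) (j < i0) then 1 else 2 - e0
  else if j < 2 * g then if j == g + i0 then 1 else e0
  else minn (j - 2 * g) 2.

Lemma cell_colour_b lab t d i : i < g ->
  cell_colour lab t d (g + i) = if i == lab t d then 1 else if odd (t + d) then 2 else 0.
Proof.
move=> ig; rewrite /cell_colour eqn_add2l.
have -> : (g + i < g) = false by lia.
by have -> : g + i < 2 * g by lia.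
Qed.

Lemma cell_colour_palette lab t d c : c < 3 -> cell_colour lab t d (2 * g + c) = c.
Proof.
move=> c3; rewrite /cell_colour addKn.
have -> : (2 * g + c < g) = false by lia.
have -> : (2 * g + c < 2 * g) = false by lia.
lia.
Qed.

Lemma labelling_colouring lab : is_labelling lab -> exists f, colouring f.
Proof.
move=> [lok lhr lvr].
pose f u := cell_colour lab (u %/ J %/ N) ((u %/ J) %% N) (u %% J).
have fE t d j : d < N -> j < J -> f (vert t d j) = cell_colour lab t d j.
  by move=> hd hj; rewrite /f; have [-> -> ->] := vert_div t hd hj.
exists f; split.
  move=> u; rewrite /f /cell_colour; move: (minn _ _) (geq_minr (u %% J - 2 * g) 2) => m2 hm.
  by case: odd; repeat case: ifP => _ //.
suff arcf u v : arc u v -> f u != f v.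
  by move=> u v _ _ /andP[_ /orP[/arcf//|/arcf]]; rewrite eq_sym.
case/arcP=> t [d [j [t' [d' [j' [[tN dN jJ] [tN' dN' jJ'] -> -> h]]]]]].
rewrite !fE //; case/or4P: h.
- case/and4P=> /eqP<- /eqP<- jg; have [ig _] := lok t d tN dN.
  rewrite /cell_colour jg; set i0 := lab t d in ig *.
  case/or3P=> [/andP[/eqP-> jg']|/andP[/eqP jl /eqP->]|/eqP->].
  + rewrite jg'; case: (eqVneq j i0) => [->|n1].
      have -> : (i0.+1 == i0) = false by lia.
      by case: (odd (t + d)); case: ifP.
    case: (eqVneq j.+1 i0) => [_|n2]; first by case: (odd (t + d)); case: ifP.
    have -> : (j.+1 < i0) = (j < i0) by lia.
    by rewrite addnS oddS; case: (odd (t + d)); case: (odd (i0 + j)); case: (j < i0).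
  + have g0 : 0 < g by lia.
    have oj : odd j = false by move: g_odd; rewrite -jl oddS; case: odd.
    rewrite g0 (addn0 i0) (oddD i0 j) oj addbF; case: (eqVneq j i0) => [e|n1].
      have -> : (0 == i0) = false by lia.
      by case: (odd (t + d)); case: ifP.
    have -> : (j < i0) = false by lia.
    case: (eqVneq 0 i0) => [_|n2]; first by case: (odd (t + d)); case: ifP.
    have -> : 0 < i0 by lia.
    by case: (odd (t + d)); case: (odd i0).
  + have -> : (g + j < g) = false by lia.
    have -> : g + j < 2 * g by lia.
    rewrite eqn_add2l -/i0; case: (eqVneq j i0) => [_|_]; case: (odd (t + d)) => //=.
    + by case: ifP.
    + by case: ifP.
- case/and3P=> /eqP-> /eqP-> /has_ltP[i ig /andP[/eqP->]].
  have [lg okl] := lok t d tN dN.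
  rewrite cell_colour_b //; case/orP=> [/eqP->|/andP[/eqP-> nok]].
    rewrite cell_colour_palette; last by case: (odd (t + d)).
    by case: (odd (t + d)); case: ifP.
  rewrite cell_colour_palette //; case: (eqVneq i (lab t d)) => [e|_]; first by move: nok; rewrite e okl.
  by case: (odd (t + d)).
- case/has_ltP=> i ig /has_ltP[i' ig' /and3P[/eqP-> /eqP->]]; rewrite !cell_colour_b //.
  case/orP=> /and3P[/eqP e1 /eqP e2 no].
    rewrite -e1 e2 addnS oddS; case: (eqVneq i (lab t d)) => e;
      case: (eqVneq i' (lab t d.+1)) => e'; try by case: (odd (t + d)).
    by move: no; rewrite e e' lhr // -?e2.
  rewrite e1 e2 addSn oddS; case: (eqVneq i (lab t d)) => e;
      case: (eqVneq i' (lab t.+1 d)) => e'; try by case: (odd (t + d)).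
  by move: no; rewrite e e' lvr // -?e1.
case/and5P=> _ _ _ _ /and3P[h1 h2 h3].
rewrite -(subnKC h1) -(@subnKC (2 * g) j'); last lia.
by rewrite !cell_colour_palette; lia.
Qed.

(** Colours may be permuted, so everything is read relative to the colours [c i] of the palette; the
    label of a cell is the first index whose [b_i] has the colour [c 1]. *)
Lemma colouring_labelling f : 0 < N -> colouring f -> exists lab, is_labelling lab.
Proof.
move=> N0 [f3 fe].
have fedge t d j t' d' j' : t < N -> d < N -> j < J -> t' < N -> d' < N -> j' < J ->
    edge t d j t' d' j' -> (t != t') || (d != d') || (j != j') ->
    f (vert t d j) <> f (vert t' d' j').
  move=> ht hd hj ht' hd' hj' e ne; apply/eqP; apply: fe; rewrite ?vert_lt //.
  apply/andP; split; last by apply/orP; left; apply/arcP; exists t, d, j, t', d', j'.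
  apply: contraTneq ne => e'.
  have [a1 a2 a3] := vert_div t hd hj; have [] := vert_div t' hd' hj'.
  by rewrite -e' a1 a2 a3 => -> -> ->; rewrite !eqxx.
pose c i := f (vert 0 0 (2 * g + i)).
have pal i j : i < j -> j < 3 -> c i <> c j.
  move=> ij j3; apply: fedge; try lia.
  by apply/or4P; apply: Or44; rewrite !eqxx /=; lia.
have c01 := pal 0 1 isT isT; have c02 := pal 0 2 isT isT; have c12 := pal 1 2 isT isT.
have g0 : 0 < g by case: g g_odd.
pose T t d i := f (vert t d (g + i)) == c 1.
have some t d : t < N -> d < N -> has_lt g (T t d).
  move=> tN dN; apply/negPn/negP => /has_ltP no.
  (* The [b_i] of the cell are joined to the palette vertex of colour [y], so [x] is the only colour
     left to them. *)
  pose x := if odd (t + d) then c 2 else c 0; pose y := if odd (t + d) then c 0 else c 2.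
  have b i : i < g -> f (vert t d (g + i)) = x.
    move=> ig; have n1 : f (vert t d (g + i)) <> c 1 by move=> e; apply: no; exists i => //; apply/eqP.
    have n2 : f (vert t d (g + i)) <> y.
      rewrite /y -(fun_if c); apply: fedge; try (case: (odd (t + d)); lia); try lia.
      apply/or4P; apply: Or42; rewrite !eqxx /=; apply/has_ltP; exists i => //.
      by rewrite !eqxx.
    move: n1 n2; rewrite /x /y /c in c01 c02 c12 *.
    have := f3 (vert t d (g + i)); have := f3 (vert 0 0 (2 * g + 0)).
    have := f3 (vert 0 0 (2 * g + 1)); have := f3 (vert 0 0 (2 * g + 2)).
    by case: (odd (t + d)); lia.
  pose h i := f (vert t d i) == c 1.
  have a i : i < g -> f (vert t d i) <> x.
    move=> ig; rewrite -(b i ig); apply: fedge; try lia.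
    by apply/or4P; apply: Or41; rewrite !eqxx ig /= !orbT.
  have step i j : i < g -> j < g -> f (vert t d i) <> f (vert t d j) -> h j = ~~ h i.
    move=> ig jg; have := a i ig; have := a j jg; rewrite /h /x /c in c01 c02 c12 *.
    have := f3 (vert t d i); have := f3 (vert t d j); have := f3 (vert 0 0 (2 * g + 0)).
    have := f3 (vert 0 0 (2 * g + 1)); have := f3 (vert 0 0 (2 * g + 2)).
    by case: (odd (t + d)); do 2!case: eqP; lia.
  have alt i : i < g -> h i = h 0 (+) odd i.
    elim: i => [|i IH] ig; first by rewrite addbF.
    rewrite (step i i.+1) ?(IH (ltnW ig)) ?(ltnW ig) //; first by rewrite oddS; case: (h 0); case: odd.
    apply: fedge; try lia.
    by apply/or4P; apply: Or41; rewrite !eqxx (ltnW ig) ig.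
  have g1 : g.-1 < g by lia.
  have og : odd g.-1 = false by move: g_odd; rewrite -{1}(prednK g0) oddS; case: odd.
  have : h 0 = ~~ h g.-1.
    apply: step => //; apply: fedge; try lia.
    by apply/or4P; apply: Or41; rewrite !eqxx g1 prednK ?eqxx ?orbT.
  by rewrite (alt _ g1) og addbF; case: (h 0).
exists (fun t d => find (T t d) (iota 0 g)).
have labP t d : t < N -> d < N -> let i := find (T t d) (iota 0 g) in i < g /\ f (vert t d (g + i)) = c 1.
  move=> tN dN /=; have hs := some t d tN dN.
  have ltg : find (T t d) (iota 0 g) < g by move: hs; rewrite /has_lt has_find size_iota.
  by split=> //; have := nth_find 0 hs; rewrite nth_iota // => /eqP.
split.
- move=> t d tN dN; have [ig e] := labP t d tN dN; split=> //.
  apply/negPn/negP => nok; apply: (fedge t d _ 0 0 (2 * g + 1) _ _ _ _ _ _ _ _ e); try lia.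
  apply/or4P; apply: Or42; rewrite !eqxx /=; apply/has_ltP.
  by exists (find (T t d) (iota 0 g)) => //; rewrite eqxx nok orbT.
- move=> t d tN dN; have [ig e] := labP t d tN (ltnW dN); have [ig' e'] := labP t d.+1 tN dN.
  move: ig e ig' e'; set i := find _ _; set i' := find _ _ => ig e ig' e'.
  apply/negPn/negP => no; suff : f (vert t d (g + i)) <> f (vert t d.+1 (g + i')) by rewrite e e'.
  apply: fedge; try lia; apply/or4P; apply: Or43; apply/has_ltP; exists i => //.
  by apply/has_ltP; exists i' => //; rewrite !eqxx no.
move=> t d tN dN; have [ig e] := labP t d (ltnW tN) dN; have [ig' e'] := labP t.+1 d tN dN.
move: ig e ig' e'; set i := find _ _; set i' := find _ _ => ig e ig' e'.
apply/negPn/negP => no; suff : f (vert t d (g + i)) <> f (vert t.+1 d (g + i')) by rewrite e e'.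
apply: fedge; try lia; apply/or4P; apply: Or43; apply/has_ltP; exists i => //.
by apply/has_ltP; exists i' => //; rewrite !eqxx no orbT.
Qed.

End Gadget.

(** * Denotational semantics *)

(* Formulas and commands are written in higher-order style, as functions of the
   level at which they are used.  A world is an environment whose variables are
   in use below some level; denotations are stable under extension of worlds. *)
Definition world := ((nat -> nat) * nat)%type.

Definition wext (W W' : world) : Prop := W.2 <= W'.2 /\ forall i, i < W.2 -> W'.1 i = W.1 i.

Definition tden (W : world) (e : term) (v : nat) : Prop :=
  forall W', wext W W' -> teval W'.1 e = v.

Definition fm := nat -> bexp.
Definition cm := nat -> cmd.

Definition bden (al : arrays) (W : world) (F : fm) (b : bool) : Prop :=
  forall W', wext W W' -> beval al W'.2 W'.1 (F W'.2) = b.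

Definition cden (W : world) (C : cm) (f : arrays -> arrays) : Prop :=
  forall W', wext W W' -> forall al, ceval W'.2 W'.1 (C W'.2) al = f al.

Lemma wext_refl W : wext W W. Proof. by []. Qed.

Lemma wext_trans W1 W2 W3 : wext W1 W2 -> wext W2 W3 -> wext W1 W3.
Proof.
move=> [h1 e1] [h2 e2]; split; first exact: leq_trans h2.
by move=> i hi; rewrite e2 ?e1 // (leq_trans hi).
Qed.

Lemma tden_ext W W' e v : wext W W' -> tden W e v -> tden W' e v.
Proof. by move=> h hd W'' h'; apply/hd/wext_trans/h'. Qed.

Lemma wext_up W : wext W (W.1, W.2.+1).
Proof. by split=> /=. Qed.

Lemma wext_bind W v : wext W (upd W.1 W.2 v, W.2.+1).
Proof. by split=> //= i hi; rewrite /upd ltn_eqF. Qed.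

Lemma tden_V W i v : i < W.2 -> W.1 i = v -> tden W (V i) v.
Proof. by move=> hi <- W' [_ h] /=; apply: h. Qed.

Lemma tden_K W c : tden W (K c) c.
Proof. by []. Qed.

Lemma tden_add W e1 e2 v1 v2 : tden W e1 v1 -> tden W e2 v2 -> tden W (Add e1 e2) (v1 + v2).
Proof. by move=> h1 h2 W' h /=; rewrite h1 ?h2. Qed.

Lemma tden_mul W e1 e2 v1 v2 : tden W e1 v1 -> tden W e2 v2 -> tden W (Mul e1 e2) (v1 * v2).
Proof. by move=> h1 h2 W' h /=; rewrite h1 ?h2. Qed.

Definition fle e1 e2 : fm := fun=> Le e1 e2.
Definition fbit a e x : fm := fun=> Bit a e x.
Definition fnot (F : fm) : fm := fun l => Not (F l).
Definition fand (F1 F2 : fm) : fm := fun l => And (F1 l) (F2 l.+1).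
Definition fex (e : term) (F : term -> fm) : fm := fun l => Ex e (F (V l) l.+1).
Definition flor F1 F2 : fm := fnot (fand (fnot F1) (fnot F2)).
Definition feq e1 e2 : fm := fand (fle e1 e2) (fle e2 e1).
Definition flt e1 e2 : fm := fnot (fle e2 e1).
Definition fconst (b : bool) : fm := fle (K (~~ b)) (K 0).
Definition fif F F1 F0 : fm := flor (fand F F1) (fand (fnot F) F0).
Definition fdisj (n : nat) (F : nat -> fm) : fm :=
  foldr (fun i G => flor (F i) G) (fconst false) (iota 0 n).
Definition fall (e : term) (F : term -> fm) : fm := fnot (fex e (fun x => fnot (F x))).

Section Den.
Variables (al : arrays) (W : world).
Notation bden := (bden al).

Lemma bden_le e1 e2 v1 v2 : tden W e1 v1 -> tden W e2 v2 -> bden W (fle e1 e2) (v1 <= v2).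
Proof. by move=> h1 h2 W' h /=; rewrite h1 ?h2. Qed.

Lemma bden_bit a e x v : tden W e v -> bden W (fbit a e x) (al a v == x).
Proof. by move=> h1 W' h /=; rewrite h1. Qed.

Lemma bden_not F b : bden W F b -> bden W (fnot F) (~~ b).
Proof. by move=> h1 W' h /=; rewrite h1. Qed.

Lemma bden_and F1 F2 b1 b2 : bden W F1 b1 -> bden W F2 b2 -> bden W (fand F1 F2) (b1 && b2).
Proof.
move=> h1 h2 W' h /=; rewrite h1 //; congr (_ && _).
by apply: (h2 (W'.1, W'.2.+1)); apply: wext_trans h (wext_up _).
Qed.

Lemma bden_ex e v F P : tden W e v ->
  (forall W' x w, wext W W' -> tden W' x w -> bden W' (F x) (P w)) ->
  bden W (fex e F) (has_lt v P).
Proof.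
move=> he hF W' h /=; rewrite he //; apply: eq_has => w.
have h' : wext W (upd W'.1 W'.2 w, W'.2.+1) by apply: wext_trans h (wext_bind _ _).
have hx : tden (upd W'.1 W'.2 w, W'.2.+1) (V W'.2) w.
  by apply: tden_V; rewrite //= /upd eqxx.
exact: hF h' hx _ (wext_refl _).
Qed.

Lemma bden_eqb F b b' : bden W F b -> b = b' -> bden W F b'.
Proof. by move=> h <-. Qed.

Lemma bden_or F1 F2 b1 b2 : bden W F1 b1 -> bden W F2 b2 -> bden W (flor F1 F2) (b1 || b2).
Proof.
move=> h1 h2; refine (bden_eqb (bden_not (bden_and (bden_not h1) (bden_not h2))) _).
by rewrite negb_and !negbK.
Qed.

Lemma bden_eq e1 e2 v1 v2 : tden W e1 v1 -> tden W e2 v2 -> bden W (feq e1 e2) (v1 == v2).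
Proof. by move=> h1 h2; refine (bden_eqb (bden_and (bden_le h1 h2) (bden_le h2 h1)) _); rewrite -eqn_leq. Qed.

Lemma bden_lt e1 e2 v1 v2 : tden W e1 v1 -> tden W e2 v2 -> bden W (flt e1 e2) (v1 < v2).
Proof. by move=> h1 h2; refine (bden_eqb (bden_not (bden_le h2 h1)) _); rewrite -ltnNge. Qed.

Lemma bden_const b : bden W (fconst b) b.
Proof. by refine (bden_eqb (bden_le (@tden_K _ _) (@tden_K _ _)) _); case: b. Qed.

Lemma bden_if F F1 F0 b b1 b0 : bden W F b -> bden W F1 b1 -> bden W F0 b0 ->
  bden W (fif F F1 F0) (if b then b1 else b0).
Proof.
move=> h h1 h0; refine (bden_eqb (bden_or (bden_and h h1) (bden_and (bden_not h) h0)) _).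
by case: b {h}; rewrite ?orbF.
Qed.

Lemma bden_disj n F P : (forall i, i < n -> bden W (F i) (P i)) -> bden W (fdisj n F) (has_lt n P).
Proof.
rewrite /fdisj /has_lt => h.
have : {in iota 0 n, forall i, bden W (F i) (P i)} by move=> i; rewrite mem_iota => /h.
elim: (iota 0 n) => [|i s IH] hs /=; first exact: bden_const.
apply: bden_or; first by apply: hs; rewrite mem_head.
by apply: IH => j hj; apply: hs; rewrite inE hj orbT.
Qed.

End Den.

Lemma bden_all al W e v F P : tden W e v ->
  (forall W' x w, wext W W' -> tden W' x w -> bden al W' (F x) (P w)) ->
  bden al W (fall e F) (all P (iota 0 v)).
Proof.
move=> he hF; rewrite -[all _ _]negbK -has_predC; apply: bden_not.
apply: (bden_ex (P := fun w => ~~ P w) he) => W' x w hW hx.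
exact: (bden_not (hF _ _ _ hW hx)).
Qed.

Definition cseq (C1 C2 : cm) : cm := fun l => CSeq (C1 l) (C2 l).
Definition cfor (e : term) (C : term -> cm) : cm := fun l => CFor e (C (V l) l.+1).
Definition cif (F : fm) (C : cm) : cm := fun l => CIf (F l) (C l).
Definition cset a e x : cm := fun=> CSet a e x.

Definition put (a : 'I_6) (i : nat) (x : Sy) (al : arrays) : arrays := upd al a (upd (al a) i x).
Definition loop (n : nat) (f : nat -> arrays -> arrays) (al : arrays) : arrays :=
  foldl (fun al v => f v al) al (iota 0 n).

Lemma cden_seq W C1 C2 f1 f2 : cden W C1 f1 -> cden W C2 f2 ->
  cden W (cseq C1 C2) (fun al => f2 (f1 al)).
Proof. by move=> h1 h2 W' h al /=; rewrite h1 ?h2. Qed.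

Lemma cden_for W e v C f : tden W e v ->
  (forall W' x w, wext W W' -> tden W' x w -> cden W' (C x) (f w)) ->
  cden W (cfor e C) (loop v f).
Proof.
move=> he hC W' h al /=; rewrite he // /loop.
elim: (iota 0 v) al => //= w s IH al; rewrite IH; congr (foldl _ _ _).
have h' : wext W (upd W'.1 W'.2 w, W'.2.+1) by apply: wext_trans h (wext_bind _ _).
have hx : tden (upd W'.1 W'.2 w, W'.2.+1) (V W'.2) w.
  by apply: tden_V; rewrite //= /upd eqxx.
exact: hC h' hx _ (wext_refl _) al.
Qed.

Lemma cden_if W F C P f : (forall al, bden al W F (P al)) -> cden W C f ->
  cden W (cif F C) (fun al => if P al then f al else al).
Proof. by move=> hF hC W' h al /=; rewrite (hF al _ h) hC. Qed.

Lemma cden_set W a e x v : tden W e v -> cden W (cset a e x) (put a v x).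
Proof. by move=> h1 W' h al /=; rewrite h1. Qed.

Lemma loop_inv (P : nat -> arrays -> Prop) n f al : P 0 al ->
  (forall v al, v < n -> P v al -> P v.+1 (f v al)) -> P n (loop n f al).
Proof.
move=> h0 hS; rewrite /loop; elim: n hS => // n IH hS.
rewrite iotaSr foldl_rcons; apply: (hS) => //; apply: IH => v al' hv; apply: hS.
exact: ltnW.
Qed.

Lemma loop_id n f al : (forall v, v < n -> f v al = al) -> loop n f al = al.
Proof.
by move=> h; apply: (loop_inv (P := fun _ a => a = al)) => // v a vn ->; apply: h.
Qed.

Lemma loop_single n f v0 al al1 : v0 < n -> f v0 al = al1 ->
  (forall v, v < v0 -> f v al = al) -> (forall v, v0 < v -> v < n -> f v al1 = al1) ->
  loop n f al = al1.
Proof.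
move=> v0n h0 h1 h2.
have : n <= v0 /\ loop n f al = al \/ v0 < n /\ loop n f al = al1.
  apply: (loop_inv (P := fun k a => k <= v0 /\ a = al \/ v0 < k /\ a = al1)); first by left.
  move=> v a vn [[hv ->]|[hv ->]]; last by right; rewrite h2 // ltnW.
  have [vv|vv|->] := ltngtP v v0; last by right; rewrite h0.
    by left; rewrite h1.
  by move: hv vv; lia.
by case=> -[] //; lia.
Qed.

(** [I] lets round [v0] establish [Q], and later rounds preserve it; this is how a search is shown
    to find what it should. *)
Lemma loop_hit (I Q : arrays -> Prop) n f v0 al : v0 < n -> I al ->
  (forall v al, v < n -> I al -> I (f v al)) -> (forall al, I al -> Q (f v0 al)) ->
  (forall v al, v < n -> Q al -> Q (f v al)) -> Q (loop n f al).
Proof.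
move=> v0n i0 hI h0 hQ.
suff [_] : I (loop n f al) /\ (v0 < n -> Q (loop n f al)) by apply.
apply: (loop_inv (P := fun k a => I a /\ (v0 < k -> Q a))) => // v a vn [ia qa].
split; first exact: hI.
by rewrite ltnS leq_eqVlt => /predU1P[<-|/qa h]; [apply: h0 | apply: hQ].
Qed.

Lemma loop_once n (c : nat -> arrays -> bool) f v0 al : v0 < n ->
  (forall v, v < v0 -> c v al = false) -> c v0 al ->
  (forall v, v0 < v -> v < n -> c v (f v0 al) = false) ->
  loop n (fun v al => if c v al then f v al else al) al = f v0 al.
Proof.
move=> v0n h1 h0 h2; apply: (loop_single v0n); first by rewrite h0.
- by move=> v hv; rewrite h1.
- by move=> v hv vn; rewrite h2.
Qed.

Lemma putE a i x al b k : put a i x al b k = if (b == a) && (k == i) then x else al b k.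
Proof. by rewrite /put /upd; case: eqP => [->|_] //=. Qed.

Ltac lift_den h := repeat match type of h with wext ?W ?W' =>
  match goal with H : tden W ?e ?v |- _ => apply (tden_ext h) in H end end.

Ltac tden_tac := repeat first [ eassumption | apply: tden_add | apply: tden_mul | apply: tden_K ].

Ltac den_step :=
  lazymatch goal with
  | |- bden _ _ (fand _ _) _ => apply: bden_and
  | |- bden _ _ (flor _ _) _ => apply: bden_or
  | |- bden _ _ (feq _ _) _ => apply: bden_eq; tden_tac
  | |- bden _ _ (flt _ _) _ => apply: bden_lt; tden_tac
  | |- bden _ _ (fle _ _) _ => apply: bden_le; tden_tac
  | |- bden _ _ (fbit _ _ _) _ => apply: bden_bit; tden_tac
  | |- bden _ _ (fconst _) _ => apply: bden_const
  | |- bden _ _ (fif _ _ _) _ => apply: bden_if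
  | |- bden _ _ (fnot _) _ => apply: bden_not
  | |- bden _ _ (fdisj _ _) _ => apply: bden_disj => ? ?
  | |- bden _ _ (fex _ _) _ =>
      let W := fresh "W" in let x := fresh "x" in let w := fresh "w" in
      let h := fresh "h" in let hx := fresh "hx" in
      (apply: bden_ex; [by tden_tac | move=> W x w h hx; lift_den h])
  | |- bden _ _ (fall _ _) _ =>
      let W := fresh "W" in let x := fresh "x" in let w := fresh "w" in
      let h := fresh "h" in let hx := fresh "hx" in
      (apply: bden_all; [by tden_tac | move=> W x w h hx; lift_den h])
  end.

Ltac den_tac := repeat den_step.

(* Otherwise unification unfolds the huge formula [fgadget]. *)
Global Opaque fle fbit fnot fand fex flor feq flt fconst fif fdisj fall.

Definition fodd (e : term) : fm := fnot (fex (Add e (K 1)) (fun c => feq e (Add c c))).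

Lemma bden_odd al W e v : tden W e v -> bden al W (fodd e) (odd v).
Proof.
move=> he; refine (bden_eqb (b := ~~ has_lt (v + 1) (fun c => v == c + c)) _ _); first by rewrite /fodd; den_tac.
case: has_ltP => [[c _ /eqP->]|no]; first by rewrite addnn odd_double.
apply/esym/negPn/negP => ov; apply: no; exists v./2; first lia.
by rewrite addnn; have := odd_double_half v; rewrite (negPf ov) add0n => ->.
Qed.

(** * Writing the query *)

Section Labels.
Variable M : machine.

(* The enumeration is sealed, since unfolding it makes conversion explode. *)
Lemma label_enum : {p : nat * (nat -> label M) * (label M -> nat) |
  forall l, p.1.2 (p.2 l) = l /\ p.2 l < p.1.1}.
Proof.
pose c : column M := [ffun=> (None, None)].
pose l0 : label M := (false, ord0, start M, (c, c, c, c)).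
exists (#|label M|, fun i => nth l0 (enum (label M)) i, fun l => index l (enum (label M))) => l /=.
by rewrite nth_index ?mem_enum // cardE index_mem mem_enum.
Qed.

Definition label_count : nat := (sval label_enum).1.1.
Definition label_of : nat -> label M := (sval label_enum).1.2.
Definition label_index : label M -> nat := (sval label_enum).2.
(* An odd number of indices; those from [label_count] on stand for no label. *)
Definition label_bound : nat := (2 * label_count).+3.

Lemma label_indexK l : label_of (label_index l) = l.
Proof. by case: (svalP label_enum l). Qed.

Lemma label_index_lt l : label_index l < label_count.
Proof. by case: (svalP label_enum l). Qed.

Definition right_index : rel nat := fun i i' => label_right (label_of i) (label_of i').
Definition down_index : rel nat := fun i i' => label_down (label_of i) (label_of i').

Definition bit_of (s : Sy) : option bool := if s is Some (inl b) then Some b else None.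

Definition ok_index (X : nat -> Sy) (N Q t d i : nat) : bool :=
  (i < label_count) &&
  label_ok (t == 0) (t.+1 == N) (d == 0) (bit_of (X d)) (d < Q) (label_of i).

Lemma is_labelling_index N Q x :
  (exists L : nat -> nat -> label M, labelling N Q x L) <->
  exists lab, is_labelling label_bound N right_index down_index (ok_index (word x) N Q) lab.
Proof.
have wE d : bit_of (word x d) = onth x d.
  by rewrite /word; elim: x d => [|b x IH] [|d] //=.
split=> [[L [h1 h2 h3]]|[lab [h3 h1 h2]]].
  exists (fun t d => label_index (L t d)); split=> t d ht hd.
  - split; first by have := label_index_lt (L t d); rewrite /label_bound; lia.
    by rewrite /ok_index label_index_lt label_indexK wE h3.
  - by rewrite /right_index !label_indexK h1.
  - by rewrite /down_index !label_indexK h2.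
exists (fun t d => label_of (lab t d)); split=> t d ht hd; [exact: h1 | exact: h2 |].
by have [_ /andP[_]] := h3 t d ht hd; rewrite wE.
Qed.

Section Formula.
Variables (N Q : term).

Definition finput (l : label M) (d : term) (dQ : bool) : fm :=
  fif (fbit tapeX d (bit true)) (fconst (label_init (Some true) dQ l))
   (fif (fbit tapeX d (bit false)) (fconst (label_init (Some false) dQ l))
     (fconst (label_init None dQ l))).

(** There is one formula for each index [i]: the tests on the label are constants, and only the
    position and the input bit are examined at run time. *)
Definition fok (t d : term) (i : nat) : fm :=
  let l := label_of i in
  fand (fconst (i < label_count))
   (fand (fif (feq t (K 0)) (fif (flt d Q) (finput l d true) (finput l d false)) (fconst true))
   (fand (fif (feq (Add t (K 1)) N) (fconst (verdict (lst l) == Some true)) (fconst true))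
         (fif (feq d (K 0)) (fconst ((lpos l == 0) && (lcur l == lhead l))) (fconst true)))).

Definition fedge (t d j t' d' j' : term) : fm :=
  let g := label_bound in
  flor (fand (feq t t') (fand (feq d d') (fand (flt j (K g))
     (flor (fand (feq j' (Add j (K 1))) (flt j' (K g)))
     (flor (fand (feq (Add j (K 1)) (K g)) (feq j' (K 0))) (feq j' (Add (K g) j)))))))
  (flor (fand (feq t' (K 0)) (fand (feq d' (K 0)) (fdisj g (fun i => fand (feq j (K (g + i)))
     (flor (fif (fodd (Add t d)) (feq j' (K (2 * g + 0))) (feq j' (K (2 * g + 2))))
           (fand (feq j' (K (2 * g + 1))) (fnot (fok t d i))))))))
  (flor (fdisj g (fun i => fdisj g (fun i' => fand (feq j (K (g + i))) (fand (feq j' (K (g + i')))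
     (flor (fand (feq t t') (fand (feq d' (Add d (K 1))) (fconst (~~ right_index i i'))))
           (fand (feq t' (Add t (K 1))) (fand (feq d' d) (fconst (~~ down_index i i')))))))))
  (fand (feq t (K 0)) (fand (feq d (K 0)) (fand (feq t' (K 0)) (fand (feq d' (K 0))
     (fand (fle (K (2 * g)) j) (fand (flt j j') (flt j' (K (2 * g + 3))))))))))).

Definition fvert (J : nat) (t d j : term) : term := Add (Mul (Add (Mul t N) d) (K J)) j.

Definition farc (J : nat) (u v : term) : fm :=
  fex N (fun t => fex N (fun d => fex (K J) (fun j =>
  fex N (fun t' => fex N (fun d' => fex (K J) (fun j' =>
    fand (feq u (fvert J t d j)) (fand (feq v (fvert J t' d' j')) (fedge t d j t' d' j')))))))).

Definition fgadget (J : nat) (u v : term) : fm :=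
  fand (fnot (feq u v)) (flor (farc J u v) (farc J v u)).
End Formula.

Lemma bden_input al W l d vd dQ : tden W d vd ->
  bden al W (finput l d dQ) (label_init (bit_of (al tapeX vd)) dQ l).
Proof.
move=> hd; refine (bden_eqb (b := if al tapeX vd == bit true then label_init (Some true) dQ l
  else if al tapeX vd == bit false then label_init (Some false) dQ l else label_init None dQ l) _ _).
  by rewrite /finput; den_tac.
by case: (al tapeX vd) => [[[]|[]]|].
Qed.

Lemma bden_ok al W N Q t d i vN vQ vt vd : tden W N vN -> tden W Q vQ -> tden W t vt ->
  tden W d vd -> bden al W (fok N Q t d i) (ok_index (al tapeX) vN vQ vt vd i).
Proof.
move=> hN hQ ht hd; set X := al tapeX vd; set l := label_of i.
refine (bden_eqb (b := (i < label_count) && ((if vt == 0 then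
    if vd < vQ then label_init (bit_of X) true l else label_init (bit_of X) false l else true) &&
  ((if vt + 1 == vN then verdict (lst l) == Some true else true) &&
   (if vd == 0 then (lpos l == 0) && (lcur l == lhead l) else true)))) _ _).
  by rewrite /fok; den_tac; apply: bden_input.
by rewrite /ok_index /label_ok -/X -/l addn1; case: (vd < vQ).
Qed.

Lemma bden_edge al W N Q t d j t' d' j' vN vQ vt vd vj vt' vd' vj' :
  tden W N vN -> tden W Q vQ -> tden W t vt -> tden W d vd -> tden W j vj ->
  tden W t' vt' -> tden W d' vd' -> tden W j' vj' ->
  bden al W (fedge N Q t d j t' d' j')
    (edge label_bound right_index down_index (ok_index (al tapeX) vN vQ) vt vd vj vt' vd' vj').
Proof.
move=> hN hQ ht hd hj ht' hd' hj'; set g := label_bound.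
refine (bden_eqb (b := [|| [&& vt == vt', vd == vd', vj < g &
        [|| (vj' == vj + 1) && (vj' < g), (vj + 1 == g) && (vj' == 0) | vj' == g + vj]],
      [&& vt' == 0, vd' == 0 & has_lt g (fun i => (vj == g + i) &&
           ((if odd (vt + vd) then vj' == 2 * g + 0 else vj' == 2 * g + 2) ||
            (vj' == 2 * g + 1) && ~~ ok_index (al tapeX) vN vQ vt vd i))],
      has_lt g (fun i => has_lt g (fun i' => [&& vj == g + i, vj' == g + i' &
           [&& vt == vt', vd' == vd + 1 & ~~ right_index i i'] || [&& vt' == vt + 1, vd' == vd & ~~ down_index i i']]))
    | [&& vt == 0, vd == 0, vt' == 0, vd' == 0 & [&& 2 * g <= vj, vj < vj' & vj' < 2 * g + 3]]]) _ _).
  rewrite /fedge; den_tac; try exact: bden_ok; apply: bden_odd; tden_tac.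
rewrite /edge !addn1; do 2?congr (_ || _); congr [&& _, _ & _].
by apply: eq_has => i; case: odd.
Qed.

Lemma bden_gadget al W N Q J u v vN vQ vu vv : tden W N vN -> tden W Q vQ ->
  tden W u vu -> tden W v vv ->
  bden al W (fgadget N Q J u v)
    (gadget label_bound J vN right_index down_index (ok_index (al tapeX) vN vQ) vu vv).
Proof.
move=> hN hQ hu hv; rewrite /fgadget /gadget /farc /arc /vert /fvert.
by den_tac; apply: bden_edge; tden_tac.
Qed.

End Labels.

(** * The bits of the code of a graph *)

Lemma nth_flatten_rows (T : Type) (x0 : T) (ss : seq (seq T)) n u v :
  all (fun s => size s == n) ss -> v < n -> nth x0 (flatten ss) (u * n + v) = nth x0 (nth [::] ss u) v.
Proof.
elim: ss u => [|s ss IH] u /=; first by rewrite !nth_nil.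
case/andP=> /eqP sn hs vn; rewrite nth_cat sn; case: u => [|u]; first by rewrite mul0n add0n vn.
by rewrite ifN ?mulSn; [rewrite -addnA addKn IH | lia].
Qed.

Section CodeGraph.
Variables (n : nat) (G : sgraph 'I_n).

Let rows := [seq [seq G u v | v <- enum 'I_n] | u <- enum 'I_n].

Lemma code_graphE : code_graph G = (nseq n true ++ [:: false]) ++ flatten rows.
Proof. by rewrite /code_graph /code_nat cats1. Qed.

Lemma size_code_graph : size (code_graph G) = n + 1 + n * n.
Proof.
rewrite code_graphE !size_cat size_nseq /=; congr (_ + _).
rewrite size_flatten /shape -map_comp (eq_map (g := fun=> n)) => [|u /=]; last by rewrite size_map size_enum_ord.
have const (s : seq 'I_n) : sumn [seq n | _ <- s] = n * size s.
  by elim: s => [|u s IH] /=; rewrite ?muln0 // IH mulnS.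
by rewrite const size_enum_ord.
Qed.

Lemma nth_code_graph_unary i : i < n -> nth false (code_graph G) i = true.
Proof. by move=> hi; rewrite code_graphE !nth_cat size_cat size_nseq /= ltn_addr // hi nth_nseq hi. Qed.

Lemma nth_code_graph_end : nth false (code_graph G) n = false.
Proof. by rewrite code_graphE !nth_cat size_cat size_nseq /= addn1 ltnS leqnn ltnn subnn. Qed.

Lemma nth_code_graph_adj (u v : 'I_n) : nth false (code_graph G) (n + 1 + (u * n + v)) = G u v.
Proof.
rewrite code_graphE nth_cat size_cat size_nseq /= ltnNge leq_addr /= addKn.
rewrite nth_flatten_rows //; last first.
  by apply/allP => s /mapP[w _ ->]; rewrite size_map size_enum_ord.
by rewrite (nth_map u) ?size_enum_ord // (nth_map v) ?size_enum_ord // !nth_ord_enum.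
Qed.

End CodeGraph.

(** A positive number is a power of two iff 1 is its only odd divisor, a criterion that needs no
    exponentiation. *)
Definition pow2b (v : nat) : bool :=
  ~~ has_lt (v + 1) (fun a => has_lt (v + 1) (fun b => (v == a * b) && (~~ (a == 1) && odd a))).

Lemma pow2bP v : 0 < v -> reflect (exists i, v = 2 ^ i) (pow2b v).
Proof.
move=> v0; apply: (iffP idP) => [|[i ->]].
  elim/ltn_ind: v v0 => v IH v0 /has_ltP no.
  have [v1|v1] := eqVneq v 1; first by exists 0.
  have ev : ~~ odd v.
    apply/negP => ov; apply: no; exists v; rewrite ?addn1 //; apply/has_ltP; exists 1; first lia.
    by rewrite muln1 eqxx v1 ov.
  have e2 : v = 2 * v./2 by have := odd_double_half v; rewrite (negPf ev); lia.
  have h2 : pow2b v./2.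
    apply/has_ltP => -[a ha /has_ltP[b hb /and3P[/eqP hab a1 oa]]]; apply: no.
    exists a; first lia; apply/has_ltP; exists (2 * b); first lia.
    by rewrite a1 oa !andbT; apply/eqP; rewrite {1}e2 hab mulnCA.
  have lt2 : v./2 < v by lia.
  have gt0 : 0 < v./2 by lia.
  by have [i hi] := IH _ lt2 gt0 h2; exists i.+1; rewrite expnS -hi.
apply/has_ltP => -[a _ /has_ltP[b _ /and3P[/eqP e a1 oa]]].
have : coprime a (2 ^ i) by rewrite coprimeXr // coprimen2.
rewrite e /coprime => /eqP; rewrite gcdnMr => ea; move: a1; by rewrite ea.
Qed.

(** The side of the tableau is the [e]-th power of the selected number. It must be a power of two
    for the number of vertices to have the form [3 * 2 ^ k.+1], and at least [(s + 2) ^ e] to exceed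
    the running time. *)
Definition selected (s v : nat) : bool := [&& s + 2 <= v, v < 2 * (s + 2) & pow2b v].

Lemma selected_exists s : exists i, selected s (2 ^ i).
Proof.
exists (up_log 2 (s + 2)); rewrite /selected.
have s1 : 1 < s + 2 by lia.
have /andP[lo hi] := up_log_bounds (isT : 1 < 2) s1.
rewrite hi /=; apply/andP; split; last by apply/pow2bP; [rewrite expn_gt0 | exists (up_log 2 (s + 2))].
have u0 : 0 < up_log 2 (s + 2) by rewrite up_log_gt0.
by rewrite -(prednK u0) expnS ltn_mul2l.
Qed.

Lemma selected_uniq s v w : selected s v -> selected s w -> v = w.
Proof.
wlog vw : v w / v <= w => [H|].
  by case/orP: (leq_total v w) => /H h a b; [apply: h | apply/esym/h].
case/and3P=> v1 v2 pv /and3P[w1 w2 pw].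
have /pow2bP[|i ei] := pv; first lia.
have /pow2bP[|j ej] := pw; first lia.
have ij : i <= j by rewrite -(@leq_exp2l 2) // -ei -ej.
have [e|ne] := eqVneq i j; first by rewrite ei ej e.
have : 2 ^ i.+1 <= 2 ^ j by rewrite leq_exp2l //; lia.
by rewrite expnS -ei -ej; lia.
Qed.

Definition fselected (s S : term) : fm :=
  fand (fle (Add s (K 2)) S) (fand (flt S (Mul (K 2) (Add s (K 2))))
   (fnot (fex (Add S (K 1)) (fun a => fex (Add S (K 1)) (fun b =>
      fand (feq S (Mul a b)) (fand (fnot (feq a (K 1))) (fodd a))))))).

Lemma bden_selected al W s S vs vS : tden W s vs -> tden W S vS ->
  bden al W (fselected s S) (selected vs vS).
Proof.
move=> hs hS; rewrite /fselected /selected /pow2b; den_tac.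
by apply: bden_odd; tden_tac.
Qed.

Fixpoint tpow (S : term) (e : nat) : term := if e is e'.+1 then Mul S (tpow S e') else K 1.

Lemma tden_pow W S v e : tden W S v -> tden W (tpow S e) (v ^ e).
Proof. by move=> hS; elim: e => [|e IH] /=; [exact: tden_K | rewrite expnS; apply: tden_mul]. Qed.

Definition tpoly (p : {poly nat}) (s : term) : term :=
  foldr (fun a r => Add (Mul r s) (K a)) (K 0) p.

Lemma tden_poly W s v p : tden W s v -> tden W (tpoly p s) (p.[v])%R.
Proof.
move=> hs; rewrite /tpoly /horner; elim: (polyseq p) => [|a r IH] /=; first exact: tden_K.
by apply: tden_add; [apply: tden_mul | apply: tden_K].
Qed.

Definition input_term : term := V 0.

(* Runs [body S] for the unique power of two [S] in the interval
   from [|x| + 2] to [2 |x| + 3]. *)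
Definition cselect (body : term -> cm) : cm :=
  cfor (Mul (K 2) (Add input_term (K 2))) (fun S => cif (fselected input_term S) (body S)).

Definition world0 (s : nat) : world := (input_env s, 1).

Lemma tden_input s W : wext (world0 s) W -> tden W input_term s.
Proof. by move=> h; apply: (tden_ext h); apply: tden_V. Qed.

Lemma cselect_eval body s i f al : selected s (2 ^ i) ->
  (forall W S v, wext (world0 s) W -> tden W S v -> cden W (body S) (f v)) ->
  ceval 1 (input_env s) (cselect body 1) al = f (2 ^ i) al.
Proof.
move=> hsel hb; have hs := tden_input (wext_refl (world0 s)).
have : cden (world0 s) (cselect body)
   (loop (2 * (s + 2)) (fun v al => if selected s v then f v al else al)).
  apply: cden_for; first by tden_tac.
  move=> W S v hW hS; lift_den hW; apply: cden_if; last exact: hb.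
  by move=> al'; apply: bden_selected.
move=> /(_ _ (wext_refl _) al) /= ->.
apply: (loop_once (c := fun v _ => selected s v)) => //.
- by case/and3P: hsel.
- by move=> v hv; apply/negP => /(selected_uniq hsel) e; lia.
- by move=> v hv _; apply/negP => /(selected_uniq hsel) e; lia.
Qed.

Section Writer.
Variables (M : machine) (q : {poly nat}) (e kap : nat).
Let J := 3 * 2 ^ kap.

Definition side_term (S : term) : term := tpow S e.
Definition witness_term : term := tpoly q input_term.
Definition order_term (S : term) : term := Mul (Mul (side_term S) (side_term S)) (K J).

Definition query_adj (s N : nat) (X : nat -> Sy) (u v : nat) : bool :=
  gadget (label_bound M) J N (@right_index M) (@down_index M) (@ok_index M X N (q.[s])%R) u v.

Definition fquery (S u v : term) : fm := fgadget M (side_term S) witness_term J u v.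

Lemma bden_query al W s S vS u v vu vv : wext (world0 s) W -> tden W S vS ->
  tden W u vu -> tden W v vv ->
  bden al W (fquery S u v) (query_adj s (vS ^ e) (al tapeX) vu vv).
Proof.
move=> hW hS hu hv; have hs := tden_input hW.
by apply: bden_gadget => //; [apply: tden_pow | apply: tden_poly].
Qed.

(** Conditionals have no alternative, so the bit 0 is written beforehand, and [F] is evaluated after
    that. *)
Definition cwrite a i F : cm := cseq (cset a i (bit false)) (cif F (cset a i (bit true))).

Definition write a i (P : arrays -> bool) (al : arrays) : arrays :=
  let al' := put a i (bit false) al in if P al' then put a i (bit true) al' else al'.

Lemma cden_write W a i vi F P : tden W i vi -> (forall al, bden al W F (P al)) ->
  cden W (cwrite a i F) (write a vi P).
Proof.
move=> hi hF; apply: (cden_seq (f2 := fun al => if P al then put a vi (bit true) al else al)).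
  exact: cden_set.
by apply: cden_if => //; apply: cden_set.
Qed.

Lemma writeE a i P al b k : write a i P al b k =
  if (b == a) && (k == i) then bit (P (put a i (bit false) al)) else al b k.
Proof. by rewrite /write; case: (P _); rewrite !putE; case: (_ && _). Qed.

Definition write_graph (S : term) : cm :=
  let n := order_term S in
  cseq (cfor n (fun u => cset tapeQ u (bit true)))
  (cseq (cset tapeQ n (bit false))
     (cfor n (fun u => cfor n (fun v => cwrite tapeQ (Add (Add n (K 1)) (Add (Mul u n) v))
        (fand (fnot (feq u v)) (fnot (fquery S u v))))))).

Definition write_graph_sem (s vS : nat) (al : arrays) : arrays :=
  let n := vS ^ e * vS ^ e * J in
  loop n (fun u => loop n (fun v => write tapeQ (n + 1 + (u * n + v))
     (fun al => ~~ (u == v) && ~~ query_adj s (vS ^ e) (al tapeX) u v)))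
   (put tapeQ n (bit false) (loop n (fun u => put tapeQ u (bit true)) al)).

Lemma cden_write_graph s W S vS : wext (world0 s) W -> tden W S vS ->
  cden W (write_graph S) (write_graph_sem s vS).
Proof.
move=> hW hS; have hN := tden_pow e hS.
have hn : tden W (order_term S) (vS ^ e * vS ^ e * J) by rewrite /order_term; tden_tac.
set n := _ * J in hn *.
have c1 : cden W (cfor (order_term S) (fun u => cset tapeQ u (bit true)))
    (loop n (fun u => put tapeQ u (bit true))).
  by apply: (cden_for hn) => W' u w h hu; apply: cden_set.
have c2 : cden W (cset tapeQ (order_term S) (bit false)) (put tapeQ n (bit false)).
  exact: cden_set.
refine (cden_seq c1 (cden_seq c2 _)).
apply: (cden_for hn) => W1 u vu h1 hu; lift_den h1.
apply: (cden_for hn) => W2 v vv h2 hv; lift_den h2; apply: cden_write; first by tden_tac.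
move=> al; apply: bden_and; first by den_tac.
by apply: bden_not; apply: bden_query => //; apply: wext_trans h2; apply: wext_trans h1.
Qed.

(** The second clause is needed within the loops already, as the adjacency formula reads the input
    between two writes. *)
Definition written (x w : seq bool) (m : nat) (al : arrays) : Prop :=
  (forall k, al tapeQ k = if k < m then bit (nth false w k) else None) /\
  (forall a, a != tapeQ -> al a = input_arrays x a).

Lemma written_step x w m al al' b : b = nth false w m -> written x w m al ->
  (forall a k, al' a k = if (a == tapeQ) && (k == m) then bit b else al a k) ->
  written x w m.+1 al'.
Proof.
move=> -> [h1 h2] h; split=> [k|a ne].
  by rewrite h eqxx /= ltnS leq_eqVlt h1; case: eqP => [->|].
by rewrite -h2 //; apply: functional_extensionality => k; rewrite h (negPf ne).
Qed.

Lemma write_graph_correct (x : seq bool) (vS : nat) (N := vS ^ e) (G : sgraph 'I_(N * N * J)) :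
  (forall u v : 'I_(N * N * J), G u v = (u != v) && ~~ query_adj (size x) N (word x) u v) ->
  let al := write_graph_sem (size x) vS (input_arrays x) in
  al tapeQ =1 word (code_graph G) /\ forall a, a != tapeQ -> al a = input_arrays x a.
Proof.
move=> hG; rewrite /write_graph_sem -/N; move: G hG.
move: (N * N * J) => n G hG.
suff [h1 h2] : written x (code_graph G) (n + 1 + n * n)
  (loop n (fun u => loop n (fun v => write tapeQ (n + 1 + (u * n + v))
     (fun al => ~~ (u == v) && ~~ query_adj (size x) N (al tapeX) u v)))
   (put tapeQ n (bit false) (loop n (fun u => put tapeQ u (bit true)) (input_arrays x)))).
  split=> // k; rewrite h1 /word; case: ltnP => hk; last by rewrite nth_default // size_map size_code_graph.
  by rewrite (nth_map false) // size_code_graph.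
apply: (loop_inv (P := fun u => written x (code_graph G) (n + 1 + u * n))).
  rewrite mul0n addn0 addn1; apply: (@written_step _ _ n
    (loop n (fun u => put tapeQ u (bit true)) (input_arrays x)) _ false).
  - by rewrite nth_code_graph_end.
  - apply: (loop_inv (P := written x (code_graph G))); first by split=> // k; rewrite ltn0.
    move=> u al un h; apply: (@written_step _ _ _ _ _ true _ h).
      by rewrite nth_code_graph_unary.
    by move=> a k; rewrite putE.
  - by move=> a k; rewrite putE.
move=> u al un h; rewrite mulSnr.
apply: (loop_inv (P := fun v => written x (code_graph G) (n + 1 + (u * n + v)))) => [|v al' vn h'].
  by rewrite addn0.
rewrite (addnS (u * n)) (addnS (n + 1)).
have [_ hX] := h'.
have XE : put tapeQ (n + 1 + (u * n + v)) (bit false) al' tapeX = word x.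
  by apply: functional_extensionality => k; rewrite putE hX.
have wE := writeE tapeQ (n + 1 + (u * n + v))
   (fun al => ~~ (u == v) && ~~ query_adj (size x) N (al tapeX) u v) al'.
apply: (written_step _ h' wE).
rewrite (nth_code_graph_adj G (Ordinal un) (Ordinal vn)) hG.
by rewrite XE.
Qed.

End Writer.

(** * Reading the answer *)

Definition tapeS : 'I_6 := @Ordinal 6 2 isT.
Definition tapeP : 'I_6 := @Ordinal 6 3 isT.
Definition tapeC : 'I_6 := @Ordinal 6 4 isT.

Lemma cden_eq W C f g : cden W C f -> (forall al, f al = g al) -> cden W C g.
Proof. by move=> h e W' hW al; rewrite h. Qed.

(* Word [u] of the list of leaves in a layout of an [n]-vertex graph in a tree
   with [m] nodes starts at position [p] iff the bit [u * leaf_width n m + p] of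
   [tapeS] is set; bit [u * m + w] of [tapeP] says that vertex [u] is at node [w]. *)
Definition leaf_width (n m : nat) : nat := n * m + 1.

Definition parse_cond (m L u p w : nat) (al : arrays) : bool :=
  (al tapeS (u * L + p) == bit true) &&
  ((al tapeQ (m + 1 + m * m + (p + w)) == bit false) &&
   all (fun i => al tapeQ (m + 1 + m * m + (p + i)) == bit true) (iota 0 w)).

(** The words of the list have unequal lengths, so all starts [p] and lengths [w] are tried. In a
    well-formed answer one pair passes the test for each [u], and it marks the start of the next
    word. *)
Definition parse_sem (n m : nat) (al : arrays) : arrays :=
  let L := leaf_width n m in
  loop n (fun u => loop L (fun p => loop m (fun w al => if parse_cond m L u p w al then
     put tapeP (u * m + w) (bit true) (put tapeS ((u + 1) * L + (p + w + 1)) (bit true) al) else al)))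
   (put tapeS 0 (bit true) al).

(* Bit [(r * m + c) * m + x] of [tapeC]: node [x] is reached from [c] avoiding [r]. *)
Definition close_cond (m r c x y : nat) (al : arrays) : bool :=
  (al tapeC ((r * m + c) * m + x) == bit true) &&
  ((al tapeQ (m + 1 + (x * m + y)) == bit true) && ~~ (y == r)).

Definition close_sem (m : nat) : arrays -> arrays :=
  loop m (fun r => loop m (fun c al =>
    loop m (fun _ => loop m (fun x => loop m (fun y al => if close_cond m r c x y al then
       put tapeC ((r * m + c) * m + y) (bit true) al else al)))
     (put tapeC ((r * m + c) * m + c) (bit true) al))).

Definition check_sem (H : (nat -> Sy) -> nat -> nat -> bool) (n m : nat) (al : arrays) : bool :=
  let P u w := al tapeP (u * m + w) == bit true in
  let C r c w := al tapeC ((r * m + c) * m + w) == bit true in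
  has_lt m (fun r => has_lt m (fun c0 => has_lt m (fun c1 => has_lt m (fun c2 =>
   all (fun u => has_lt m (fun w => P u w && (C r c0 w || (C r c1 w || C r c2 w)))) (iota 0 n) &&
   ~~ has_lt n (fun u => has_lt n (fun v => H (al tapeX) u v &&
       has_lt m (fun w => has_lt m (fun w' => P u w && (P v w' &&
         ((C r c0 w && C r c0 w') || ((C r c1 w && C r c1 w') || (C r c2 w && C r c2 w'))))))))
  )))).

Definition analyse_sem H (n m : nat) (al : arrays) : arrays :=
  let al' := close_sem m (parse_sem n m al) in
  if check_sem H n m al' then put tapeR 0 (bit true) al' else al'.

Section Reader.
Variables (M : machine) (q : {poly nat}) (e kap : nat).
Let J := 3 * 2 ^ kap.

Definition parse_prog (n m : term) : cm :=
  let L := Add (Mul n m) (K 1) in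
  let b := Add (Add m (K 1)) (Mul m m) in
  cseq (cset tapeS (K 0) (bit true))
  (cfor n (fun u => cfor L (fun p => cfor m (fun w =>
    cif (fand (fbit tapeS (Add (Mul u L) p) (bit true))
        (fand (fbit tapeQ (Add b (Add p w)) (bit false))
              (fall w (fun i => fbit tapeQ (Add b (Add p i)) (bit true)))))
     (cseq (cset tapeS (Add (Mul (Add u (K 1)) L) (Add (Add p w) (K 1))) (bit true))
           (cset tapeP (Add (Mul u m) w) (bit true))))))).

Lemma cden_parse W n m vn vm : tden W n vn -> tden W m vm ->
  cden W (parse_prog n m) (parse_sem vn vm).
Proof.
move=> hn hm; refine (cden_seq (cden_set (v := 0) _ _ _) _); first exact: tden_K.
apply: (cden_for hn) => W1 u vu h1 hu; lift_den h1.
apply: cden_for; first by tden_tac.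
move=> W2 p vp h2 hp; lift_den h2.
apply: (cden_for hm) => W3 w vw h3 hw; lift_den h3.
apply: cden_if; first by move=> al; rewrite /parse_cond /leaf_width; den_tac.
by refine (cden_seq (cden_set _ _ _) (cden_set _ _ _)); rewrite /leaf_width; tden_tac.
Qed.

Definition close_prog (m : term) : cm :=
  cfor m (fun r => cfor m (fun c =>
   let k x := Add (Mul (Add (Mul r m) c) m) x in
   cseq (cset tapeC (k c) (bit true))
    (cfor m (fun _ => cfor m (fun x => cfor m (fun y =>
      cif (fand (fbit tapeC (k x) (bit true))
          (fand (fbit tapeQ (Add (Add m (K 1)) (Add (Mul x m) y)) (bit true)) (fnot (feq y r))))
       (cset tapeC (k y) (bit true)))))))).

Lemma cden_close W m vm : tden W m vm -> cden W (close_prog m) (close_sem vm).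
Proof.
move=> hm; apply: (cden_for hm) => W1 r vr h1 hr; lift_den h1.
apply: (cden_for hm) => W2 c vc h2 hc; lift_den h2.
refine (cden_seq (cden_set (v := (vr * vm + vc) * vm + vc) _ _ _) _); first by tden_tac.
apply: (cden_for hm) => W3 i vi h3 hi; lift_den h3.
apply: (cden_for hm) => W4 x vx h4 hx; lift_den h4.
apply: (cden_for hm) => W5 y vy h5 hy; lift_den h5.
apply: cden_if; first by move=> al; rewrite /close_cond; den_tac.
by apply: cden_set; tden_tac.
Qed.

Definition fcheck (S n m : term) : fm :=
  let P u w := fbit tapeP (Add (Mul u m) w) (bit true) in
  let C r c w := fbit tapeC (Add (Mul (Add (Mul r m) c) m) w) (bit true) in
  fex m (fun r => fex m (fun c0 => fex m (fun c1 => fex m (fun c2 =>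
   fand (fall n (fun u => fex m (fun w =>
          fand (P u w) (flor (C r c0 w) (flor (C r c1 w) (C r c2 w))))))
   (fnot (fex n (fun u => fex n (fun v => fand (fquery M q e kap S u v)
       (fex m (fun w => fex m (fun w' => fand (P u w) (fand (P v w')
         (flor (fand (C r c0 w) (C r c0 w')) (flor (fand (C r c1 w) (C r c1 w'))
               (fand (C r c2 w) (C r c2 w')))))))))))))))).

Lemma bden_check al W s S n m vS vn vm : wext (world0 s) W -> tden W S vS -> tden W n vn ->
  tden W m vm ->
  bden al W (fcheck S n m) (check_sem (query_adj M q kap s (vS ^ e)) vn vm al).
Proof.
move=> hW hS hn hm; rewrite /fcheck /check_sem; den_tac.
apply: bden_query => //; repeat (first [exact: hW | apply: wext_trans; last eassumption]).
Qed.

(* Terms have no subtraction, so the number [m = 2 n - 2] of tree nodes is found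
   by search. *)
Definition analyse_graph (S : term) : cm :=
  let n := order_term e kap S in
  cfor (Add n n) (fun m => cif (feq (Add m (K 2)) (Add n n))
    (cseq (parse_prog n m) (cseq (close_prog m)
      (cif (fcheck S n m) (cset tapeR (K 0) (bit true)))))).

Definition analyse_graph_sem (s vS : nat) (al : arrays) : arrays :=
  let n := vS ^ e * vS ^ e * J in
  loop (n + n) (fun m al => if m + 2 == n + n then
     analyse_sem (query_adj M q kap s (vS ^ e)) n m al else al) al.

Lemma cden_analyse_graph s W S vS : wext (world0 s) W -> tden W S vS ->
  cden W (analyse_graph S) (analyse_graph_sem s vS).
Proof.
move=> hW hS; have hN := tden_pow e hS.
have hn : tden W (order_term e kap S) (vS ^ e * vS ^ e * J).
  by rewrite /order_term /side_term; tden_tac.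
set n := _ * J in hn; apply: cden_for; first by tden_tac.
move=> W1 m vm h1 hm; lift_den h1.
apply: (cden_if (P := fun=> vm + 2 == n + n)); first by move=> al; den_tac.
refine (cden_eq (cden_seq (cden_parse hn hm) (cden_seq (cden_close hm) (cden_if _ (cden_set _ _ _)))) _).
- by move=> al; apply: bden_check (wext_trans hW h1) hS hn hm.
- exact: tden_K.
by [].
Qed.

End Reader.

(** * Correctness of the reader *)

Lemma word_cat a b j : word (a ++ b) j = if j < size a then word a j else word b (j - size a).
Proof. by rewrite /word map_cat nth_cat size_map. Qed.

Lemma word_code_nat k j : j <= k -> word (code_nat k) j = bit (j < k).
Proof.
rewrite /word /code_nat => jk; rewrite (nth_map false) ?size_rcons ?size_nseq ?ltnS //.
by rewrite nth_rcons size_nseq nth_nseq; case: ltngtP jk.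
Qed.

Definition leaf_start (s : seq nat) (u : nat) : nat := sumn [seq k.+1 | k <- take u s].

Lemma leaf_startS s u : u < size s -> leaf_start s u.+1 = leaf_start s u + (nth 0 s u).+1.
Proof. by move=> us; rewrite /leaf_start (take_nth 0) // map_rcons sumn_rcons. Qed.

Lemma word_codes s u i : u < size s -> i <= nth 0 s u ->
  word (flatten [seq code_nat k | k <- s]) (leaf_start s u + i) = bit (i < nth 0 s u).
Proof.
elim: s u => [|k s IH] [|u] //= us hi.
  by rewrite /leaf_start /= add0n word_cat size_rcons size_nseq ltnS hi word_code_nat.
rewrite word_cat size_rcons size_nseq /leaf_start /= ltnNge -addnA leq_addr /= addKn.
exact: IH.
Qed.

Lemma leaf_start_le s u m : (forall i, i < size s -> nth 0 s i < m) -> u <= size s ->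
  leaf_start s u <= u * m.
Proof.
move=> hs; elim: u => [|u IH] us; first by rewrite /leaf_start take0.
rewrite leaf_startS // mulSnr leq_add ?hs //.
exact: IH (ltnW us).
Qed.

Lemma bit_inj b b' : (bit b == bit b') = (b == b').
Proof. by case: b b' => [] []. Qed.

Section Parse.
Variables (n m : nat) (s : seq nat) (z : seq bool).
Hypothesis s_size : size s = n.
Hypothesis s_lt : forall i, i < n -> nth 0 s i < m.
Hypothesis z_tail : forall k, word z (m + 1 + m * m + k) = word (flatten [seq code_nat k | k <- s]) k.
Let L := leaf_width n m.
Let st := leaf_start s.

(** The third clause, that [tapeS] is blank after block [u], ensures that the mark set in round [u]
    is the only one of block [u.+1]. *)
Definition parsed (u : nat) (al : arrays) : Prop :=
  [/\ al tapeQ =1 word z,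
      forall p, p < L -> (al tapeS (u * L + p) == bit true) = (p == st u),
      forall k, u.+1 * L <= k -> al tapeS k = None
    & forall u' w, w < m -> (al tapeP (u' * m + w) == bit true) = (u' < u) && (w == nth 0 s u')].

Lemma st_lt u : u <= n -> st u < L.
Proof.
move=> un; rewrite /st /L /leaf_width addn1 ltnS.
apply: leq_trans (leaf_start_le (m := m) _ _) _; rewrite ?s_size //.
by rewrite leq_mul2r un orbT.
Qed.

Lemma parse_condE u al p w : u < n -> al tapeQ =1 word z ->
  (forall p, p < L -> (al tapeS (u * L + p) == bit true) = (p == st u)) ->
  p < L -> w < m -> parse_cond m L u p w al = (p == st u) && (w == nth 0 s u).
Proof.
move=> un hQ hS pL wm; rewrite /parse_cond hS //; case: (eqVneq p (st u)) => //= ->.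
have us : u < size s by rewrite s_size.
have val i : i <= nth 0 s u -> al tapeQ (m + 1 + m * m + (st u + i)) = bit (i < nth 0 s u).
  by move=> hi; rewrite hQ z_tail word_codes.
have [lt|gt|e] := ltngtP w (nth 0 s u).
- by rewrite val ?(ltnW lt) // lt.
- apply/negbTE/negP => /andP[_ /allP/(_ (nth 0 s u))]; rewrite mem_iota gt => /(_ isT).
  by rewrite val // ltnn.
rewrite e val // ltnn eqxx /=; apply/allP => i; rewrite mem_iota /= => hi.
by rewrite val ?(ltnW hi) // hi.
Qed.

Lemma parse_step u al : u < n -> parsed u al -> parsed u.+1
  (loop L (fun p => loop m (fun w al => if parse_cond m L u p w al then
     put tapeP (u * m + w) (bit true) (put tapeS ((u + 1) * L + (p + w + 1)) (bit true) al) else al)) al).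
Proof.
move=> un [hQ hS hN hP]; set ph := nth 0 s u.
pose al1 := put tapeP (u * m + ph) (bit true) (put tapeS ((u + 1) * L + (st u + ph + 1)) (bit true) al).
have us : u < size s by rewrite s_size.
have stS : st u + ph + 1 = st u.+1 by rewrite /st leaf_startS // addn1 addnS.
have hQ1 : al1 tapeQ =1 word z by move=> k; rewrite /al1 !putE /= hQ.
have hS1 p : p < L -> (al1 tapeS (u * L + p) == bit true) = (p == st u).
  move=> pL; rewrite /al1 !putE /=; have -> : (u * L + p == (u + 1) * L + (st u + ph + 1)) = false.
    by rewrite mulnDl mul1n; lia.
  exact: hS.
have stL : st u < L := st_lt (ltnW un).
have -> : loop L (fun p => loop m (fun w al => if parse_cond m L u p w al then
     put tapeP (u * m + w) (bit true) (put tapeS ((u + 1) * L + (p + w + 1)) (bit true) al) else al)) al = al1.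
  have pm : ph < m by apply: s_lt.
  apply: (loop_single stL).
  - apply: (loop_single pm).
    + by rewrite parse_condE // !eqxx.
    + move=> w wp; rewrite parse_condE ?(ltn_trans wp) // eqxx /=.
      by rewrite (ltn_eqF wp).
    + by move=> w pw wm; rewrite parse_condE // eqxx /= (gtn_eqF pw).
  - move=> p ps; apply: loop_id => w wm; rewrite parse_condE ?(ltn_trans ps) //.
    by rewrite (ltn_eqF ps).
  - move=> p sp pL; apply: loop_id => w wm; rewrite parse_condE //.
    by rewrite (gtn_eqF sp).
have st1 : st u.+1 < L by apply: st_lt.
split=> //.
- move=> p pL; rewrite /al1 !putE /= addn1 eqn_add2l stS.
  case: (eqVneq p (st u.+1)) => // _; rewrite hN ?leq_addr //.
- move=> k hk; rewrite /al1 !putE /= ifN; last by rewrite stS addn1; move: hk; rewrite mulSn; lia.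
  by apply: hN; apply: leq_trans hk; rewrite leq_mul2r leqnSn orbT.
move=> u' w wm; rewrite /al1 !putE /= (fun_if (fun x => x == bit true)) hP // eqxx.
have pm : ph < m by apply: s_lt.
rewrite ltnS [u' <= u]leq_eqVlt; case: (eqVneq u' u) => [->|ne] /=.
  by rewrite eqn_add2l ltnn -/ph; case: (eqVneq w ph).
have -> // : (u' * m + w == u * m + ph) = false.
by case: (ltngtP u' u) ne => // h _; nia.
Qed.

Lemma parse_correct al : al tapeQ =1 word z -> al tapeS = (fun=> None) -> al tapeP = (fun=> None) ->
  let al' := parse_sem n m al in
  al' tapeQ =1 word z /\
  forall u w, u < n -> w < m -> (al' tapeP (u * m + w) == bit true) = (w == nth 0 s u).
Proof.
move=> hQ hS hP al'; have : parsed n al'; last first.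
  by case=> h1 _ _ h4; split=> // u w un wm; rewrite h4 // un.
apply: (loop_inv (P := parsed)); last exact: parse_step.
split=> [k|p pL|k hk|u w wm]; rewrite putE /=.
- by rewrite hQ.
- by rewrite mul0n add0n hS /st /leaf_start take0 /=; case: (p == 0).
- have -> : (k == 0) = false by apply/negP => /eqP k0; move: hk; rewrite k0 /L /leaf_width; lia.
  by rewrite hS.
- by rewrite hP.
Qed.

End Parse.

Section Close.
Variables (m : nat) (T : sgraph 'I_m) (Y : nat -> Sy).
Hypothesis Y_adj : forall x y : 'I_m, (Y (m + 1 + (x * m + y)) == bit true) = T x y.

Definition reached (al : arrays) (r c x : nat) : bool :=
  al tapeC ((r * m + c) * m + x) == bit true.

Lemma reached_put al r c x r' c' x' : c < m -> x < m -> c' < m -> x' < m ->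
  reached (put tapeC ((r * m + c) * m + x) (bit true) al) r' c' x' =
  [&& r' == r, c' == c & x' == x] || reached al r' c' x'.
Proof.
move=> cm xm cm' xm'; rewrite /reached putE /=.
case: (eqVneq ((r' * m + c') * m + x') ((r * m + c) * m + x)) => [e|ne] /=.
  have [a1 a2 a3] := vert_div r cm xm; have [b1 b2 b3] := vert_div r' cm' xm'.
  by move: b1 b2 b3; rewrite /vert e -/(vert m m r c x) a1 a2 a3 => <- <- <-; rewrite !eqxx.
by case: (eqVneq r' r) => //= er; case: (eqVneq c' c) => //= ec; case: (eqVneq x' x) => //= ex;
  move: ne; rewrite er ec ex eqxx.
Qed.

Definition close_inv (al : arrays) : Prop :=
  al tapeQ =1 Y /\ forall r c x : 'I_m, reached al r c x -> connect (avoid T r) c x.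

Definition step_sem (r c x y : nat) (al : arrays) : arrays :=
  if close_cond m r c x y al then put tapeC ((r * m + c) * m + y) (bit true) al else al.

Definition round_sem (r c : nat) : arrays -> arrays :=
  loop m (fun x => loop m (fun y => step_sem r c x y)).

Lemma close_condE al (r c x y : 'I_m) : al tapeQ =1 Y ->
  close_cond m r c x y al = reached al r c x && avoid T r x y.
Proof. by move=> hQ; rewrite /close_cond -/(reached _ _ _ _) hQ Y_adj. Qed.

Lemma step_inv (r c x y : nat) al : r < m -> c < m -> x < m -> y < m ->
  close_inv al -> close_inv (step_sem r c x y al).
Proof.
move=> rm cm xm ym [hQ hC]; rewrite /step_sem.
have := close_condE (Ordinal rm) (Ordinal cm) (Ordinal xm) (Ordinal ym) hQ => /= ->.
case: ifP => // /andP[hx hxy]; split=> [k|r' c' x']; first by rewrite putE /= hQ.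
rewrite reached_put // => /orP[/and3P[/eqP e1 /eqP e2 /eqP e3]|/hC //].
have {e1}-> : r' = Ordinal rm by apply: val_inj.
have {e2}-> : c' = Ordinal cm by apply: val_inj.
have {e3}-> : x' = Ordinal ym by apply: val_inj.
by apply: connect_trans (connect1 hxy); apply: (hC (Ordinal rm) (Ordinal cm) (Ordinal xm)).
Qed.

Lemma step_mono r c x y al r' c' x' : c < m -> y < m -> c' < m -> x' < m ->
  reached al r' c' x' -> reached (step_sem r c x y al) r' c' x'.
Proof.
move=> cm ym cm' xm' h; rewrite /step_sem; case: ifP => // _.
by rewrite reached_put // h orbT.
Qed.

Lemma round_inv r c al : r < m -> c < m -> close_inv al -> close_inv (round_sem r c al).
Proof.
move=> rm cm h; apply: (loop_inv (P := fun _ => close_inv)) => // x al' xm h'.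
by apply: (loop_inv (P := fun _ => close_inv)) => // y al'' ym; apply: step_inv.
Qed.

Lemma round_mono r c al r' c' x' : c < m -> c' < m -> x' < m ->
  reached al r' c' x' -> reached (round_sem r c al) r' c' x'.
Proof.
move=> cm cm' xm' h; apply: (loop_inv (P := fun _ a => reached a r' c' x')) => // x al' xm h'.
by apply: (loop_inv (P := fun _ a => reached a r' c' x')) => // y al'' ym; apply: step_mono.
Qed.

Lemma round_hit (r c x y : 'I_m) al : close_inv al -> reached al r c x -> avoid T r x y ->
  reached (round_sem r c al) r c y.
Proof.
move=> hI hx xy.
pose I a := close_inv a /\ reached a r c x.
have stepI v w a : v < m -> w < m -> I a -> I (step_sem r c v w a).
  by move=> vm wm [h1 h2]; split; [apply: step_inv | apply: step_mono].
have hit a : I a -> reached (loop m (fun w => step_sem r c x w) a) r c y.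
  move=> ia; apply: (loop_hit (I := I) (Q := fun b => reached b r c y) (ltn_ord y)) => //.
  - by move=> w b wm; apply: stepI.
  - move=> b [[hQ _] hx']; rewrite /step_sem close_condE // hx' xy /=.
    by rewrite reached_put // !eqxx.
  - by move=> w b wm; apply: step_mono.
apply: (loop_hit (I := I) (Q := fun b => reached b r c y) (ltn_ord x)) => //.
- move=> v b vm ib; apply: (loop_inv (P := fun _ => I)) => // w b' wm; exact: stepI.
- by move=> v b vm hb; apply: (loop_inv (P := fun _ a => reached a r c y)) => // w a wm; apply: step_mono.
Qed.

Definition source_sem (r c : nat) (al : arrays) : arrays :=
  loop m (fun _ => round_sem r c) (put tapeC ((r * m + c) * m + c) (bit true) al).

Lemma source_inv r c al : r < m -> c < m -> close_inv al -> close_inv (source_sem r c al).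
Proof.
move=> rm cm [hQ hC]; apply: (loop_inv (P := fun _ => close_inv)) => [|i a _]; last exact: round_inv.
split=> [k|r' c' x']; first by rewrite putE /= hQ.
rewrite reached_put // => /orP[/and3P[_ /eqP ec /eqP ex]|/hC //].
by have -> : x' = c' by apply: val_inj; rewrite /= ec ex.
Qed.

Lemma source_mono r c al r' c' x' : c < m -> c' < m -> x' < m ->
  reached al r' c' x' -> reached (source_sem r c al) r' c' x'.
Proof.
move=> cm cm' xm' h; apply: (loop_inv (P := fun _ a => reached a r' c' x')) => [|i a _]; last exact: round_mono.
by rewrite reached_put // h orbT.
Qed.

(** After [i] rounds the first [i] steps of a simple path from [c] have been followed, and such a
    path has fewer than [m] steps. *)
Lemma source_hit (r c x : 'I_m) al : close_inv al -> connect (avoid T r) c x ->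
  reached (source_sem r c al) r c x.
Proof.
move=> hI /connectP[p0 cp ->]; case/shortenP: cp => p cp up _.
have sp : size p < m by move/card_uniqP: up (max_card (mem (c :: p))) => /= ->; rewrite card_ord.
suff [_] : close_inv (source_sem r c al) /\
    forall i, i <= m -> i <= size p -> reached (source_sem r c al) r c (last c (take i p)).
  by move=> /(_ (size p) (ltnW sp) (leqnn _)); rewrite take_size.
have [rm cm] : r < m /\ c < m by [].
apply: (loop_inv (P := fun k a => close_inv a /\
   forall i, i <= k -> i <= size p -> reached a r c (last c (take i p)))) => [|k a _ [ia ha]].
  have [hQ hC] := hI; split; last first.
    by move=> i; rewrite leqn0 => /eqP-> _; rewrite take0 /= reached_put // !eqxx.
  split=> [k|r' c' x']; first by rewrite putE /= hQ.
  rewrite reached_put // => /orP[/and3P[_ /eqP ec /eqP ex]|/hC //].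
  by have -> : x' = c' by apply: val_inj; rewrite /= ec ex.
split; first exact: round_inv.
move=> i; rewrite leq_eqVlt => /predU1P[->|]; last first.
  by rewrite ltnS => ik ip; apply: round_mono => //; apply: ha.
move=> kp; apply: (round_hit ia (ha k (leqnn k) (ltnW kp))).
move: cp; rewrite -{1}(cat_take_drop k p) cat_path => /andP[_].
by rewrite (drop_nth c) // => /= /andP[h _]; rewrite (take_nth c) // last_rcons.
Qed.

Lemma close_correct al : al tapeQ =1 Y -> al tapeC = (fun=> None) ->
  forall r c x : 'I_m, reached (close_sem m al) r c x = connect (avoid T r) c x.
Proof.
move=> hQ hC r c x.
have hI : close_inv al by split=> // r' c' x'; rewrite /reached hC.
have inner r' a : r' < m -> close_inv a -> close_inv (loop m (source_sem r') a).
  move=> rm' ia; apply: (loop_inv (P := fun _ => close_inv)) => // c' b cm'; exact: source_inv.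
have fin : close_inv (close_sem m al).
  apply: (loop_inv (P := fun _ => close_inv)) => // r' a rm'; exact: inner.
apply/idP/idP; first by case: fin => _; apply.
move=> h; pose Q a := reached a r c x.
apply: (loop_hit (I := close_inv) (Q := Q) (ltn_ord r)) => //.
  move=> a ia; apply: (loop_hit (I := close_inv) (Q := Q) (ltn_ord c)) => //.
  - by move=> c' b cm'; apply: source_inv.
  - by move=> b ib; apply: source_hit.
  - by move=> c' b cm'; apply: source_mono.
by move=> r' b rm' qb; apply: (loop_inv (P := fun _ => Q)) => // c' a cm'; apply: source_mono.
Qed.

End Close.

(** An answer to an instance without a solution can be any word, so the colouring is read off
    arbitrary arrays: a vertex gets the number of the first of the three classes in which it is
    found. Hence no answer can make the machine accept a word outside the language. *)
Lemma check_sound H n m al : check_sem H n m al -> exists f : nat -> nat,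
  (forall u, f u < 3) /\ forall u v, u < n -> v < n -> H (al tapeX) u v -> f u != f v.
Proof.
case/has_ltP=> r _ /has_ltP[c0 _ /has_ltP[c1 _ /has_ltP[c2 _ /andP[/allP hall /has_ltP hno]]]].
pose c i := nth c2 [:: c0; c1] i.
pose cls i u := has_lt m (fun w => (al tapeP (u * m + w) == bit true) &&
  (al tapeC ((r * m + c i) * m + w) == bit true)).
pose f u := if cls 0 u then 0 else if cls 1 u then 1 else 2.
have f3 u : f u < 3 by rewrite /f; case: (cls 0 u); case: (cls 1 u).
have fc u : u < n -> cls (f u) u.
  move=> un; have /hall/has_ltP[w wm /andP[wP wC]] : u \in iota 0 n by rewrite mem_iota.
  rewrite /f; case: ifP => // no0; case: ifP => // no1.
  apply/has_ltP; exists w => //; rewrite wP /=; case/or3P: wC => // h.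
    by case/negP: (negbT no0); apply/has_ltP; exists w; rewrite // wP.
  by case/negP: (negbT no1); apply/has_ltP; exists w; rewrite // wP.
exists f; split=> // u v un vn huv; apply/eqP => e; apply: hno; exists u => //.
apply/has_ltP; exists v => //; rewrite huv /=.
have /has_ltP[w wm /andP[wP wC]] := fc u un; have /has_ltP[w' wm' /andP[wP' wC']] := fc v vn.
apply/has_ltP; exists w => //; apply/has_ltP; exists w' => //; rewrite wP wP' /=.
move: wC wC'; rewrite -e; have := f3 u.
by case: (f u) => [|[|[|]]] // _; rewrite /c /= => -> ->; rewrite ?orbT.
Qed.

Lemma check_complete (H : (nat -> Sy) -> nat -> nat -> bool) n m al (T : sgraph 'I_m)
    (phi : 'I_n -> 'I_m) r c :
  (forall (u : 'I_n) (w : 'I_m), (al tapeP (u * m + w) == bit true) = (w == phi u)) ->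
  (forall r c x : 'I_m, reached m al r c x = connect (avoid T r) c x) ->
  splits T phi (fun u v : 'I_n => H (al tapeX) u v) r c -> check_sem H n m al.
Proof.
move=> hP hC [_ hall hno].
apply/has_ltP; exists r => //; apply/has_ltP; exists (c 0) => //.
apply/has_ltP; exists (c 1) => //; apply/has_ltP; exists (c 2) => //.
apply/andP; split.
  apply/allP => u; rewrite mem_iota => un; have [i i3 hi] := hall (Ordinal un).
  apply/has_ltP; exists (phi (Ordinal un)) => //.
  rewrite (hP (Ordinal un)) eqxx /= -!/(reached _ _ _ _ _) !hC.
  by move: hi; case: i i3 => [|[|[|]]] // _ ->; rewrite ?orbT.
apply/has_ltP => -[u un /has_ltP[v vn /andP[huv]]].
case/has_ltP=> w wm /has_ltP[w' wm'] /and3P[hw hw'].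
have := hno (Ordinal un) (Ordinal vn) ^~ huv => no.
move: hw hw'; rewrite (hP (Ordinal un) (Ordinal wm)) (hP (Ordinal vn) (Ordinal wm')).
move=> /eqP ew /eqP ew'.
have rE i x (xm : x < m) : (al tapeC ((r * m + c i) * m + x) == bit true) = connect (avoid T r) (c i) (Ordinal xm).
  exact: (hC r (c i) (Ordinal xm)).
rewrite !rE ew ew'.
by case/or3P => h; [case/negP: (no 0) | case/negP: (no 1) | case/negP: (no 2)].
Qed.

Lemma parse_keep n m al a : a != tapeS -> a != tapeP -> parse_sem n m al a = al a.
Proof.
move=> aS aP; apply: functional_extensionality => k.
apply: (loop_inv (P := fun _ b => b a k = al a k)) => [|u b _ hb]; first by rewrite putE (negPf aS).
apply: (loop_inv (P := fun _ b => b a k = al a k)) => // p b' _ hb'.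
apply: (loop_inv (P := fun _ b => b a k = al a k)) => // w b'' _ hb''.
by case: ifP => // _; rewrite !putE (negPf aS) (negPf aP).
Qed.

Lemma close_keep m al a : a != tapeC -> close_sem m al a = al a.
Proof.
move=> aC; apply: functional_extensionality => k.
apply: (loop_inv (P := fun _ b => b a k = al a k)) => // r b _ hb.
apply: (loop_inv (P := fun _ b => b a k = al a k)) => // c b' _ hb'.
apply: (loop_inv (P := fun _ b => b a k = al a k)) => [|i d _ hd]; first by rewrite putE (negPf aC).
apply: (loop_inv (P := fun _ b => b a k = al a k)) => // x d' _ hd'.
apply: (loop_inv (P := fun _ b => b a k = al a k)) => // y d'' _ hd''.
by case: ifP => // _; rewrite putE (negPf aC).
Qed.

Lemma analyse_result H n m al : al tapeR 0 = None ->
  (analyse_sem H n m al tapeR 0 == bit true) = check_sem H n m (close_sem m (parse_sem n m al)).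
Proof.
move=> hR; rewrite /analyse_sem; case: ifP => h; first by rewrite putE.
by rewrite close_keep // parse_keep // hR.
Qed.

Lemma layout_word_adj n m (T : sgraph 'I_m) (phi : 'I_n -> 'I_m) (x y : 'I_m) :
  word (code_layout T phi) (m + 1 + (x * m + y)) = bit (T x y).
Proof.
have lt : m + 1 + (x * m + y) < size (code_graph T).
  rewrite size_code_graph ltn_add2l; apply: leq_trans (_ : x.+1 * m <= _).
    by rewrite mulSnr ltn_add2l.
  by rewrite leq_mul2r ltn_ord orbT.
by rewrite /code_layout word_cat lt /word (nth_map false) // nth_code_graph_adj.
Qed.

Lemma layout_word_tail n m (T : sgraph 'I_m) (phi : 'I_n -> 'I_m) k :
  word (code_layout T phi) (m + 1 + m * m + k) =
  word (flatten [seq code_nat i | i <- [seq val (phi u) | u <- enum 'I_n]]) k.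
Proof.
rewrite /code_layout word_cat size_code_graph ltnNge leq_addr /= addKn.
by rewrite -map_comp.
Qed.

Lemma analyse_complete (H : (nat -> Sy) -> nat -> nat -> bool) n m al (T : sgraph 'I_m)
    (phi : 'I_n -> 'I_m) r c :
  al tapeQ =1 word (code_layout T phi) ->
  al tapeS = (fun=> None) -> al tapeP = (fun=> None) -> al tapeC = (fun=> None) ->
  splits T phi (fun u v : 'I_n => H (al tapeX) u v) r c ->
  check_sem H n m (close_sem m (parse_sem n m al)).
Proof.
move=> hQ hS hP hC hsplit.
pose s := [seq val (phi u) | u <- enum 'I_n].
have sn : size s = n by rewrite size_map size_enum_ord.
have snth (u : 'I_n) : nth 0 s u = phi u by rewrite (nth_map u) ?size_enum_ord // nth_ord_enum.
have slt i : i < n -> nth 0 s i < m by move=> hi; rewrite (snth (Ordinal hi)).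
have [pQ pP] := parse_correct sn slt (layout_word_tail T phi) hQ hS hP.
have pC : parse_sem n m al tapeC = (fun=> None) by rewrite parse_keep.
have Yadj (x y : 'I_m) : (word (code_layout T phi) (m + 1 + (x * m + y)) == bit true) = T x y.
  by rewrite layout_word_adj bit_inj eqb_id.
apply: (check_complete (T := T) (phi := phi) (r := r) (c := c)).
- by move=> u w; rewrite close_keep // pP // snth.
- move=> r0 c0 x0; exact: (@close_correct m T (word (code_layout T phi)) Yadj _ pQ pC r0 c0 x0).
by rewrite close_keep // parse_keep.
Qed.

(** * The reduction *)

Lemma polyb_horner (p : {poly nat}) : polyb (fun s => p.[s])%R.
Proof.
rewrite /horner; elim: (polyseq p) => [|a r IH]; first exact: (polyb_const 0).
apply: (polyb_le (g := fun s => horner_rec r s * s + a)) => [b|]; first exact: leqnn.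
by apply: polyb_add (polyb_const a); apply: polyb_mul IH polyb_id.
Qed.

Lemma horner_mono (p : {poly nat}) a b : a <= b -> (p.[a])%R <= (p.[b])%R.
Proof.
rewrite /horner => ab; elim: (polyseq p) => //= c r IH.
by rewrite leq_add2r leq_mul.
Qed.

Lemma code_graph_inj n n' (G : sgraph 'I_n) (G' : sgraph 'I_n') :
  code_graph G = code_graph G' -> n = n'.
Proof.
move=> e; apply/eqP; rewrite eqn_leq; apply/andP; split; rewrite leqNgt; apply/negP => lt.
  by have := nth_code_graph_unary G lt; rewrite e nth_code_graph_end.
by have := nth_code_graph_unary G' lt; rewrite -e nth_code_graph_end.
Qed.

Lemma code_graph_adj_inj n (G G' : sgraph 'I_n) :
  code_graph G = code_graph G' -> forall u v, G u v = G' u v.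
Proof. by move=> e u v; rewrite -!nth_code_graph_adj e. Qed.

(** This bounds the number of vertices of the gadget graph that have edges, as these have small
    remainders modulo [J]. *)
Lemma card_mod_lt A J w : w <= J -> #|[pred u : 'I_(A * J) | u %% J < w]| <= A * w.
Proof.
move=> wJ; rewrite cardE; set s := enum _.
pose f (u : 'I_(A * J)) := (u %/ J) * w + u %% J.
have sub : {subset [seq f u | u <- s] <= iota 0 (A * w)}.
  move=> i /mapP[u]; rewrite mem_enum inE => uw ->; rewrite mem_iota /= add0n.
  have J0 : 0 < J by case: (J) (u) => // -[k]; rewrite muln0.
  have uA : u %/ J < A by rewrite ltn_divLR.
  apply: leq_trans (_ : (u %/ J).+1 * w <= _); last by rewrite leq_mul2r uA orbT.
  by rewrite /f mulSn addnC ltn_add2r.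
have := uniq_leq_size _ sub; rewrite size_map size_iota; apply.
rewrite map_inj_in_uniq ?enum_uniq // => u v; rewrite !mem_enum !inE => uw vw e.
have w0 : 0 < w by apply: leq_trans uw.
have ed : u %/ J = v %/ J.
  by have := congr1 (divn ^~ w) e; rewrite /= /f divnMDl // divnMDl // (divn_small uw) (divn_small vw) !addn0.
apply: val_inj; rewrite /= (divn_eq u J) (divn_eq v J) ed.
by move: e; rewrite /f ed => /addnI ->.
Qed.

(** * The results on optimal layouts for an order that only provably equals [3 * 2 ^ k.+1] *)

Section SplitAtSize.
Variables (n k : nat) (H : rel 'I_n) (G : sgraph 'I_n) (S : {pred 'I_n}) (f : 'I_n -> nat).
Hypothesis nk : n = 3 * 2 ^ k.+1.
Hypothesis irrH : irreflexive H.
Hypothesis GH : forall u v, G u v = (u != v) && ~~ H u v.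
Hypothesis HS : forall u v, H u v -> (u \in S) && (v \in S).
Hypothesis S_small : 4 * #|S| <= 2 ^ k.+1.
Hypothesis f3 : forall u, f u < 3.
Hypothesis fH : forall u v, H u v -> f u != f v.

Lemma min_layout_exists : exists (m : nat) (T : sgraph 'I_m) (phi : 'I_n -> 'I_m),
  min_tree_layout G T phi.
Proof.
move: nk; clear nk => nk; subst n.
have [T [phi h]] := exists_min_layout irrH GH HS S_small f3 fH.
by exists (2 * (3 * 2 ^ k.+1) - 3).+1, T, phi.
Qed.

Lemma min_layout_split (m : nat) (T : sgraph 'I_m) (phi : 'I_n -> 'I_m) :
  min_tree_layout G T phi -> m + 2 = n + n /\ exists r c, splits T phi H r c.
Proof.
move: nk; clear nk => nk; subst n => h.
have [] := min_layout_splits irrH GH HS S_small f3 fH h.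
by rewrite card_ord mul2n -addnn.
Qed.

End SplitAtSize.

Section Reduction.
Variables (M : machine) (p q : {poly nat}) (L : language).
Hypothesis M_oracle_free : oracle_free M.
Hypothesis M_halts : forall x y : seq bool, exists b : bool,
  halts_within no_oracle M x y b p.[(size x + size y)%N]%R.
Hypothesis M_verifies : forall x : seq bool, L x <-> exists y : seq bool,
  size y <= q.[size x]%R /\ exists t : nat, halts_within no_oracle M x y true t.

(** Halting configurations are fixed points of [step], so every accepting run is still accepting at
    the common time [N.-1]. *)
Lemma accepts_at x N : (p.[(size x + q.[size x])%N])%R < N ->
  L x <-> exists2 y, size y <= q.[size x]%R & halts_within no_oracle M x y true N.-1.
Proof.
move=> hN; split=> [/M_verifies[y [hy [t ht]]]|[y hy ht]]; last first.
  by apply/M_verifies; exists y; split=> //; exists N.-1.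
exists y => //; have [b hb] := M_halts x y.
have le : (p.[(size x + size y)%N])%R <= N.-1.
  have h1 : size x + size y <= size x + (q.[size x])%R by rewrite leq_add2l.
  by apply: leq_trans (horner_mono p h1) _; move: hN; lia.
have := halts_stable hb le.
have := halts_stable ht (leq_maxl t N.-1); have := halts_stable (halts_stable hb le) (leq_maxr t N.-1).
by rewrite /halts_within => -> [->].
Qed.

Let g := label_bound M.
(** A cell is padded to [J = 3 * 2 ^ kap] vertices, of which at most [2 * g + 3] have edges. As
    [2 ^ kap >= 4 * (2 * g + 3)], the vertices with edges amount to at most a quarter of a
    branch. *)
Let kap := 4 * (2 * g + 3).
Let J := 3 * 2 ^ kap.

Lemma g_odd : odd g.
Proof. by rewrite /g /label_bound /= oddM. Qed.

Lemma kap_big : 4 * (2 * g + 3) <= 2 ^ kap.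
Proof. exact: ltnW (ltn_expl _ _). Qed.

Lemma J_big : 2 * g + 3 <= J.
Proof. by have := kap_big; rewrite /J; lia. Qed.

Lemma accepts_colouring x N : (p.[(size x + q.[size x])%N])%R < N ->
  L x <-> exists f, colouring g J N (@right_index M) (@down_index M)
                      (@ok_index M (word x) N (q.[size x])%R) f.
Proof.
move=> hN; have N0 : 0 < N by apply: leq_trans hN.
rewrite (accepts_at hN); split.
  case=> y hy acc; have [Lab hL] := tableau_complete M_oracle_free N0 hy acc.
  have /is_labelling_index[lab hlab] : exists L0 : nat -> nat -> label M, labelling N (q.[size x])%R x L0 by exists Lab.
  exact: labelling_colouring g_odd isT J_big _ hlab.
case=> f hf; have [lab hlab] := colouring_labelling g_odd isT J_big N0 hf.
have /is_labelling_index[Lab hL] : exists lab, is_labelling g N (@right_index M) (@down_index M)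
  (@ok_index M (word x) N (q.[size x])%R) lab by exists lab.
by have [y hy acc] := tableau_sound M_oracle_free N0 hL; exists y.
Qed.

Lemma gadget_irrefl N hr vr ok : irreflexive (gadget g J N hr vr ok).
Proof. by move=> u; rewrite /gadget eqxx. Qed.

Lemma gadget_sym N hr vr ok : symmetric (gadget g J N hr vr ok).
Proof. by move=> u v; rewrite /gadget eq_sym orbC. Qed.

Lemma gadget_support N hr vr ok u v : gadget g J N hr vr ok u v ->
  (u %% J < 2 * g + 3) && (v %% J < 2 * g + 3).
Proof.
suff arcS a b : arc g J N hr vr ok a b -> (a %% J < 2 * g + 3) && (b %% J < 2 * g + 3).
  by case/andP => _ /orP[/arcS//|/arcS]; rewrite andbC.
case/arcP=> t [d [j [t' [d' [j' [[_ hd hj] [_ hd' hj'] -> -> h]]]]]].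
have [_ _ ->] := vert_div t hd hj; have [_ _ ->] := vert_div t' hd' hj'.
case/or4P: h.
- case/and4P=> _ _ jg /or3P[/andP[/eqP-> h]|/andP[_ /eqP->]|/eqP->]; lia.
- case/and3P=> _ _ /has_ltP[i ig /andP[/eqP-> /orP[/eqP->|/andP[/eqP-> _]]]]; last lia.
  by case: odd; lia.
- by case/has_ltP=> i ig /has_ltP[i' ig' /and3P[/eqP-> /eqP-> _]]; lia.
by case/and5P=> _ _ _ _ /and3P[h1 h2 h3]; lia.
Qed.

Lemma reduction_correct : turing_reducible L MinTreeLength.
Proof.
(* The power [(size x + 2) ^ e] exceeds the time bound, and the selected power of two is at least
   [size x + 2], so [N] exceeds it too. *)
have [e he] : polyb (fun s => (p.[(s + q.[s])%N])%R + 1).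
  apply: polyb_add (polyb_const 1); have [c hc] := polyb_horner p.
  apply: (polyb_le (fun s => hc _)); apply: polyb_pow.
  exact: polyb_add polyb_id (polyb_horner q).
have [Mred [pt hred]] := cmd_machine (cselect (write_graph M q e kap) 1) (cselect (analyse_graph M q e kap) 1).
exists Mred, pt => O hO x.
have [i hi] := selected_exists (size x).
pose N := (2 ^ i) ^ e; pose n := N * N * J.
have hN : (p.[(size x + q.[size x])%N])%R < N.
  have := he (size x); rewrite addn1 => h; apply: leq_trans h _.
  case/and3P: hi => h _ _; rewrite /N; case: (e) => // e'; by rewrite leq_exp2r.
have N0 : 0 < N by apply: leq_trans hN.
pose H (u v : 'I_n) := query_adj M q kap (size x) N (word x) u v.
have Hirr : irreflexive H by move=> u; apply: gadget_irrefl.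
have Hsym : symmetric H by move=> u v; apply: gadget_sym.
pose Gr (u v : 'I_n) := (u != v) && ~~ H u v.
have Gsym : symmetric Gr by move=> u v; rewrite /Gr eq_sym Hsym.
have Girr : irreflexive Gr by move=> u; rewrite /Gr eqxx.
pose G := SGraph Gsym Girr.
have GH u v : G u v = (u != v) && ~~ H u v by [].
pose S := [pred u : 'I_n | u %% J < 2 * g + 3].
have HS u v : H u v -> (u \in S) && (v \in S) by move=> h; exact: gadget_support h.
pose k := (2 * (i * e) + kap).-1.
have k1 : k.+1 = 2 * (i * e) + kap.
  by rewrite prednK // addn_gt0; apply/orP; right; rewrite /kap; lia.
have NN : N * N = 2 ^ (2 * (i * e)) by rewrite /N -expnM mulnn -expnM mulnC.
have nk : n = 3 * 2 ^ k.+1.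
  by rewrite /n /J k1 expnD -NN mulnCA.
have Ssmall : 4 * #|S| <= 2 ^ k.+1.
  have := card_mod_lt (N * N) J_big; rewrite -/S => hS.
  rewrite k1 expnD -NN; apply: leq_trans (_ : N * N * (4 * (2 * g + 3)) <= _).
    by rewrite mulnCA leq_mul2l.
  by rewrite leq_mul2l kap_big orbT.
have cden1 := cselect_eval (f := write_graph_sem M q e kap (size x)) (input_arrays x) hi
   (fun W St v hW hS => cden_write_graph M q e kap hW hS).
have [wQ wO] := write_graph_correct (x := x) (vS := 2 ^ i) (M := M) (q := q) (e := e) (kap := kap) (G := G) GH.
set al1 := write_graph_sem M q e kap (size x) (2 ^ i) (input_arrays x) in wQ wO.
have := hred O x (code_graph G); rewrite cden1 -/al1 => /(_ wQ).
have cden2 al := cselect_eval (f := analyse_graph_sem M q e kap (size x)) al hi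
   (fun W St v hW hS => cden_analyse_graph M q e kap hW hS).
rewrite cden2; set al2 := upd al1 tapeQ _ => hM.
exists (analyse_graph_sem M q e kap (size x) (2 ^ i) al2 tapeR 0 == bit true); split; first exact: hM.
have n0 : 1 < n by rewrite nk; have := expn_gt0 2 k.+1; lia.
pose m0 := n + n - 2.
have m0E : m0 + 2 = n + n by rewrite /m0; lia.
have -> : analyse_graph_sem M q e kap (size x) (2 ^ i) al2 =
          analyse_sem (query_adj M q kap (size x) N) n m0 al2.
  apply: (loop_once (c := fun m _ => m + 2 == n + n)).
  - by rewrite /m0; lia.
  - by move=> v hv; apply/eqP; lia.
  - by apply/eqP.
  - by move=> v hv _; apply/eqP; lia.
have al2E a : a != tapeQ -> al2 a = input_arrays x a.
  by move=> ha; rewrite /al2 /upd (negPf ha) wO.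
have al2X : al2 tapeX = word x by rewrite al2E.
rewrite analyse_result; last by rewrite al2E.
split.
  have alX : close_sem m0 (parse_sem n m0 al2) tapeX = word x.
    by rewrite (close_keep m0 _ (a := tapeX)) // (parse_keep n m0 al2 (a := tapeX)) // al2X.
  move: alX; move: (close_sem _ _) => al3 alX hc.
  have [f [f3 fH]] := check_sound hc; rewrite alX in fH.
  apply/(accepts_colouring hN); exists f; split; [exact: f3 | move=> u v un vn h].
  exact: (fH u v un vn h).
case/(accepts_colouring hN) => f [f3 fH].
have fH' (u v : 'I_n) : H u v -> f u != f v by move=> h; apply: fH.
have [m [T [phi hmin]]] := min_layout_exists nk Hirr GH HS Ssmall (fun u => f3 u) fH'.
(* The colouring makes the instance solvable and thereby binds the oracle. The solution comes with
   an order and a graph of its own, which the common code identifies with [n] and [G]. *)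
have /hO : exists y, MinTreeLength (code_graph G) y.
  by exists (code_layout T phi), n, G, m, T, phi.
case=> n' [G' [m' [T' [phi' [eG eO hmin']]]]].
have en := code_graph_inj eG; subst n'.
have GH' u v : G' u v = (u != v) && ~~ H u v by rewrite -(code_graph_adj_inj eG).
have [em [r [c hs]]] := min_layout_split nk Hirr GH' HS Ssmall (fun u => f3 u) fH' hmin'.
have em0 : m' = m0 by apply/eqP; rewrite -(eqn_add2r 2) em m0E.
subst m'.
apply: (analyse_complete (T := T') (phi := phi') (r := r) (c := c)).
- by move=> j; rewrite /al2 /upd eqxx eO.
- by rewrite al2E.
- by rewrite al2E.
- by rewrite al2E.
by rewrite al2X.
Qed.

End Reduction.

Theorem theorem4 : NP_hard MinTreeLength.
Proof.
move=> L [M [p [q [hfree hhalt hver]]]].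
exact: reduction_correct hfree hhalt hver.
Qed.
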